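(* Let $K$ be a number field of degree $m$ over $\mathbb{Q}$, let $n\ge2$, and let $\rho$ be the natural representation of $\mathrm{SL}_n$. Then $$\gamma^p(n,K)=\gamma^W(\mathrm{SL}_n,\rho)^m.$$
   Context: Let $K$ have $r$ real and $s$ pairs of complex embeddings, $m=r+2s$, with embeddings $\sigma_1,\dots,\sigma_r$ real and $\sigma_{r+j}=\overline{\sigma_{r+s+j}}$ complex ($1\le j\le s$). An $n$-dimensional Humbert form over $K$ is a tuple $S=(S_1,\dots,S_{r+s})$ with $S_1,\dots,S_r$ positive definite real symmetric $n\times n$ matrices and $S_{r+1},\dots,S_{r+s}$ positive definite hermitian $n\times n$ matrices; $\mathcal P_{K,n}$ is the set of these. With $S_i[y]=y^*S_iy$, set, for $x\in\mathcal{O}_K^n$, $S[x]=\prod_{i=1}^rS_i[x^{\sigma_i}]\cdot\bigl(\prod_{i=r+1}^{r+s}S_i[x^{\sigma_i}]\bigr)^2$ and $\det(S)=\prod_{i=1}^r\det S_i\cdot\bigl(\prod_{i=r+1}^{r+s}\det S_i\bigr)^2$. For $x\ne0$, $\langle x\rangle$ is the ideal generated by the coordinates of $x$ and $N_K$ is the ideal norm. The projective Hermite-Humbert constant is $$\gamma^p(n,K)=\sup_{S\in\mathcal P_{K,n}}\ \min_{x\in\mathcal{O}_K^n\setminus\{0\}}\frac{S[x]}{N_K(\langle x\rangle)^2\det(S)^{1/n}}.$$ For a place $v$ of $K$, $K_v$ is the completion and $|\cdot|_v$ the absolute value normalized so that $\mu(\alpha C)=|\alpha|_v\mu(C)$ for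 a Haar measure $\mu$ on $K_v$ (so for complex $v$ it is the square of the usual modulus). For $x\in K_v^n$, the local height is $H_v(x)=(\sum_i|x_i|_v^2)^{1/(2m)}$ if $v$ is real, $H_v(x)=(\sum_i|x_i|_v)^{1/m}$ if $v$ is complex, and $H_v(x)=(\max_i|x_i|_v)^{1/m}$ if $v$ is finite. Let $\mathbb{A}$ be the adele ring of $K$; for $g\in\mathrm{GL}_n(\mathbb{A})$ and $x\in K^n$ put $H_g(x)=\prod_vH_v(g_vx)$. Watanabe's constant for a connected linear algebraic group $G$ over $K$ and a strongly $K$-rational absolutely irreducible representation $\pi$ is $\gamma^W(G,\pi)=\max_{g\in G(\mathbb{A})^1}\min_{x\in Q(K)\backslash G(K)}H_\pi(xg)^2$, where $Q$ is the stabilizer of the highest weight line of $\pi$ (a maximal $K$-parabolic subgroup) and $H_\pi$ is the global height on the representation space, evaluated on the translate of a highest weight vector. For $G=\mathrm{SL}_n$ and $\pi=\rho$ (the natural representation on $K^n$, with highest weight vector $e_1=(1,0,\dots,0)^t$, so that $Q$ is the stabilizer of the line $Ke_1$), one has $\mathrm{SL}_n(\mathbb{A})^1=\mathrm{SL}_n(\mathbb{A})$, and, writing the translates with the left action, this reads $$\gamma^W(\mathrm{SL}_n,\rho)=\max_{g\in\mathrm{SL}_n(\mathbb{A})}\ \min_{\gamma\in\mathrm{SL}_n(K)/Q(K)}H_g(\gamma e_1)^2.$$ *)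

(* Defs.v *)
From HB Require Import structures.
From mathcomp Require Import all_boot all_order all_algebra all_field.
From mathcomp Require Import generic_quotient ring_quotient sesquilinear spectral.
From mathcomp Require Import complex finmap ring.
From mathcomp Require Import all_classical all_reals all_analysis.

Set Implicit Arguments.
Unset Strict Implicit.
Unset Printing Implicit Defensive.

Import Order.TTheory GRing.Theory Num.Theory.
Import numFieldNormedType.Exports.

Local Open Scope sesquilinear_scope.
Local Open Scope classical_set_scope.
Local Open Scope ring_scope.
Local Open Scope quotient_scope.

(* Least and greatest elements; the default 0 is returned only when there is
   no such element. *)
Definition minval (R : realType) (A : set R) : R := xget 0 (A `&` lbound A).
Definition maxval (R : realType) (A : set R) : R := xget 0 (A `&` ubound A).

Section Ideals.
Variable K : fieldExtType rat.

Definition OK : set K := [set x | integralOver (intr : int -> K) x].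

Definition idealM (I J : set K) : set K :=
  [set z | exists2 s : seq (K * K),
     (forall p, p \in s -> I p.1 /\ J p.2) & z = \sum_(p <- s) p.1 * p.2].

Definition idealX (I : set K) (k : nat) : set K := iter k (idealM I) OK.

(* Index of I in OK (0 if infinite). *)
Definition ideal_norm (I : set K) : nat :=
  #|` fset_set [set [set y | OK y /\ I (y - x)] | x in OK]|.

Definition coord_ideal n (x : 'cV[K]_n) : set K :=
  [set z | exists2 c : 'cV[K]_n,
     (forall i, OK (c i 0)) & z = \sum_i c i 0 * x i 0].

Definition is_finplace (P : set K) : Prop :=
  [/\ P `<=` OK /\ (exists2 x, P x & x != 0),
      P 0 /\ (forall x y, P x -> P y -> P (x - y)),
      forall a x, OK a -> P x -> P (a * x),
      ~ P 1
    & forall a b, OK a -> OK b -> P (a * b) -> P a \/ P b].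

(* The finite places of K are the nonzero prime ideals of OK. *)
Definition finplace := {P : set K | `[< is_finplace P >]}.

Implicit Types v : finplace.

(* ord_v (a / b) = k - l when v^k and v^l are the exact powers of the prime
   ideal v dividing a and b; only used at x != 0. *)
Definition ordv v (x : K) : int :=
  xget 0 [set z | exists a b : K, exists k l : nat,
    [/\ x = a / b,
        idealX (val v) k a /\ ~ idealX (val v) k.+1 a,
        idealX (val v) l b /\ ~ idealX (val v) l.+1 b
      & z = k%:Z - l%:Z]].

(* The local ring of OK at the prime ideal v, inside K. *)
Definition locring v : set K :=
  [set x | exists a b, [/\ OK a, OK b, ~ val v b & x = a / b]].

(* d * locring v, for d != 0: since x lies in it iff |x|_v <= |d|_v, these sets
   form a basis of neighbourhoods of 0 for the v-adic topology of K. *)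
Definition vball v (d : K) : set K := [set d * x | x in locring v].

Definition vcauchy v : {pred nat -> K} := fun u =>
  `[< forall d, d != 0 -> exists N, forall k l, (N <= k)%N -> (N <= l)%N ->
        vball v d (u k - u l) >].

Definition vnull v : {pred nat -> K} := fun u =>
  `[< forall d, d != 0 -> exists N, forall k, (N <= k)%N -> vball v d (u k) >].

Lemma OK1 : OK 1. Proof. exact: integral1. Qed.
Lemma OKB x y : OK x -> OK y -> OK (x - y). Proof. exact: integral_sub. Qed.
Lemma OKM x y : OK x -> OK y -> OK (x * y). Proof. exact: integral_mul. Qed.

Lemma finplaceP v : is_finplace (val v).
Proof. by apply/asboolP; exact: (valP v). Qed.

Lemma locring1 v : locring v 1.
Proof.
by have [_ _ _ v1 _] := finplaceP v; exists 1, 1; rewrite divr1; split=> //;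
  exact: OK1.
Qed.

Lemma notv_neq0 v b : ~ val v b -> b != 0.
Proof.
by have [_ [v0 _] _ _ _] := finplaceP v => nb; apply/eqP => b0; apply: nb;
  rewrite b0.
Qed.

Lemma locringB v x y : locring v x -> locring v y -> locring v (x - y).
Proof.
have [_ _ _ _ vM] := finplaceP v.
move=> [a [b [Oa Ob nb ->]]] [c [d [Oc Od nd ->]]].
exists (a * d - c * b), (b * d); split; first by apply: OKB; apply: OKM.
- exact: OKM.
- by case/(vM _ _ Ob Od).
- by rewrite -mulNr addf_div ?mulNr // (notv_neq0 nb, notv_neq0 nd).
Qed.

Lemma locringM v x y : locring v x -> locring v y -> locring v (x * y).
Proof.
have [_ _ _ _ vM] := finplaceP v.
move=> [a [b [Oa Ob nb ->]]] [c [d [Oc Od nd ->]]].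
exists (a * c), (b * d); split; [exact: OKM|exact: OKM| |].
- by case/(vM _ _ Ob Od).
- by rewrite mulf_div.
Qed.

Lemma vball0 v d : vball v d 0.
Proof.
by exists (1 - 1); [apply: locringB; exact: locring1|rewrite subrr mulr0].
Qed.

Lemma vballB v d x y : vball v d x -> vball v d y -> vball v d (x - y).
Proof.
move=> [a La <-] [b Lb <-]; exists (a - b); first exact: locringB.
by rewrite mulrBr.
Qed.

Lemma vballD v d x y : vball v d x -> vball v d y -> vball v d (x + y).
Proof.
move=> Bx By; rewrite -[y]opprK; apply: vballB => //.
by rewrite -sub0r; apply: vballB => //; exact: vball0.
Qed.

Lemma vballM v d x y : vball v 1 x -> vball v d y -> vball v d (x * y).
Proof.
move=> [a La <-] [b Lb <-]; exists (a * b); first exact: locringM.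
by rewrite mul1r mulrCA.
Qed.

Lemma vcauchy_bounded v u : u \in vcauchy v -> forall d, d != 0 ->
  exists N c, c != 0 /\ forall k y, (N <= k)%N -> vball v d y -> vball v c y ->
    vball v d (u k * y).
Proof.
move=> /asboolP cu d d0; have [N HN] := cu 1 (oner_neq0 _).
exists N; have [uN0|uN0] := eqVneq (u N) 0.
  exists d; split=> // k y Nk By _; apply: vballM => //.
  by have := HN _ _ Nk (leqnn N); rewrite uN0 subr0.
exists (d / u N); split=> [|k y Nk By [a La yE]].
  by rewrite mulf_neq0 ?invr_eq0.
rewrite -(subrK (u N) (u k)) mulrDl; apply: vballD.
  by apply: vballM => //; exact: HN.
by exists a => //; rewrite -yE; rewrite mulrA mulrCA divff // mulr1.
Qed.

Fact vcauchy_subring v : subring_closed (vcauchy v).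
Proof.
split=> [|u w cu cw|u w cu cw].
- by apply/asboolP => d _; exists 0%N => k l _ _; rewrite /= subrr; exact: vball0.
- apply/asboolP => d d0; move/asboolP: cu => /(_ d d0)[N HN].
  move/asboolP: cw => /(_ d d0)[M HM]; exists (maxn N M) => k l.
  rewrite !geq_max => /andP[Nk Mk] /andP[Nl Ml].
  rewrite [X in vball v d X](_ : _ = (u k - u l) - (w k - w l)).
    by apply: vballB; [exact: HN|exact: HM].
  by change (u k - w k - (u l - w l) = u k - u l - (w k - w l)); ring.
- apply/asboolP => d d0.
  have [N [c [c0 HN]]] := vcauchy_bounded cu d0.
  have [M [e [e0 HM]]] := vcauchy_bounded cw d0.
  move/asboolP: cu => cu; move/asboolP: cw => cw.
  have [[A HA] [B HB]] := (cu d d0, cu e e0).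
  have [[C HC] [D HD]] := (cw d d0, cw c c0).
  exists (maxn (maxn N M) (maxn (maxn A B) (maxn C D))) => k l.
  rewrite !geq_max => /andP[/andP[Nk Mk] /andP[/andP[Ak Bk] /andP[Ck Dk]]].
  move=> /andP[/andP[Nl Ml] /andP[/andP[Al Bl] /andP[Cl Dl]]].
  rewrite [X in vball v d X](_ : _ = u k * (w k - w l) + w l * (u k - u l)).
    apply: vballD; [apply: HN => //|apply: HM => //];
    by [exact: HC|exact: HD|exact: HA|exact: HB].
  change (u k * w k - u l * w l = u k * (w k - w l) + w l * (u k - u l)); ring.
Qed.

HB.instance Definition _ v :=
  GRing.isSubringClosed.Build (nat -> K) (vcauchy v) (vcauchy_subring v).

Record cauchy_seq v := CauchySeq {
  seqval :> nat -> K; _ : seqval \in vcauchy v }.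

HB.instance Definition _ v := [isSub for @seqval v].
HB.instance Definition _ v := [Choice of cauchy_seq v by <:].
HB.instance Definition _ v := [SubChoice_isSubComNzRing of cauchy_seq v by <:].

Definition null_seq v : {pred cauchy_seq v} := fun u => seqval u \in vnull v.

Fact null_seq_ideal v : idealr_closed (null_seq (v := v)).
Proof.
split.
- by apply/asboolP => d d0; exists 0%N => k _; exact: vball0.
- have [[vO [p vp p0]] _ vZ v1 vM] := finplaceP v.
  apply/negP => /asboolP /(_ p p0)[N /(_ N (leqnn N))].
  move=> [x [a [b [Oa Ob nb ->]]] E].
  have b0 : b != 0 by exact: (notv_neq0 nb).
  have {}E : p * (a / b) = 1 by exact: E.
  apply: nb; rewrite (_ : b = a * p); first exact: vZ.
  by rewrite -[LHS]mul1r -E mulrA divfK // mulrC.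
- move=> a x y nx ny; apply/asboolP => d d0.
  have [N [c [c0 HN]]] := vcauchy_bounded (valP a) d0.
  move/asboolP: nx => nx; move/asboolP: ny => /(_ d d0)[C HC].
  have [[A HA] [B HB]] := (nx d d0, nx c c0).
  exists (maxn (maxn N C) (maxn A B)) => k.
  rewrite !geq_max => /andP[/andP[Nk Ck] /andP[Ak Bk]].
  by apply: vballD; [apply: HN; [|exact: HA|exact: HB]|exact: HC].
Qed.

HB.instance Definition _ v :=
  isIdealr.Build (cauchy_seq v) (null_seq (v := v)) (null_seq_ideal v).

(* K_v, as Cauchy sequences modulo null sequences. *)
Definition completion v := {ideal_quot (null_seq (v := v))}.


Fact vcauchy_cst v (x : K) : (fun _ : nat => x) \in vcauchy v.
Proof. by apply/asboolP => d _; exists 0%N => k l _ _; rewrite subrr; exact: vball0. Qed.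

Definition to_completion v (x : K) : completion v :=
  \pi_(completion v) (CauchySeq (vcauchy_cst v x)).
End Ideals.

Section Absolute.
Variables (R : realType) (K : fieldExtType rat).
Implicit Types v : finplace K.

(* |x|_v = N(v) ^ (- ord_v x): the normalization for which multiplication by x
   scales a Haar measure of K_v by |x|_v. *)
Definition absK v (x : K) : R :=
  if x == 0 then 0 else (ideal_norm (val v))%:R ^ (- ordv v x).

(* Extension of |.|_v to K_v by continuity. *)
Definition absv v (x : completion v) : R :=
  lim ((fun k => absK v (repr x k)) @ \oo).

(* Archimedean places: real_emb lists the real embeddings of K, and
   complex_emb lists one embedding out of each pair of conjugate non-real
   ones. *)
Definition emb_fun (r s : nat) (f : 'I_r -> {rmorphism K -> R})
    (g : 'I_s -> {rmorphism K -> R[i]}) (k : 'I_r + ('I_s + 'I_s)) : K -> R[i] :=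
  match k with
  | inl i => fun x => ((f i x)%:C)%C
  | inr (inl j) => fun x => g j x
  | inr (inr j) => fun x => conjc (g j x)
  end.

Record embeddings := Embeddings {
  nreal : nat;
  ncomplex : nat;
  real_emb : 'I_nreal -> {rmorphism K -> R};
  complex_emb : 'I_ncomplex -> {rmorphism K -> R[i]};
  embeddingsP : forall h : {rmorphism K -> R[i]},
    exists! k, h =1 emb_fun real_emb complex_emb k }.

Variables (E : embeddings) (n : nat).

Let m : nat := \dim {:K}.

(* Humbert forms, S.1 holding the matrices at the real places and S.2 those at
   the complex places. *)
Definition form_tuple : Type :=
  ('I_(nreal E) -> 'M[R]_n) * ('I_(ncomplex E) -> 'M[R[i]]_n).

Definition rform (A : 'M[R]_n) (y : 'cV[R]_n) : R := (y^T *m A *m y) 0 0.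
Definition cform (A : 'M[R[i]]_n) (y : 'cV[R[i]]_n) : R[i] :=
  (y^t* *m A *m y) 0 0.

Definition humbert : set form_tuple := [set S |
  (forall i, S.1 i \is symmetricmx /\ forall y, y != 0 -> 0 < rform (S.1 i) y) /\
  (forall j, S.2 j \is hermsymmx /\ forall y, y != 0 -> 0 < cform (S.2 j) y)].

(* The values at complex places are real: Re only changes their type. *)
Definition form_val (S : form_tuple) (x : 'cV[K]_n) : R :=
  (\prod_i rform (S.1 i) (map_mx (real_emb i) x)) *
  (\prod_j complex.Re (cform (S.2 j) (map_mx (complex_emb j) x))) ^+ 2.

Definition form_det (S : form_tuple) : R :=
  (\prod_i \det (S.1 i)) * (\prod_j complex.Re (\det (S.2 j))) ^+ 2.

Definition humbert_quot (S : form_tuple) (x : 'cV[K]_n) : R :=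
  form_val S x /
  ((ideal_norm (coord_ideal x))%:R ^+ 2 * (form_det S `^ n%:R^-1)).

Definition gammaP : R :=
  sup [set minval [set humbert_quot S x
                  | x in [set x : 'cV[K]_n | x != 0 /\ forall i, OK (x i 0)]]
      | S in humbert].

Definition height_real (x : 'cV[R]_n) : R :=
  (\sum_i `|x i 0| ^+ 2) `^ (2 * m)%:R^-1.

(* The normalized absolute value at a complex place is the squared modulus. *)
Definition height_complex (x : 'cV[R[i]]_n) : R :=
  (\sum_i complex.Re `|x i 0| ^+ 2) `^ m%:R^-1.

Definition height_fin v (x : 'cV[completion v]_n) : R :=
  (\big[Num.max/0]_i absv (x i 0)) `^ m%:R^-1.

(* Families of matrices indexed by all the places of K. *)
Record place_mx := PlaceMx {
  mx_real : 'I_(nreal E) -> 'M[R]_n;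
  mx_complex : 'I_(ncomplex E) -> 'M[R[i]]_n;
  mx_fin : forall v, 'M[completion v]_n }.

(* SL_n of the adele ring: the entries of g are adeles, i.e. v-integral for all
   but finitely many finite places v, and every component has determinant 1. *)
Definition SLA : set place_mx := [set g |
  [/\ forall i, \det (mx_real g i) = 1,
      forall j, \det (mx_complex g j) = 1,
      forall v, \det (mx_fin g v) = 1
    & forall i j, finite_set [set v | ~ absv (mx_fin g v i j) <= 1]]].

(* H_g x; all but finitely many factors at the finite places are 1 as soon as
   g is invertible over the adeles and x != 0. *)
Definition height (g : place_mx) (x : 'cV[K]_n) : R :=
  (\prod_i height_real (mx_real g i *m map_mx (real_emb i) x)) *
  (\prod_j height_complex (mx_complex g j *m map_mx (complex_emb j) x)) *
  \big[*%R/1]_(v \in [set: finplace K])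
    height_fin (mx_fin g v *m map_mx (to_completion v) x).

Definition e1 : 'cV[K]_n := \col_i (i == 0%N :> nat)%:R.

(* H_g (gamma e1) only depends on the class of gamma in SL_n(K) / Q(K), so the
   minimum is taken over representatives gamma in SL_n(K). *)
Definition gammaW : R :=
  maxval [set minval [set height g (gamma *m e1) ^+ 2
                     | gamma in [set gamma : 'M[K]_n | \det gamma = 1]]
         | g in SLA].

End Absolute.

(* Main.v *)
(* Both constants are the maximum, over the families h = (h_k) of complex matrices
   of determinant 1 indexed by the embeddings k of K and compatible with complex
   conjugation, of the minimum over x of
     Phi h x = prod_k |h_k x^k|^2 * (prod_v max_i |x_i|_v)^2,
   which by the product formula depends only on the line K x.
   Up to scalars, a Humbert form is the form of Gram matrices h_k^* h_k, and
   N<x> = prod_v (max_i |x_i|_v)^-1 for integral x, so that the Humbert quotient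
   of x is Phi h x.  By strong approximation every g in SL_n(A) can be moved by
   SL_n(K) into the stabilizer of the local norms at the finite places, so that
   H_g^(2m) becomes Phi h on SL_n(K) e1 = K^n - 0.
   The minima are attained because, by reduction theory over Z applied to the
   lattice {a in K | a x in OK^n}, each line has an integral generator of bounded
   size at every embedding.  The maximum is attained because reduction theory
   applied to OK^n and a finiteness argument modulo a fixed ideal show that the
   families on which Phi is bounded below lie in a compact set modulo SL_n(OK). *)
Require Import Defs.
From HB Require Import structures.
From mathcomp Require Import all_boot all_order all_algebra all_field.
From mathcomp Require Import generic_quotient ring_quotient sesquilinear spectral.
From mathcomp Require Import complex finmap ring lra zify perm.
From mathcomp Require Import all_classical all_reals all_analysis.

Set Implicit Arguments.
Unset Strict Implicit.
Unset Printing Implicit Defensive.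

Import Order.TTheory GRing.Theory Num.Theory.
Import numFieldNormedType.Exports.

Local Open Scope classical_set_scope.
Local Open Scope ring_scope.

(** * Integral bases *)

Section RingOfIntegers.
Variable K : fieldExtType rat.
Implicit Types x y z : K.

(** Completions enter only through [completion_approx]: a matrix of SL_n(K_v) is exchanged for one
    of SL_n(K) with the same local norm on K^n. Strong approximation then concerns matrices over K;
    it reduces to transvections, which generate SL_n, and for these to the Chinese remainder
    theorem. Ideal theory rests on the finiteness of OK / I. Factorization into primes is replaced
    by an induction on the index: adding to I an element whose annihilator modulo I is a prime v
    divides the index by N(v) and multiplies the local norm at v by N(v). Geometry of numbers rests
    on a single inequality, Hermite's bound for the product of the values of a positive definite
    form on a suitable Z-basis. It is used in rank m inside a line of K^n, and in rank mn on OK^n.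
    In rank mn it yields n short columns independent over K, but these need not generate OK^n: only
    their determinant is bounded. Hence the passage to finitely many classes of integral matrices of
    bounded determinant, which makes reduction modulo SL_n(OK) work for any class number. *)

Lemma OK_int (k : int) : OK (k%:~R : K). Proof. exact: integral_id. Qed.

Lemma OK0 : OK (0 : K). Proof. exact: (OK_int 0). Qed.

Lemma OKN x : OK x -> OK (- x).
Proof. by move=> Ox; rewrite -sub0r; apply: OKB => //; exact: OK0. Qed.

Lemma OKD x y : OK x -> OK y -> OK (x + y).
Proof. by move=> Ox Oy; rewrite -[y]opprK; apply: OKB => //; exact: OKN. Qed.

Lemma OK_nat (k : nat) : OK (k%:R : K). Proof. exact: (OK_int k). Qed.

Lemma OKX x k : OK x -> OK (x ^+ k).
Proof.
move=> Ox; elim: k => [|k IHk]; first by rewrite expr0; exact: OK1.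
by rewrite exprS; exact: OKM.
Qed.

Lemma OK_sum (I : Type) (r : seq I) (P : pred I) (F : I -> K) :
  (forall i, P i -> OK (F i)) -> OK (\sum_(i <- r | P i) F i).
Proof. by move=> OF; elim/big_ind: _ => //; [exact: OK0|exact: OKD]. Qed.

Lemma OK_prod (I : Type) (r : seq I) (P : pred I) (F : I -> K) :
  (forall i, P i -> OK (F i)) -> OK (\prod_(i <- r | P i) F i).
Proof. by move=> OF; elim/big_ind: _ => //; [exact: OK1|exact: OKM]. Qed.

Lemma scale_int (k : int) x : (k%:~R : rat) *: x = k%:~R * x.
Proof. by rewrite scaler_int -mulrzl. Qed.

(** Determinant trick: [x] is a root of the characteristic polynomial of the integer matrix [M]. It
    serves to clear denominators and, at a prime, to show that an element stabilizing the prime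
    ideal is integral. *)
Lemma OK_eigen k (c : 'rV[K]_k) (M : 'M[int]_k) x : c != 0 ->
  c *m map_mx intr M = x *: c -> OK x.
Proof.
move=> c0 Mc; exists (char_poly M); first exact: char_poly_monic.
rewrite map_char_poly -eigenvalue_root_char; apply/eigenvalueP.
by exists c.
Qed.

Lemma eig_horner (F : fieldType) k (g : 'M[F]_k.+1) (v : 'rV_k.+1) a p :
  v *m g = a *: v -> v *m horner_mx g p = p.[a] *: v.
Proof.
move=> vg; elim/poly_ind: p => [|p c IHp].
  by rewrite rmorph0 mulmx0 horner0 scale0r.
rewrite rmorphD rmorphM /= horner_mx_X horner_mx_C mulmxDr mulmxA IHp.
rewrite -scalemxAl vg hornerMXaddC mul_mx_scalar scalerDl scalerA.
by [].
Qed.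

(** [A] is multiplication by [x] in the free family [b]. A monic integer polynomial killing [x]
    kills [A], so the eigenvalues of [A] in [algC] are algebraic integers; their sum is rational,
    hence an integer. *)
Lemma trace_int k (A : 'M[rat]_k.+1) (b : 'rV[K]_k.+1) x :
  (forall q : 'cV[rat]_k.+1, b *m map_mx (in_alg K) q = 0 -> q = 0) ->
  b *m map_mx (in_alg K) A = x *: b -> OK x -> \tr A \is a Num.int.
Proof.
move=> bfree bA [p pmon proot].
pose pQ : {poly rat} := map_poly intr p.
have pA0 : horner_mx A pQ = 0.
  apply/matrixP => i j; suff /matrixP/(_ i 0) : col j (horner_mx A pQ) = 0.
    by rewrite !mxE.
  apply: bfree; rewrite colE map_mxM mulmxA map_horner_mx (eig_horner _ bA).
  have -> : map_poly (in_alg K) pQ = map_poly intr p.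
    by rewrite -map_poly_comp; apply: eq_map_poly => z; rewrite /= scale_int mulr1.
  by rewrite (rootP proot) scale0r mul0mx.
pose B : 'M[algC]_k.+1 := map_mx ratr A.
have [r rE] := closed_field_poly_normal (char_poly B).
rewrite (monicP (char_poly_monic _)) scale1r in rE.
have rint (z : algC) : z \in r -> z \in Aint.
  move=> zr; have : root (char_poly B) z by rewrite rE root_prod_XsubC.
  rewrite -root_mxminpoly => zm.
  have dv : mxminpoly B %| map_poly ratr pQ.
    by apply: mxminpoly_min; rewrite -map_horner_mx pA0 map_mx0.
  apply: (@root_monic_Aint (map_poly ratr pQ)).
  - by rewrite -dvdp_XsubCl (dvdp_trans _ dv) // dvdp_XsubCl.
  - by do 2!apply: monic_map.
  - rewrite -map_poly_comp; apply/polyOverP => i; rewrite coef_map /=.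
    by rewrite rmorph_int; exact: rpred_int.
have sr : size r = k.+1.
  by have := size_char_poly B; rewrite rE size_prod_XsubC => -[].
have trB : \tr B = \sum_(z <- r) z.
  apply: oppr_inj; rewrite -char_poly_trace //= rE.
  by have := @coefPn_prod_XsubC _ r; rewrite sr; apply.
rewrite -Cint_rat /= -trace_map_mx; apply: Cint_rat_Aint.
  by rewrite trace_map_mx; apply: Crat_rat.
by rewrite trB big_seq; apply: rpred_sum => z; exact: rint.
Qed.

Local Notation m := (\dim {:K}).
Local Notation b0 := (vbasis {:K}).

Lemma dimK_gt0 : (0 < m)%N.
Proof. by rewrite adim_gt0. Qed.

Section Coordinates.
Variable b : m.-tuple K.
Hypothesis bP : basis_of {:K} b.

Lemma coordE x : x = \sum_i coord b i x *: b`_i.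
Proof. by apply: (coord_basis bP); rewrite memvf. Qed.

Lemma coord_b (i j : 'I_m) : coord b i b`_j = (i == j)%:R.
Proof. by rewrite coord_free ?(basis_free bP) // eq_sym. Qed.

Lemma coord_comb (q : 'I_m -> rat) i : coord b i (\sum_j q j *: b`_j) = q i.
Proof.
rewrite linear_sum (bigD1 i) //= linearZ /= coord_b eqxx mulr1 big1 ?addr0 //.
by move=> j ji; rewrite linearZ /= coord_b eq_sym (negbTE ji) mulr0.
Qed.

Definition mulmat x : 'M[rat]_m := \matrix_(i, j) coord b i (x * b`_j).

Lemma mulmatE x :
  (\row_j b`_j) *m map_mx (in_alg K) (mulmat x) = x *: \row_j b`_j.
Proof.
apply/rowP => j; rewrite !mxE [RHS](coordE).
by apply: eq_bigr => i _; rewrite !mxE -[RHS]mulr_algl mulrC.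
Qed.

Lemma row_basis_free (q : 'cV[rat]_m) :
  (\row_j b`_j) *m map_mx (in_alg K) q = 0 -> q = 0.
Proof.
move=> /matrixP/(_ 0 0); rewrite !mxE => q0; apply/colP => i; rewrite mxE.
rewrite -(coord_comb (q ^~ 0)) -[RHS](linear0 (coord b i)); congr coord.
by rewrite -[RHS]q0; apply: eq_bigr => j _; rewrite !mxE -[LHS]mulr_algl mulrC.
Qed.

Lemma row_basis_neq0 : \row_j b`_j != 0 :> 'rV[K]_m.
Proof.
apply/eqP => /rowP /(_ (Ordinal dimK_gt0)); rewrite !mxE => bi0.
have := coord_b (Ordinal dimK_gt0) (Ordinal dimK_gt0).
by rewrite bi0 linear0 eqxx => /eqP; rewrite eq_sym oner_eq0.
Qed.

End Coordinates.

Lemma b0P : basis_of {:K} b0. Proof. exact: vbasisP. Qed.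

Lemma denominator x : exists2 N : nat, (0 < N)%N & OK (N%:R * x).
Proof.
pose A := mulmat b0 x.
pose N : nat := \prod_i \prod_j `|denq (A i j)|%N.
have denN i j : exists z : int, N%:R * A i j = z%:~R.
  rewrite /N (bigD1 i) //= (bigD1 j) //= -mulnA.
  set k := (X in (_ * X)%N); exists (k%:Z * numq (A i j)).
  rewrite natrM intrM -pmulrn [RHS]mulrC mulrAC; congr (_ * _).
  by rewrite numqE mulrC; congr (_ * _); rewrite natr_absz ger0_norm.
have N0 : (0 < N)%N.
  by rewrite prodn_gt0 // => i; rewrite prodn_gt0 // => j; rewrite absz_gt0 denq_neq0.
exists N => //; pose f i j := projT1 (cid (denN i j)).
apply: (@OK_eigen _ (\row_j b0`_j) (\matrix_(i, j) f i j)).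
  exact: (row_basis_neq0 b0P).
rewrite -scalerA -(mulmatE b0P) scalemxAr; congr (_ *m _).
apply/matrixP => i j; rewrite !mxE.
have := projT2 (cid (denN i j)); rewrite -/(f i j) => /(congr1 (in_alg K)).
by rewrite /= -scalerA scaler_nat scale_int mulr1 !mxE => <-; rewrite mulr_natl.
Qed.

Definition ftrace x : rat := \tr (mulmat b0 x).

Lemma ftraceE x : ftrace x = \sum_i coord b0 i (x * b0`_i).
Proof. by apply: eq_bigr => i _; rewrite mxE. Qed.

Fact ftrace_is_linear : scalar ftrace.
Proof.
move=> a x y; rewrite !ftraceE mulr_sumr -big_split /=; apply: eq_bigr => i _.
by rewrite mulrDl -scalerAl linearP.
Qed.

HB.instance Definition _ :=
  GRing.isLinear.Build rat K rat *%R ftrace ftrace_is_linear.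

Lemma ftrace1 : ftrace 1 = m%:R.
Proof.
rewrite ftraceE (eq_bigr (fun=> 1)) ?sumr_const ?card_ord // => i _.
by rewrite mul1r (coord_b b0P) eqxx.
Qed.

Lemma ftrace_int x : OK x -> ftrace x \is a Num.int.
Proof.
move=> Ox; rewrite /ftrace; have := mulmatE b0P x; have := row_basis_free b0P.
move: (\row_j _) (mulmat _ _); have := dimK_gt0.
case: (\dim {:K}) => // k _ b A bf bA; exact: (trace_int bf bA Ox).
Qed.

Definition gram k (c : k.-tuple K) : 'M[rat]_k :=
  \matrix_(i, j) ftrace (c`_i * c`_j).

Lemma int_det k (A : 'M[rat]_k) :
  (forall i j, A i j \is a Num.int) -> \det A \is a Num.int.
Proof.
move=> Ai; rewrite /determinant rpred_sum // => s _.
by rewrite rpredM ?rpred_prod // rpredX // rpredN rpred1.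
Qed.

(** Nondegeneracy of the trace form: a nonzero [y] orthogonal to all of K would give
    [ftrace (y * y^-1) = 0], whereas this trace is the degree. *)
Lemma gram_basis (c : m.-tuple K) : basis_of {:K} c = (\det (gram c) != 0).
Proof.
apply/idP/idP => [cP|].
  apply/negP => /det0P[v v0 vG].
  pose y := \sum_i v 0 i *: c`_i.
  have y0 : y != 0.
    apply: contra v0 => /eqP y0; apply/eqP/rowP => i; rewrite mxE.
    by rewrite -(coord_comb cP (v 0)) -/y y0 linear0.
  have ty z : ftrace (y * z) = 0.
    rewrite (coordE cP z) mulr_sumr linear_sum big1 // => j _.
    rewrite -scalerAr linearZ /=; apply/eqP; rewrite mulf_eq0; apply/orP; right.
    move/rowP: vG => /(_ j); rewrite !mxE => <-.
    rewrite /y mulr_suml linear_sum; apply/eqP; apply: eq_bigr => i _.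
    by rewrite -scalerAl linearZ /= mxE.
  have := ty y^-1; rewrite divff // ftrace1 => /eqP.
  by rewrite pnatr_eq0 -leqn0 leqNgt dimK_gt0.
move=> G0; rewrite basisEfree subvf size_tuple leqnn !andbT.
apply/freeP => k k0 i; apply/eqP; apply: contraNT G0 => ki.
apply/det0P; exists (\row_i k i).
  by apply: contra ki => /eqP/rowP/(_ i); rewrite !mxE => ->.
apply/rowP => j; rewrite !mxE; transitivity (ftrace ((\sum_i k i *: c`_i) * c`_j)).
  rewrite mulr_suml linear_sum; apply: eq_bigr => l _.
  by rewrite !mxE -scalerAl linearZ.
by rewrite k0 mul0r linear0.
Qed.

Lemma gram_change (b c : m.-tuple K) (P := \matrix_(i, j) coord b j c`_i) :
  basis_of {:K} b -> \det (gram c) = \det P ^+ 2 * \det (gram b).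
Proof.
move=> bP; suff -> : gram c = P *m gram b *m P^T.
  by rewrite !det_mulmx det_tr expr2 mulrAC.
apply/matrixP => i j; rewrite !mxE {1}(coordE bP c`_j) mulr_sumr linear_sum.
apply: eq_bigr => l _; rewrite -scalerAr linearZ /= !mxE mulrC; congr (_ * _).
rewrite {1}(coordE bP c`_i) mulr_suml linear_sum; apply: eq_bigr => s _.
by rewrite -scalerAl linearZ /= !mxE.
Qed.

(** Integrality of the rational coordinates replaces generation over the integers; L is thereby a
    full lattice in K. *)
Definition Zbasis (L : set K) (b : m.-tuple K) :=
  basis_of {:K} b /\ forall x, L x <-> forall i, coord b i x \is a Num.int.

Lemma subgroup_closed (L : set K) (L0 : L 0)
    (LB : forall x y, L x -> L y -> L (x - y)) :
  (forall x y, L x -> L y -> L (x + y)) /\ (forall (k : int) x, L x -> L (k%:~R * x)).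
Proof.
have LN x : L x -> L (- x) by move=> Lx; rewrite -sub0r; exact: LB.
have LD x y : L x -> L y -> L (x + y).
  by move=> Lx Ly; rewrite -[y]opprK; apply: LB => //; exact: LN.
split=> // k x Lx; have Ln (n : nat) : L (n%:R * x).
  elim: n => [|n IHn]; first by rewrite mul0r.
  by rewrite -natr1 mulrDl mul1r; exact: LD.
by case: k => n; [exact: Ln|rewrite NegzE rmorphN mulNr; exact/LN/Ln].
Qed.

(* A basis of minimal discriminant is a Z-basis: a vector of L with a
   non-integral coordinate would allow one to decrease the discriminant. *)
Lemma Zbasis_exists (L : set K) : L `<=` @OK K -> L 0 ->
  (forall x y, L x -> L y -> L (x - y)) ->
  (exists2 c : m.-tuple K, basis_of {:K} c & forall i : 'I_m, L c`_i) ->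
  exists b, Zbasis L b.
Proof.
move=> LO L0 LB [c cP cL]; have [LD LZ] := subgroup_closed L0 LB.
pose Lbasis (b : m.-tuple K) := basis_of {:K} b /\ forall i : 'I_m, L b`_i.
have disc b : Lbasis b -> exists n : nat, `|\det (gram b)| = n%:R.
  move=> [_ bL]; have /intrP[z zE] : \det (gram b) \is a Num.int.
    apply: int_det => i j; rewrite mxE; apply: ftrace_int.
    by apply: OKM; apply: LO.
  by exists `|z|%N; rewrite zE -intr_norm natr_absz.
pose Q (n : nat) := `[< exists2 b, Lbasis b & `|\det (gram b)| = n%:R >].
have exQ : exists n, Q n.
  by have [|n nE] := disc c; [by []|exists n; apply/asboolP; exists c].
case: (ex_minnP exQ) => n /asboolP[b [bP bL] bn] nmin; exists b; split=> // x.
split=> [Lx i|xi].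
  set q := coord b i x; apply/negPn/negP => qi.
  pose f := q - (Num.floor q)%:~R.
  pose x' := x - (Num.floor q)%:~R * b`_i.
  have Lx' : L x' by apply: LB => //; exact: LZ.
  have fE : coord b i x' = f.
    by rewrite linearB /= -scale_int linearZ /= (coord_b bP) eqxx mulr1.
  have f01 : 0 < f < 1.
    rewrite /f subr_gt0 ltrBlDl lt_neqAle floor_le_tmp andbT.
    rewrite -intrD1 floorD1_gt andbT.
    by apply: contra qi => /eqP <-; exact: rpred_int.
  pose d : m.-tuple K := [tuple if j == i then x' else b`_j | j < m].
  have dE (j : 'I_m) : d`_j = if j == i then x' else b`_j.
    by rewrite /d -tnth_nth tnth_mktuple.
  have detP : \det (\matrix_(j, l) coord b l d`_j) = f.
    rewrite (expand_det_col _ i) (bigD1 i) //= big1 ?addr0 => [|j ji]; last first.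
      by rewrite mxE dE (negbTE ji) (coord_b bP) eq_sym (negbTE ji) mul0r.
    rewrite mxE dE eqxx fE /cofactor addnn -signr_odd odd_double expr0 mul1r.
    rewrite (_ : row' i _ = 1%:M) ?det1 ?mulr1 //.
    apply/matrixP => r s; rewrite !mxE dE -(inj_eq (@lift_inj _ i)).
    by rewrite eq_sym (negbTE (neq_lift _ _)) (coord_b bP) eq_sym.
  have G0 : \det (gram b) != 0 by rewrite -gram_basis.
  have dG := gram_change d bP; rewrite detP in dG.
  have dP : Lbasis d.
    split; last by move=> j; rewrite dE; case: ifP.
    rewrite gram_basis dG mulf_neq0 // expf_neq0 //.
    by case/andP: f01 => /lt0r_neq0.
  have [k kE] := disc d dP.
  have /nmin : Q k by apply/asboolP; exists d.
  rewrite leqNgt => /negP; apply.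
  rewrite -(ltr_nat rat) -kE -bn dG normrM gtr_pMl ?normr_gt0 //.
  by rewrite normrX expr_lt1 // ger0_norm; case/andP: f01 => // /ltW.
rewrite (coordE bP x); elim/big_ind: _ => // i _.
by have /intrP[z ->] := xi i; rewrite scale_int; exact: LZ.
Qed.

Record nzideal (I : set K) : Prop := NzIdeal {
  nzi_sub : I `<=` @OK K;
  nziB : forall x y, I x -> I y -> I (x - y);
  nziM : forall a x, OK a -> I x -> I (a * x);
  nzi_neq0 : exists2 x, I x & x != 0 }.

Lemma nzi0 I : nzideal I -> I 0.
Proof. by move=> iI; have [x Ix _] := nzi_neq0 iI; rewrite -(subrr x); exact: nziB. Qed.

Lemma nziD I x y : nzideal I -> I x -> I y -> I (x + y).
Proof.
move=> iI; have [LD _] := subgroup_closed (nzi0 iI) (nziB iI); exact: LD.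
Qed.

Lemma nzideal_OK : nzideal (@OK K).
Proof.
split=> //; [exact: OKB|exact: OKM|].
by exists 1; [exact: OK1|exact: oner_neq0].
Qed.

Lemma nzideal_principal a : OK a -> a != 0 -> nzideal [set a * x | x in @OK K].
Proof.
move=> Oa a0; split=> [_ [x Ox <-]|_ _ [x Ox <-] [y Oy <-]|b _ Ob [x Ox <-]|].
- exact: OKM.
- by rewrite -mulrBr; exists (x - y) => //; exact: OKB.
- by rewrite mulrCA; exists (b * x) => //; exact: OKM.
- by exists a => //; exists 1; [exact: OK1|rewrite mulr1].
Qed.

(** Clearing the denominators of a Q-basis of K and multiplying it by a nonzero element of I gives a
    Q-basis inside I, from which [Zbasis_exists] can descend. *)
Lemma nzideal_Zbasis I : nzideal I -> exists b, Zbasis I b.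
Proof.
move=> iI; apply: Zbasis_exists; [exact: nzi_sub|exact: nzi0|exact: nziB|].
have [a Ia a0] := nzi_neq0 iI.
have /all_tag2[N N0 NO] x : {N : nat & (0 < N)%N & OK (N%:R * x)}.
  have [N N0 NO] := cid2 (denominator x).
  by exists N.
pose c : m.-tuple K := [tuple (N b0`_i)%:R * b0`_i * a | i < m].
have cE (i : 'I_m) : c`_i = (N b0`_i)%:R * b0`_i * a.
  by rewrite /c -tnth_nth tnth_mktuple.
exists c => [|i]; last by rewrite cE; exact: nziM.
rewrite basisEfree subvf size_tuple leqnn !andbT.
apply/freeP => k k0 i.
have : (\sum_i (k i * (N b0`_i)%:R) *: b0`_i) * a = 0.
  rewrite mulr_suml -[RHS]k0; apply: eq_bigr => j _.
  by rewrite cE -scalerA scaler_nat mulr_natl -scalerAl.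
move/eqP; rewrite mulf_eq0 (negbTE a0) orbF => /eqP /(congr1 (coord b0 i)).
rewrite (coord_comb b0P (fun i => k i * (N b0`_i)%:R)) linear0.
move/eqP; rewrite mulf_eq0 pnatr_eq0 -[_ == 0%N]leqn0 leqNgt N0 orbF.
by move/eqP.
Qed.

End RingOfIntegers.

(** * Norms of ideals *)

Section Index.
Variable K : fieldExtType rat.
Implicit Types (x y z : K) (I : set K).
Local Notation m := (\dim {:K}).

Lemma Zbasis_change (L : set K) (b : m.-tuple K) (U : 'M[int]_m) : Zbasis L b ->
  U \in unitmx ->
  exists b' : m.-tuple K, [/\ Zbasis L b',
    forall i : 'I_m, b'`_i = \sum_j (U i j)%:~R * b`_j
    & forall x, \row_i coord b' i x = (\row_i coord b i x) *m map_mx intr (invmx U)].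
Proof.
move=> [bP LP] uU.
pose b' : m.-tuple K := [tuple \sum_j (U i j)%:~R * b`_j | i < m].
have b'E (i : 'I_m) : b'`_i = \sum_j (U i j)%:~R * b`_j.
  by rewrite /b' -tnth_nth tnth_mktuple.
have UK : map_mx intr (invmx U) *m map_mx intr U = 1%:M :> 'M[rat]_m.
  by rewrite -map_mxM mulVmx // map_mx1.
have KU : map_mx intr U *m map_mx intr (invmx U) = 1%:M :> 'M[rat]_m.
  by rewrite -map_mxM mulmxV // map_mx1.
have comb (q : 'rV[rat]_m) :
    \sum_i q 0 i *: b'`_i = \sum_i (q *m map_mx intr U) 0 i *: b`_i.
  transitivity (\sum_i \sum_j (q 0 i * (U i j)%:~R) *: b`_j).
    apply: eq_bigr => i _; rewrite b'E scaler_sumr; apply: eq_bigr => j _.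
    by rewrite -scale_int scalerA.
  rewrite exchange_big; apply: eq_bigr => j _; rewrite mxE scaler_suml.
  by apply: eq_bigr => i _; rewrite mxE.
have b'P : basis_of {:K} b'.
  rewrite basisEfree subvf size_tuple leqnn !andbT; apply/freeP => k k0 i.
  have : (\row_i k i) *m map_mx intr U = 0.
    apply/rowP => j; rewrite [RHS]mxE.
    rewrite -(coord_comb bP (fun i => ((\row_i k i) *m map_mx intr U) 0 i)).
    rewrite -comb -[RHS](linear0 (coord b j)) -[in RHS]k0; congr coord.
    by apply: eq_bigr => l _; rewrite mxE.
  move/(congr1 (mulmx^~ (map_mx intr (invmx U)))).
  by rewrite -mulmxA KU mulmx1 mul0mx => /rowP/(_ i); rewrite !mxE.
have cE x : \row_i coord b' i x = (\row_i coord b i x) *m map_mx intr (invmx U).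
  have -> : \row_i coord b i x = (\row_i coord b' i x) *m map_mx intr U.
    apply/rowP => j; rewrite [LHS]mxE {1}(coordE b'P x).
    rewrite -(coord_comb bP (fun i => ((\row_i coord b' i x) *m map_mx intr U) 0 i)).
    rewrite -comb; congr coord; by apply: eq_bigr => l _; rewrite mxE.
  by rewrite -mulmxA KU mulmx1.
have cE' x : (\row_i coord b' i x) *m map_mx intr U = \row_i coord b i x.
  by rewrite cE -mulmxA UK mulmx1.
exists b'; split=> //; split=> // x; rewrite LP; split=> [xi i|xi i].
  move/rowP: (cE x) => /(_ i); rewrite !mxE => ->; apply: rpred_sum => j _.
  by rewrite !mxE rpredM // rpred_int.
move/rowP: (cE' x) => /(_ i); rewrite !mxE => <-; apply: rpred_sum => j _.
by rewrite !mxE rpredM // rpred_int.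
Qed.

Lemma int_coord (L : set K) (b : m.-tuple K) x : Zbasis L b -> L x ->
  exists k : 'I_m -> int, forall i, coord b i x = (k i)%:~R.
Proof.
move=> [_ LP] /LP xi; have h i := cid (elimT intrP (xi i)).
by exists (fun i => projT1 (h i)) => i; exact: projT2 (h i).
Qed.

Lemma Zbasis_mem (L : set K) (b : m.-tuple K) (i : 'I_m) : Zbasis L b -> L b`_i.
Proof.
by move=> [bP LP]; apply/LP => j; rewrite (coord_b bP); case: eqP => _;
  rewrite ?rpred1 ?rpred0.
Qed.

(** Elementary divisors: the Smith normal form of the matrix of a basis of I in a basis of OK
    provides a basis of OK in which I is cut out coordinate by coordinate. *)
Lemma adapted_Zbasis I : nzideal I ->
  exists (b : m.-tuple K) (d : 'I_m -> nat), [/\ (forall i, 0 < d i)%N,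
    Zbasis (@OK K) b
  & forall x, I x <-> forall i, exists z : int, coord b i x = z%:~R * (d i)%:R].
Proof.
move=> iI.
have [b bZ] := nzideal_Zbasis (nzideal_OK K); have [c cZ] := nzideal_Zbasis iI.
have [[bP bO] [cP cI]] := (bZ, cZ).
have cO (i : 'I_m) : @OK K c`_i by apply: (nzi_sub iI); exact: Zbasis_mem.
have h (i : 'I_m) := cid (int_coord bZ (cO i)).
pose M : 'M[int]_m := \matrix_(i, j) projT1 (h i) j.
have ME (i j : 'I_m) : coord b j c`_i = (M i j)%:~R.
  by rewrite (projT2 (h i) j) mxE.
have cbE x : \row_i coord b i x = (\row_i coord c i x) *m map_mx intr M.
  apply/rowP => j; rewrite !mxE {1}(coordE cP x) linear_sum; apply: eq_bigr => i _.
  by rewrite linearZ /= ME !mxE.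
have [L uL [U uU [d _ MLU]]] := int_Smith_normal_form M.
have [b' [b'Z b'E b'c]] := Zbasis_change bZ uU.
pose D : 'M[int]_m := \matrix_(i, j) (d`_i *+ (i == j :> nat)).
have DE (u : 'rV[rat]_m) i : (u *m map_mx intr D) 0 i = u 0 i * (d`_i)%:~R.
  rewrite mxE (bigD1 i) //= big1 ?addr0 => [|j ji].
    by rewrite !mxE eqxx mulr1n.
  by rewrite !mxE (negbTE (ji : j != i :> nat)) mulr0n mulr0.
have key x : \row_i coord b' i x =
    (\row_i coord c i x) *m map_mx intr L *m map_mx intr D.
  rewrite b'c cbE MLU -/D !map_mxM -!mulmxA -map_mxM mulmxV // map_mx1 mulmx1.
  by rewrite !mulmxA.
(* [key] holds on all of K, so a zero invariant factor would make the i-th coordinate of every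
   element vanish. *)
have d0 (i : 'I_m) : d`_i != 0.
  apply/eqP => di0.
  have /rowP/(_ i) := key b'`_i; rewrite DE di0 mulr0 mxE (coord_b b'Z.1) eqxx.
  by move/eqP; rewrite oner_eq0.
exists b', (fun i : 'I_m => `|(d`_i)%R|%N); split=> // [i|x]; first by rewrite absz_gt0.
(* Smith's form may have negative entries; their signs go into the integer factor. *)
have dE (i : 'I_m) : exists e : int, ((d`_i)%:~R = e%:~R * (`|(d`_i)%R|%N)%:R :> rat)
    /\ ((`|(d`_i)%R|%N)%:R = e%:~R * (d`_i)%:~R :> rat).
  exists (Num.sg d`_i); split.
    by rewrite natr_absz -rmorphM /= -numEsg.
  by rewrite natr_absz -rmorphM /= normrEsg.
rewrite cI; split=> [xi i|xi i].
  have /intrP[z zE] : ((\row_i coord c i x) *m map_mx intr L) 0 i \is a Num.int.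
    rewrite mxE; apply: rpred_sum => j _.
    by rewrite !mxE rpredM // rpred_int.
  have /rowP/(_ i) := key x; rewrite DE mxE => ->; have [e [-> _]] := dE i.
  by rewrite zE; exists (z * e); rewrite rmorphM /= mulrA.
have wi j : ((\row_i coord c i x) *m map_mx intr L) 0 j \is a Num.int.
  have [z zE] := xi j; have [e [_ eE]] := dE j.
  have /rowP/(_ j) := key x; rewrite DE mxE zE eE mulrA.
  have dj0 : (d`_j)%:~R != 0 :> rat by rewrite intr_eq0.
  by move/(mulIf dj0) <-; rewrite rpredM ?rpred_int.
have <- : ((\row_i coord c i x) *m map_mx intr L *m map_mx intr (invmx L)) 0 i
    = coord c i x.
  by rewrite -mulmxA -map_mxM mulmxV // map_mx1 mulmx1 mxE.
move: wi; move: (_ *m map_mx intr L) => w wi; rewrite mxE; apply: rpred_sum => j _.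
by rewrite rpredM ?wi // mxE rpred_int.
Qed.

(** A system of representatives of OK / I indexed by a finite type, so that indices are compared and
    multiplied as cardinalities of types rather than of sets of cosets. *)
Definition residues I (T : finType) (f : T -> K) :=
  [/\ forall t, OK (f t), forall t t', I (f t - f t') -> t = t'
    & forall x, OK x -> exists t, I (x - f t)].

Lemma eq_modz (p q r : nat) (z : int) : p%:Z - q%:Z = z * r%:Z ->
  (p < r)%N -> (q < r)%N -> p = q.
Proof. by case: (ltgtP z 0) => z0; nia. Qed.

(** The representatives are the elements whose i-th coordinate is a natural number below [d i];
    Euclidean division of the coordinates reaches them. *)
Lemma adapted_residues I (b : m.-tuple K) (d : 'I_m -> nat) :
  (forall i, 0 < d i)%N -> Zbasis (@OK K) b ->
  (forall x, I x <-> forall i, exists z : int, coord b i x = z%:~R * (d i)%:R) ->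
  exists (T : finType) (f : T -> K), residues I f /\ #|T| = (\prod_i d i)%N.
Proof.
move=> d0 bZ IP; have [bP _] := bZ.
pose T := {dffun forall i : 'I_m, 'I_(d i)}.
exists T, (fun t : T => \sum_i ((t i : nat)%:R : rat) *: b`_i).
split; last first.
  rewrite card_dep_ffun foldrE big_image /=; apply: eq_bigr => i _.
  by rewrite card_ord.
have cf (t : T) i : coord b i (\sum_i ((t i : nat)%:R : rat) *: b`_i) = (t i : nat)%:R.
  by rewrite (coord_comb bP (fun i => (t i : nat)%:R)).
split=> [t|t t' It|x Ox].
- by apply/bZ.2 => i; rewrite cf; apply: rpred_nat.
- apply/ffunP => i; apply: val_inj => /=.
  have [z] := (IP _).1 It i; rewrite linearB /= !cf => E.
  have {}E : (t i : nat)%:Z - (t' i : nat)%:Z = z * (d i)%:Z.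
    by apply: (@intr_inj rat); rewrite rmorphB rmorphM /= -!pmulrn.
  exact: (eq_modz E).
have [k kE] := int_coord bZ Ox.
have lt i : (`|(k i %% (d i)%:Z)%Z|%N < d i)%N.
  by rewrite -ltz_nat gez0_abs ?modz_ge0 ?ltz_pmod ?ltz_nat // -lt0n.
exists [ffun i => Ordinal (lt i)]; apply/IP => i; exists (k i %/ (d i)%:Z)%Z.
rewrite linearB /= cf kE ffunE /= natr_absz.
rewrite ger0_norm ?modz_ge0 -?lt0n // -[(d i)%:R]/((d i)%:Z%:~R).
by rewrite -rmorphB -rmorphM /= {1}(divz_eq (k i) (d i)) addrK.
Qed.

Lemma residues_exist I : nzideal I -> exists (T : finType) (f : T -> K), residues I f.
Proof.
move=> iI; have [b [d [d0 bZ IP]]] := adapted_Zbasis iI.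
by have [T [f [rf _]]] := adapted_residues d0 bZ IP; exists T, f.
Qed.

Lemma ideal_norm_residues I (T : finType) (f : T -> K) : nzideal I -> residues I f ->
  ideal_norm I = #|T|.
Proof.
move=> iI [fO finj fsurj].
pose C x : set K := [set y | OK y /\ I (y - x)].
have CE x y : OK x -> OK y -> I (x - y) -> C x = C y.
  move=> Ox Oy Ixy; apply/seteqP; split=> z [Oz Iz]; split=> //.
    by rewrite -(subrKA x); apply: nziD.
  rewrite -(subrKA y); apply: nziD => //.
  by rewrite -opprB -sub0r; apply: nziB => //; exact: nzi0.
rewrite /ideal_norm (_ : [set _ | x in _] = [set` [fset C (f t) | t in T]%fset]).
  rewrite set_fsetK card_imfset /= ?cardE // => t t' Ctt'; apply: finj.
  have : C (f t) (f t) by split=> //; rewrite subrr; exact: nzi0.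
  by rewrite Ctt' => -[].
apply/seteqP; split=> [_ [x Ox <-]|A /=].
  have [t It] := fsurj x Ox; apply/imfsetP; exists t => //.
  exact: CE.
by case/imfsetP => t _ ->; exists (f t).
Qed.

Lemma ideal_norm_gt0 I : nzideal I -> (0 < ideal_norm I)%N.
Proof.
move=> iI; have [T [f rf]] := residues_exist iI.
rewrite (ideal_norm_residues iI rf); have [_ _ fs] := rf.
by have [t _] := fs 0 (OK0 K); apply/card_gt0P; exists t.
Qed.

Lemma adapted_Zbasis_norm I : nzideal I ->
  exists (b : m.-tuple K) (d : 'I_m -> nat), [/\ (forall i, 0 < d i)%N,
    Zbasis (@OK K) b,
    forall x, I x <-> forall i, exists z : int, coord b i x = z%:~R * (d i)%:R
  & ideal_norm I = (\prod_i d i)%N].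
Proof.
move=> iI; have [b [d [d0 bZ IP]]] := adapted_Zbasis iI.
exists b, d; split=> //; have [T [f [rf <-]]] := adapted_residues d0 bZ IP.
exact: ideal_norm_residues rf.
Qed.

(** [ps] sends a class modulo J to the class modulo I of its representative, injectively. Were it
    onto, the I-classes of x and of 0 would come from J-classes which are both the zero class, so
    they would agree and x would lie in I. *)
Lemma ideal_norm_lt I J : nzideal I -> nzideal J -> I `<=` J ->
  (exists2 x, J x & ~ I x) -> (ideal_norm J < ideal_norm I)%N.
Proof.
move=> iI iJ IJ [x Jx nIx].
have [T [f rf]] := residues_exist iI; have [S [g rg]] := residues_exist iJ.
rewrite (ideal_norm_residues iI rf) (ideal_norm_residues iJ rg).
have [[fO finj fs] [gO ginj gs]] := (rf, rg).
have h t := cid (gs _ (fO t)).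
pose phi t := projT1 (h t); have phiE t : J (f t - g (phi t)) := projT2 (h t).
have psi s := cid (fs _ (gO s)).
pose ps s := projT1 (psi s); have psE s : I (g s - f (ps s)) := projT2 (psi s).
have psI : injective ps.
  move=> s s' E; apply: ginj.
  have := nziB iJ (IJ _ (psE s)) (IJ _ (psE s')); rewrite E.
  by rewrite opprB addrA subrK.
rewrite ltnNge; apply/negP => leTS; apply: nIx.
have on t : exists s, t = ps s.
  by have /codomP[s ->] := inj_card_onto psI leTS t; exists s.
have [t It] := fs x (nzi_sub iJ Jx); have [t0 It0] := fs 0 (OK0 K).
have JB y t' : J y -> I (y - f t') -> forall s, t' = ps s -> J (g s).
  move=> Jy Iy s ts; rewrite -(subrK (f t') (g s)) {1}ts.
  apply: nziD => //; first exact/IJ/psE.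
  by rewrite -[f t'](subKr y); apply: nziB => //; exact: IJ.
have [[s ts] [s0 ts0]] := (on t, on t0).
have tt0 : t = t0.
  rewrite ts ts0; congr ps; apply: ginj.
  by apply: nziB => //; [exact: (JB x t)|exact: (JB 0 t0 (nzi0 iJ))].
have := nziB iI It It0; rewrite tt0 opprB addrA subrK subr0.
by [].
Qed.

End Index.

(** * Finite places *)

Section Places.
Variable K : fieldExtType rat.
Implicit Types (x y z : K) (I : set K) (v : finplace K).

Lemma pigeonhole I (y : nat -> K) : nzideal I -> (forall i, OK (y i)) ->
  exists i j, (i < j)%N /\ I (y i - y j).
Proof.
move=> iI Oy; have [T [f [fO finj fs]]] := residues_exist iI.
pose t i := projT1 (cid (fs _ (Oy i))).
have tE i : I (y i - f (t i)) := projT2 (cid (fs _ (Oy i))).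
have key i j : t i = t j -> I (y i - y j).
  by move=> tt; have := nziB iI (tE i) (tE j); rewrite tt opprB addrA subrK.
pose g (i : 'I_#|T|.+1) := t i.
have : ~ injective g.
  by move/leq_card; rewrite card_ord ltnn.
apply: contra_notP => H i j /key Iij; apply/val_inj/eqP/negPn/negP => ij.
apply: H; move: ij; rewrite neq_ltn => /orP[ij|ji]; first by exists i, j.
exists j, i; split=> //; rewrite -opprB -sub0r.
by apply: nziB => //; exact: nzi0.
Qed.

Lemma fp_ideal v : nzideal (val v).
Proof.
have [[PO [x Px x0]] [P0 PB] PM P1 Pp] := finplaceP v.
by split=> //; exists x.
Qed.
Hint Resolve fp_ideal : core.

Lemma fp_OK v x : val v x -> OK x. Proof. exact: (nzi_sub (fp_ideal v)). Qed.

Lemma fp_prime v a b : OK a -> OK b -> val v (a * b) -> val v a \/ val v b.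
Proof. by have [_ _ _ _] := finplaceP v; exact. Qed.

Lemma fp_notM v a b : OK a -> OK b -> ~ val v a -> ~ val v b -> ~ val v (a * b).
Proof. by move=> Oa Ob na nb /(fp_prime Oa Ob)[]. Qed.

Lemma fp_not1 v : ~ val v 1. Proof. by have [] := finplaceP v. Qed.

Lemma fp_notX v a k : OK a -> ~ val v a -> ~ val v (a ^+ k).
Proof.
move=> Oa na; elim: k => [|k IHk]; first by rewrite expr0; exact: fp_not1.
by rewrite exprS; apply: fp_notM => //; exact: OKX.
Qed.

Lemma fp_not_prod v (T : finType) (s : T -> K) :
  (forall i, OK (s i)) -> (forall i, ~ val v (s i)) -> ~ val v (\prod_i s i).
Proof.
move=> Os ns; suff [] : OK (\prod_i s i) /\ ~ val v (\prod_i s i) by [].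
elim/big_ind: _ => [|x y [Ox nx] [Oy ny]|//]; first by split; [exact: OK1|exact: fp_not1].
by split; [exact: OKM|exact: fp_notM].
Qed.

Lemma fp_not1B v p : val v p -> ~ val v (1 - p).
Proof.
by move=> Pp P1; apply: (@fp_not1 v); rewrite -(subrK p 1); exact: nziD.
Qed.

(** Two powers of a agree modulo the prime v; cancelling the smaller one leaves a positive power of
    a congruent to 1. *)
Lemma inv_mod v a : OK a -> ~ val v a -> exists2 c, OK c & val v (1 - a * c).
Proof.
move=> Oa na; have [i [j [ij Pij]]] := pigeonhole (fp_ideal v) (fun i => OKX i Oa).
have jE : j = (i + (j - i.+1).+1)%N by lia.
exists (a ^+ (j - i.+1)); first exact: OKX.
move: Pij; rewrite {1}jE exprD exprS -[X in _ - X]/(_ * _) -{1}[a ^+ i]mulr1 -mulrBr.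
case/fp_prime; [exact: OKX| |by move/(fp_notX Oa na)|by []].
by apply: OKB; [exact: OK1|apply: OKM => //; exact: OKX].
Qed.

Lemma fp_maximal v w : val v `<=` val w -> v = w.
Proof.
move=> vw; apply/val_inj/seteqP; split=> // x wx.
apply: contrapT => nvx; have [c Oc vc] := inv_mod (fp_OK wx) nvx.
apply: (@fp_not1 w); rewrite -(subrK (x * c) 1).
by apply: nziD => //; [exact: vw|rewrite mulrC; exact: nziM].
Qed.

(* A nonzero element of the socle of the localization of OK / I at P: if every
   y outside I_P had a multiple p y, p in P, still outside I_P, an infinite
   chain of such multiples would contradict the finiteness of OK / I. *)
Lemma socle v I : nzideal I -> I `<=` val v ->
  exists y, [/\ OK y, forall s, OK s -> ~ val v s -> ~ I (s * y)
              & forall p, val v p -> I (p * y)].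
Proof.
move=> iI IP; pose IL x := exists s, [/\ OK s, ~ val v s & I (s * x)].
have [y [Oy ny yP]] : exists y, [/\ OK y, ~ IL y & forall p, val v p -> IL (p * y)].
  apply: contrapT => H.
  have next (y : {y : K | OK y /\ ~ IL y}) :
      exists y' : {y : K | OK y /\ ~ IL y}, exists2 p, val v p & sval y' = p * sval y.
    case: y => y [Oy ny] /=; apply: contrapT => H'; apply: H; exists y; split=> // p Pp.
    apply: contrapT => npy; apply: H'.
    by exists (exist _ (p * y) (conj (OKM (fp_OK Pp) Oy) npy)); exists p.
  have n1 : ~ IL 1.
    by move=> [s [Os ns]]; rewrite mulr1 => /IP.
  pose f (y : {y : K | OK y /\ ~ IL y}) := projT1 (cid (next y)).
  have fE (y : {y : K | OK y /\ ~ IL y}) : exists2 p, val v p & sval (f y) = p * sval y := projT2 (cid (next y)).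
  pose y0 : {y : K | OK y /\ ~ IL y} := exist _ 1 (conj (OK1 K) n1).
  pose y i := iter i f y0.
  have step i k : exists2 p, val v p & sval (y (i + k.+1)%N) = p * sval (y i).
    elim: k => [|k [p Pp E]]; first by rewrite addn1; exact: fE.
    rewrite addnS; have [p' Pp' E'] := fE (y (i + k.+1)%N).
    exists (p' * p); first by apply: nziM => //; exact: fp_OK Pp'.
    by rewrite -mulrA -E.
  have [i [j [ij Iij]]] := pigeonhole iI (fun i => (svalP (y i)).1).
  have [p Pp E] := step i (j - i.+1)%N.
  have jE : j = (i + (j - i.+1).+1)%N by lia.
  rewrite -jE in E; apply: (svalP (y i)).2; exists (1 - p); split.
  - by apply: OKB; [exact: OK1|exact: fp_OK Pp].
  - exact: fp_not1B.
  - by rewrite mulrBl mul1r -E.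
(* So far each p in v has its own multiplier s outside v with [s * (p * y)] in I. Multiplying y by
   the multipliers of a Z-basis of v makes all of v send it into I itself. *)
have [b bZ] := nzideal_Zbasis (fp_ideal v).
have h (i : 'I_(\dim {:K})) := cid (yP _ (Zbasis_mem i bZ)).
pose s i := sval (h i).
have sO i : OK (s i) by have [] := svalP (h i).
have sP i : ~ val v (s i) by have [] := svalP (h i).
have sI i : I (s i * (b`_i * y)) by have [] := svalP (h i).
have OS : OK (\prod_i s i) by exact: OK_prod.
exists ((\prod_i s i) * y); split=> [|t Ot nt It|p Pp]; first exact: OKM.
  apply: ny; exists (t * \prod_i s i); split; last by rewrite -mulrA.
    exact: OKM.
  by apply: fp_notM => //; exact: fp_not_prod.
have [k kE] := int_coord bZ Pp; have [bP _] := bZ.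
rewrite mulrCA (coordE bP p) mulr_suml mulr_sumr.
apply: (big_ind I) => [|x z Ix Iz|i _]; [exact: nzi0 iI|exact: (nziD iI)|].
rewrite kE scale_int (bigD1 i) //=.
set w := \prod_(_ | _) _; have -> : s i * w * ((k i)%:~R * b`_i * y)
  = w * (k i)%:~R * (s i * (b`_i * y)) by ring.
by apply: nziM => //; apply: OKM; [exact: OK_prod|exact: OK_int].
Qed.

(** The local ring is a discrete valuation ring. For a in v and y in the socle modulo (a), x = y / a
    satisfies x v [<=] OK. If x v were inside v, the determinant trick would make x integral,
    against the choice of y. So x b lies outside v for some b in v, and [(x * b) * p = (x * p) * b]
    shows that b is a uniformizer. *)
Lemma uniformizer_exists v : exists q, [/\ val v q, q != 0
  & forall p, val v p -> exists a s, [/\ OK a, OK s, ~ val v s & s * p = a * q]].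
Proof.
have [a Pa a0] := nzi_neq0 (fp_ideal v); have Oa := fp_OK Pa.
pose I := [set a * x | x in @OK K].
have iI : nzideal I by exact: nzideal_principal.
have IP : I `<=` val v by move=> _ [x Ox <-]; rewrite mulrC; exact: nziM.
have [y [Oy ny yP]] := socle iI IP.
pose x := y / a.
have xO p : val v p -> OK (x * p).
  by move/yP => [t Ot E]; rewrite /x mulrAC [y * p]mulrC -E mulrC mulKf.
have [b [Pb nb]] : exists b, val v b /\ ~ val v (x * b).
  apply: contrapT => H.
  have xP p : val v p -> val v (x * p).
    by move=> Pp; apply: contrapT => np; apply: H; exists p.
  have [c cZ] := nzideal_Zbasis (fp_ideal v); have [cP _] := cZ.
  have h (j : 'I_(\dim {:K})) := cid (int_coord cZ (xP _ (Zbasis_mem j cZ))).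
  have Ox : OK x.
    apply: (@OK_eigen _ _ (\row_j c`_j) (\matrix_(i, j) sval (h j) i)).
      exact: row_basis_neq0.
    rewrite -(mulmatE cP); congr (_ *m _); apply/matrixP => i j.
    by rewrite !mxE (svalP (h j) i) /= scale_int mulr1.
  apply: (ny 1); [exact: OK1|exact: fp_not1|].
  by exists x => //; rewrite /x mul1r mulrC divfK.
exists b; split=> // [|p Pp].
  by apply/eqP => b0; apply: nb; rewrite b0 mulr0; exact: nzi0.
by exists (x * p), (x * b); split=> //; [exact: xO|exact: xO|ring].
Qed.

Definition uniformizer v : K := projT1 (cid (uniformizer_exists v)).

Lemma natK_eq0 (N : nat) : (N%:R == 0 :> K) = (N == 0%N).
Proof.
have -> : N%:R = in_alg K N%:R by rewrite rmorph_nat.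
by rewrite fmorph_eq0 pnatr_eq0.
Qed.

Lemma uniformizerP v : [/\ val v (uniformizer v), uniformizer v != 0
  & forall p, val v p ->
    exists a s, [/\ OK a, OK s, ~ val v s & s * p = a * uniformizer v]].
Proof. exact: (projT2 (cid (uniformizer_exists v))). Qed.

Definition locunit v x :=
  exists a b, [/\ OK a, OK b, ~ val v a, ~ val v b & x = a / b].

Lemma locunit_neq0 v x : locunit v x -> x != 0.
Proof.
by move=> [a [b [Oa Ob na nb ->]]]; rewrite mulf_neq0 ?invr_eq0 ?(notv_neq0 na) ?(notv_neq0 nb).
Qed.

Lemma locunitM v x y : locunit v x -> locunit v y -> locunit v (x * y).
Proof.
move=> [a [b [Oa Ob na nb ->]]] [c [d [Oc Od nc nd ->]]].
exists (a * c), (b * d); rewrite mulf_div.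
by split=> //; by [exact: OKM|exact: fp_notM].
Qed.

Lemma locunitV v x : locunit v x -> locunit v x^-1.
Proof. by move=> [a [b [Oa Ob na nb ->]]]; exists b, a; rewrite invf_div. Qed.

Lemma locunit1 v : locunit v 1.
Proof. by exists 1, 1; rewrite divr1; split=> //; by [exact: OK1|exact: fp_not1]. Qed.

Lemma locunit_locring v x : locunit v x -> locring v x.
Proof. by move=> [a [b [Oa Ob na nb ->]]]; exists a, b. Qed.

Lemma locring_OK v x : OK x -> locring v x.
Proof.
by move=> Ox; exists x, 1; rewrite divr1; split=> //; by [exact: OK1|exact: fp_not1].
Qed.

Lemma locringD v x y : locring v x -> locring v y -> locring v (x + y).
Proof.
move=> Lx Ly; rewrite -[y]opprK; apply: locringB => //.
by rewrite -sub0r; apply: locringB => //; apply: locring_OK; exact: OK0.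
Qed.

Lemma locringX v x k : locring v x -> locring v (x ^+ k).
Proof.
move=> Lx; elim: k => [|k IHk]; first exact: locring1.
by rewrite exprS; exact: locringM.
Qed.

(* A nonzero integral z divides q^i - q^j = q^i (1 - q^(j-i)) for some i < j,
   so it cannot be divisible by q^(i+1) in the local ring. *)
Lemma OK_vfactor v z : OK z -> z != 0 ->
  exists k u, locunit v u /\ z = uniformizer v ^+ k * u.
Proof.
move=> Oz z0; have [Pq q0 qP] := uniformizerP v; have Oq := fp_OK Pq.
pose I := [set z * x | x in @OK K].
have iI : nzideal I by exact: nzideal_principal.
have [i [j [ij [w Ow wE]]]] := pigeonhole iI (fun i => OKX i Oq).
have jE : j = (i + (j - i.+1).+1)%N by lia.
have {jE} E : uniformizer v ^+ i * (1 - uniformizer v ^+ (j - i.+1).+1) = z * w.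
  by rewrite wE {2}jE exprD mulrBr mulr1.
pose D k := `[< exists u, locring v u /\ z = uniformizer v ^+ k * u >].
have D0 : D 0%N by apply/asboolP; exists z; rewrite expr0 mul1r; split=> //; exact: locring_OK.
have Dle k : D k -> (k <= i)%N.
  move=> /asboolP[u [[a [b [Oa Ob nb ->]]] zE]]; rewrite leqNgt; apply/negP => ik.
  have kE : k = (i + (k - i.+1).+1)%N by lia.
  have b0 := notv_neq0 nb; have qi0 : uniformizer v ^+ i != 0 by rewrite expf_neq0.
  have : 1 - uniformizer v ^+ (j - i.+1).+1 = uniformizer v ^+ (k - i.+1).+1 * (a / b) * w.
    by apply: (mulfI qi0); rewrite E zE {1}kE exprD !mulrA.
  move=> E2; have : val v (b * (1 - uniformizer v ^+ (j - i.+1).+1)).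
    rewrite E2 (_ : b * _ = uniformizer v ^+ (k - i.+1) * a * w * uniformizer v).
      by apply: nziM => //; do 2!apply: OKM => //; exact: OKX.
    by rewrite exprS; field.
  apply: fp_notM => //; first by apply: OKB; [exact: OK1|exact: OKX].
  by apply: fp_not1B; rewrite exprSr; apply: nziM => //; exact: OKX.
case: (ex_maxnP (ex_intro D 0%N D0) Dle) => k /asboolP[_ [[a [b [Oa Ob nb ->]]] zE]] kmax.
exists k, (a / b); split=> //; exists a, b; split=> // Pa.
have [a' [s [Oa' Os ns sE]]] := qP _ Pa.
suff /kmax : D k.+1 by rewrite ltnn.
apply/asboolP; exists (a' / (s * b)); split.
  by exists a', (s * b); split=> //; [exact: OKM|exact: fp_notM].
have [b0 s0] := (notv_neq0 nb, notv_neq0 ns).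
have aE : a = a' * uniformizer v / s by rewrite -sE mulrC mulKf.
by rewrite zE aE exprSr; field; rewrite s0 b0.
Qed.

Lemma vfactor v z : z != 0 ->
  exists (k : int) u, locunit v u /\ z = uniformizer v ^ k * u.
Proof.
move=> z0; have [N N0 ON] := denominator z.
have Nz0 : N%:R != 0 :> K by rewrite natK_eq0 -lt0n.
have [k [u [uu kE]]] := OK_vfactor v ON (mulf_neq0 Nz0 z0).
have [l [w [uw lE]]] := OK_vfactor v (OK_nat K N) Nz0.
have [_ q0 _] := uniformizerP v.
exists (k%:Z - l%:Z), (u / w); split; first by apply: locunitM => //; exact: locunitV.
have -> : z = N%:R * z / N%:R by rewrite mulrC mulKf.
rewrite kE lE expfzDr // -invr_expz -!exprnP invfM; ring.
Qed.

Lemma vfactor_uniq v (k l : int) u w : locunit v u -> locunit v w ->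
  uniformizer v ^ k * u = uniformizer v ^ l * w -> k = l.
Proof.
have [Pq q0 _] := uniformizerP v.
suff H (k' l' : int) u' w' : locunit v u' -> locunit v w' ->
    uniformizer v ^ k' * u' = uniformizer v ^ l' * w' -> ~ (k' < l').
  move=> uu uw E; have h1 := H _ _ _ _ uu uw E; have h2 := H _ _ _ _ uw uu (esym E).
  by case: (ltgtP k l).
move=> uu uw E kl.
have [n nE] : exists n : nat, l' = k' + n.+1%:Z.
  by exists (`|l' - k'|%N.-1); lia.
have qk0 : uniformizer v ^ k' != 0 by rewrite expfz_neq0.
have {}E : u' = uniformizer v ^+ n.+1 * w'.
  by apply: (mulfI qk0); rewrite E nE expfzDr // -exprnP mulrA.
have [a [b [Oa Ob na nb uE]]] : locunit v (u' / w').
  by apply: locunitM => //; exact: locunitV.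
apply: na; have b0 := notv_neq0 nb.
have -> : a = b * uniformizer v ^+ n * uniformizer v.
  rewrite -mulrA -exprSr; have := uE; rewrite E mulfK ?(locunit_neq0 uw) // => ->.
  by rewrite mulrC divfK.
by apply: nziM => //; apply: OKM => //; apply: OKX; exact: fp_OK Pq.
Qed.

(** Valuation read off the factorization by a uniformizer in the local ring, where multiplicativity
    is immediate; [ordvE] identifies it with [ordv], defined by powers of the prime ideal. *)
Definition vord v z : int := xget 0 [set k |
  exists u, locunit v u /\ z = uniformizer v ^ k * u].

Lemma vordP v z : z != 0 ->
  exists u, locunit v u /\ z = uniformizer v ^ vord v z * u.
Proof. move=> /(vfactor v)[k [u H]].
by apply: (@xgetPex _ 0 [set k | exists u, locunit v u /\ z = uniformizer v ^ k * u]); exists k, u. Qed.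

Lemma vordE v (k : int) u : locunit v u -> vord v (uniformizer v ^ k * u) = k.
Proof.
move=> uu; have [_ q0 _] := uniformizerP v.
have z0 : uniformizer v ^ k * u != 0 by rewrite mulf_neq0 ?expfz_neq0 ?(locunit_neq0 uu).
have [w [uw E]] := vordP v z0.
by symmetry; exact: vfactor_uniq uu uw E.
Qed.

Lemma vordM v x y : x != 0 -> y != 0 -> vord v (x * y) = vord v x + vord v y.
Proof.
have [_ q0 _] := uniformizerP v.
move=> /(vordP v)[u [uu xE]] /(vordP v)[w [uw yE]].
rewrite {1}xE {1}yE mulrACA -expfzDr // vordE //.
exact: locunitM.
Qed.

Lemma vord1 v : vord v 1 = 0.
Proof. by rewrite -[1]mulr1 -{1}(expr0z (uniformizer v)) vordE //; exact: locunit1. Qed.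

Lemma vord_uniformizer v : vord v (uniformizer v) = 1.
Proof. by rewrite -[uniformizer v]mulr1 -{1}[uniformizer v]expr1z vordE //; exact: locunit1. Qed.

Lemma vord_ge0 v x : x != 0 -> (0 <= vord v x) <-> locring v x.
Proof.
have [Pq q0 _] := uniformizerP v.
move=> x0; have [u [uu xE]] := vordP v x0; split=> [k0|[a [b [Oa Ob nb xab]]]].
  rewrite xE; apply: locringM; last exact: locunit_locring.
  case: (vord v x) k0 => // k _; apply: locringX; apply: locring_OK; exact: fp_OK Pq.
have b0 := notv_neq0 nb.
have a0 : a != 0 by apply: contra x0 => /eqP a0; rewrite xab a0 mul0r.
have [k [w [uw aE]]] := OK_vfactor v Oa a0.
rewrite xab aE -mulrA exprnP vordE //; apply: locunitM => //.
by apply: locunitV; exists b, 1; rewrite divr1; split=> //; by [exact: OK1|exact: fp_not1].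
Qed.

Lemma idealX_closed v k : [/\ idealX (val v) k 0,
  forall x y, idealX (val v) k x -> idealX (val v) k y -> idealX (val v) k (x + y)
  & forall t x, val v t -> idealX (val v) k x -> idealX (val v) k.+1 (t * x)].
Proof.
split.
- case: k => [|k]; first exact: OK0.
  by exists [::]; rewrite ?big_nil.
- case: k => [|k] x y; first exact: OKD.
  move=> [s sP ->] [t tP ->]; exists (s ++ t); last by rewrite big_cat.
  by move=> p; rewrite mem_cat => /orP[/sP|/tP].
- move=> t x Pt Ix; exists [:: (t, x)]; last by rewrite big_seq1.
  by move=> p; rewrite inE => /eqP ->.
Qed.

(** No power of v is lost by localizing. For the converse, write x = q^k a / b and take c with 1 -
    bc in v: in x = (1 - bc)^k x + (1 - (1 - bc)^k) x, the first term lies in v^k, and the second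
    factor of the other term is divisible by b, which cancels the denominator. *)
Lemma idealXE v k x : idealX (val v) k x <->
  OK x /\ exists2 l, locring v l & x = uniformizer v ^+ k * l.
Proof.
have [Pq q0 qP] := uniformizerP v.
split.
  elim: k x => [|k IHk] x.
    by move=> /= Ox; split=> //; exists x; [exact: locring_OK|rewrite mul1r].
  move=> [s sP ->]; split.
    rewrite big_seq; apply: OK_sum => p /sP[Pp /IHk[Op _]].
    by apply: OKM => //; exact: fp_OK Pp.
  suff : exists2 l, locring v l & \sum_(p <- s) p.1 * p.2 = uniformizer v ^+ k.+1 * l.
    by [].
  rewrite big_seq; elim/big_ind: _ => [|y z [l Ll ->] [l' Ll' ->]|p /sP[Pp /IHk[Op [l Ll ->]]]].
  - by exists 0; [apply: locring_OK; exact: OK0|rewrite mulr0].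
  - by exists (l + l'); [exact: locringD|rewrite mulrDr].
  have [a [t [Oa Ot nt tE]]] := qP _ Pp; have t0 := notv_neq0 nt.
  exists (a / t * l); first by apply: locringM => //; exists a, t.
  have -> : p.1 = a * uniformizer v / t by rewrite -tE mulrC mulKf.
  by rewrite exprS; field.
move=> [Ox [_ [a [b [Oa Ob nb ->]]] xE]].
have [c Oc Pc] := inv_mod Ob nb; have b0 := notv_neq0 nb.
have powP t y : val v t -> OK y -> idealX (val v) k (t ^+ k * y).
  move=> Pt Oy; elim: (k) => [|l IHl]; first by rewrite mul1r.
  by rewrite exprS -mulrA; have [_ _] := idealX_closed v l; exact.
have -> : x = (1 - b * c) ^+ k * x + (1 - (1 - b * c) ^+ k) * x by ring.
have [_ XD _] := idealX_closed v k; apply: XD; first exact: powP.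
have -> : 1 - (1 - b * c) ^+ k = b * (c * \sum_(i < k) (1 - b * c) ^+ i).
  by rewrite -opprB subrX1 -mulNr opprB subKr mulrA.
set S := \sum_(_ < _) _.
have -> : b * (c * S) * x = uniformizer v ^+ k * (a * c * S) by rewrite xE; field.
apply: powP => //; apply: OKM; first exact: OKM.
apply: OK_sum => i _; apply: OKX; exact: fp_OK Pc.
Qed.

Lemma idealX_exact v k x : idealX (val v) k x /\ ~ idealX (val v) k.+1 x <->
  [/\ OK x, x != 0 & vord v x = k%:Z].
Proof.
have [Pq q0 qP] := uniformizerP v; rewrite !idealXE.
have key l : x != 0 -> (exists2 t, locring v t & x = uniformizer v ^+ l * t) <->
    l%:Z <= vord v x.
  move=> x0; have ql0 : uniformizer v ^+ l != 0 by rewrite expf_neq0.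
  have xl0 : x / uniformizer v ^+ l != 0 by rewrite mulf_neq0 ?invr_eq0.
  have xlE : x = uniformizer v ^+ l * (x / uniformizer v ^+ l) by rewrite mulrC divfK.
  have lE : vord v (uniformizer v ^+ l) = l.
    by rewrite exprnP -[_ ^ _]mulr1 vordE //; exact: locunit1.
  have vE : vord v x = l%:Z + vord v (x / uniformizer v ^+ l).
    by rewrite {1}xlE vordM // lE.
  rewrite vE lerDl; split=> [[t Lt E]|/vord_ge0 H]; last by exists (x / uniformizer v ^+ l); [exact: H|].
  by apply/vord_ge0 => //; rewrite E mulrC mulKf.
split=> [[[Ox xk] nk]|[Ox x0 vE]].
  have x0 : x != 0.
    apply/eqP => x0; apply: nk; split=> //; exists 0; rewrite ?mulr0 //.
    by apply: locring_OK; exact: OK0.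
  split=> //; apply/eqP; rewrite eq_le; apply/andP; split; last exact/key.
  rewrite leNgt; apply/negP => lt; apply: nk; split=> //; exact/key.
split; first by split=> //; apply/key => //; rewrite vE.
by move=> [_ /(key _ x0)]; rewrite vE; lia.
Qed.

Lemma ordvE v x : x != 0 -> ordv v x = vord v x.
Proof.
move=> x0; have [N N0 ON] := denominator x.
have Nz0 : N%:R != 0 :> K by rewrite natK_eq0 -lt0n.
rewrite /ordv; set S := [set z | _].
have Sz (z : int) : S z -> z = vord v x.
  move=> [a [b [k [l [xab /idealX_exact[Oa a0 ak] /idealX_exact[Ob b0 bl] ->]]]]].
  by rewrite -ak -bl; apply/eqP; rewrite subr_eq -vordM // xab divfK.
have ord_nat y : OK y -> y != 0 -> exists k : nat, vord v y = k%:Z.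
  move=> Oy y0; have /(vord_ge0 v y0) := locring_OK v Oy.
  by case: (vord v y) => // k _; exists k.
have [k kE] := ord_nat _ ON (mulf_neq0 Nz0 x0); have [l lE] := ord_nat _ (OK_nat K N) Nz0.
apply: Sz; apply: (@xgetPex _ 0 S); exists (k%:Z - l%:Z); exists (N%:R * x), N%:R, k, l.
split=> //; first by rewrite mulrC mulKf.
- by apply/idealX_exact; split=> //; rewrite mulf_neq0.
- by apply/idealX_exact; split=> //; exact: OK_nat.
Qed.

Lemma fp_norm_ge2 v : (2 <= ideal_norm (val v))%N.
Proof.
apply: leq_ltn_trans (ideal_norm_gt0 (nzideal_OK K)) _.
apply: ideal_norm_lt => //; [exact: nzideal_OK|exact: nzi_sub|].
by exists 1; [exact: OK1|exact: fp_not1].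
Qed.

Section AbsK.
Variable R : realType.
Local Notation abs := (@absK R K).
Local Notation N v := ((ideal_norm (val v))%:R : R).

Lemma fp_normR_gt1 v : 1 < N v.
Proof. by rewrite ltr1n; exact: fp_norm_ge2. Qed.

Lemma fp_normR_gt0 v : 0 < N v.
Proof. exact: lt_trans (fp_normR_gt1 v). Qed.

Lemma absK0 v : abs v 0 = 0. Proof. by rewrite /absK eqxx. Qed.

Lemma absKE v x : x != 0 -> abs v x = N v ^ (- vord v x).
Proof. by move=> x0; rewrite /absK (negbTE x0) ordvE. Qed.

Lemma absK_gt0 v x : x != 0 -> 0 < abs v x.
Proof. by move=> x0; rewrite absKE // exprz_gt0 // fp_normR_gt0. Qed.

Lemma absK_ge0 v x : 0 <= abs v x.
Proof. by have [->|/absK_gt0/ltW//] := eqVneq x 0; rewrite absK0. Qed.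

Lemma absK_eq0 v x : (abs v x == 0) = (x == 0).
Proof. by have [->|x0] := eqVneq x 0; rewrite ?absK0 ?eqxx // gt_eqF // absK_gt0. Qed.

Lemma absKM v x y : abs v (x * y) = abs v x * abs v y.
Proof.
have [->|x0] := eqVneq x 0; first by rewrite mul0r absK0 mul0r.
have [->|y0] := eqVneq y 0; first by rewrite mulr0 absK0 mulr0.
rewrite !absKE ?mulf_neq0 // vordM // opprD expfzDr //.
by rewrite gt_eqF // fp_normR_gt0.
Qed.

Lemma absK1 v : abs v 1 = 1.
Proof. by rewrite absKE ?oner_neq0 // vord1 oppr0 expr0z. Qed.

Lemma absKX v x k : abs v (x ^+ k) = abs v x ^+ k.
Proof.
by elim: k => [|k IHk]; rewrite ?absK1 // !exprS absKM IHk.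
Qed.

Lemma absKV v x : abs v x^-1 = (abs v x)^-1.
Proof.
have [->|x0] := eqVneq x 0; first by rewrite invr0 absK0 invr0.
have a0 : abs v x != 0 by rewrite absK_eq0.
by apply: (mulfI a0); rewrite -absKM !divff // absK1.
Qed.

Lemma absK_prod v (T : Type) (r : seq T) (F : T -> K) :
  abs v (\prod_(i <- r) F i) = \prod_(i <- r) abs v (F i).
Proof. by elim/big_rec2: _ => [|i y z _ <-]; rewrite ?absK1 ?absKM. Qed.

Lemma absK_le1 v x : abs v x <= 1 <-> locring v x.
Proof.
have [->|x0] := eqVneq x 0.
  by rewrite absK0 ler01; split=> // _; apply: locring_OK; exact: OK0.
by rewrite absKE // -vord_ge0 // -(expr0z (N v)) ler_eXz2l ?fp_normR_gt1 // oppr_le0.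
Qed.

Lemma absK_OK v x : OK x -> abs v x <= 1.
Proof. by move=> Ox; apply/absK_le1; exact: locring_OK. Qed.

Lemma absKN v x : abs v (- x) = abs v x.
Proof.
rewrite -mulN1r absKM; suff -> : abs v (-1) = 1 by rewrite mul1r.
apply/eqP; rewrite -(@eqrXn2 _ 2) ?absK_ge0 //.
by rewrite -absKX sqrrN !expr1n absK1.
Qed.

Lemma absKD v x y c : abs v x <= c -> abs v y <= c -> abs v (x + y) <= c.
Proof.
wlog yx : x y / abs v y <= abs v x => [H|].
  by case/orP: (le_total (abs v y) (abs v x)) => h xc yc; [|rewrite addrC]; apply: H.
move=> xc _; have [x0|x0] := eqVneq x 0.
  rewrite x0 add0r; apply: le_trans xc; rewrite x0 absK0 in yx *.
  exact: yx.
apply: le_trans xc; have -> : x + y = x * (1 + y / x) by rewrite mulrDr mulr1 mulrCA divff ?mulr1.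
rewrite absKM ler_piMr ?absK_ge0 //; apply/absK_le1; apply: locringD; first exact: locring1.
by apply/absK_le1; rewrite absKM absKV ler_pdivrMr ?mul1r // absK_gt0.
Qed.

Lemma absKB v x y c : abs v x <= c -> abs v y <= c -> abs v (x - y) <= c.
Proof. by move=> xc yc; apply: absKD; rewrite ?absKN. Qed.

Lemma absK_sum v (T : Type) (r : seq T) (P : pred T) (F : T -> K) c : 0 <= c ->
  (forall i, P i -> abs v (F i) <= c) -> abs v (\sum_(i <- r | P i) F i) <= c.
Proof.
move=> c0 Fc; elim/big_ind: _ => [|x y|i Pi]; [by rewrite absK0|exact: absKD|exact: Fc].
Qed.

Lemma absK_uniformizer v : abs v (uniformizer v) = (N v)^-1.
Proof.
have [_ q0 _] := uniformizerP v.
by rewrite absKE // vord_uniformizer exprN1.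
Qed.

(** Nonzero values are integral powers of [N v], so a strict inequality gains a full factor. *)
Lemma absK_discrete v x y : abs v x < abs v y -> abs v x <= abs v y / N v.
Proof.
have [->|x0] := eqVneq x 0.
  by rewrite absK0 => y0; rewrite divr_ge0 ?ler0n // ltW.
have [->|y0] := eqVneq y 0; first by rewrite absK0 ltNge absK_ge0.
rewrite !absKE // -exprN1 -expfzDr ?gt_eqF ?fp_normR_gt0 //.
rewrite ltr_eXz2l ?fp_normR_gt1 // ler_eXz2l ?fp_normR_gt1 //.
by rewrite lerBrDr lezD1.
Qed.

Lemma absK_lt1 v x : OK x -> (abs v x < 1) <-> val v x.
Proof.
move=> Ox; have [Pq q0 qP] := uniformizerP v.
have N1 := fp_normR_gt1 v.
split=> [x1|/qP[a [s [Oa Os ns sE]]]].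
  apply: contrapT => nx; have [c Oc Pc] := inv_mod Ox nx.
  have : ~ val v (x * c) by move=> Pxc; apply: (@fp_not1 v); rewrite -(subrK (x * c) 1); apply: nziD.
  move=> nxc; have [y [Oy yE]] : exists y, OK y /\ x * y = x * c by exists c.
  move: x1; have /absK_le1 : locring v x^-1.
    by exists 1, x; rewrite div1r; split=> //; exact: OK1.
  rewrite absKV invf_le1 ?leNgt => [/negP//|].
  by rewrite absK_gt0 // (notv_neq0 nx).
have s0 := notv_neq0 ns.
have -> : x = a * uniformizer v / s by rewrite -sE mulrC mulKf.
rewrite !absKM absKV absK_uniformizer.
have -> : abs v s = 1.
  apply/eqP; rewrite eq_le absK_OK //=.
  have /absK_le1 : locring v s^-1.
    by exists 1, s; rewrite div1r; split=> //; exact: OK1.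
  by rewrite absKV invf_le1 // absK_gt0.
rewrite invr1 mulr1 (le_lt_trans (ler_piMl _ (absK_OK v Oa))) ?invr_ge0 ?ler0n //.
by rewrite invf_lt1 // fp_normR_gt0.
Qed.

Lemma absK_notP v s : OK s -> ~ val v s -> abs v s = 1.
Proof.
move=> Os ns; apply/eqP; rewrite eq_le absK_OK //= leNgt; apply/negP.
by move/absK_lt1 => /(_ Os).
Qed.

Lemma absK_vball v d x : d != 0 -> vball v d x <-> abs v x <= abs v d.
Proof.
move=> d0; split=> [[l /absK_le1 l1 <-]|xd].
  by rewrite absKM ler_piMr ?absK_ge0.
exists (x / d); last by rewrite mulrC divfK.
by apply/absK_le1; rewrite absKM absKV ler_pdivrMr ?mul1r ?absK_gt0.
Qed.

End AbsK.

End Places.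

(** * Index of an ideal as a product of local norms; Chinese remainder theorem *)

Section IdealNorm.
Variable K : fieldExtType rat.
Implicit Types (x y z : K) (I J : set K) (v w : finplace K).

Definition ideal_add I y : set K := [set z | exists x c, [/\ I x, OK c & z = x + c * y]].

Lemma ideal_addP I y : nzideal I -> OK y ->
  [/\ nzideal (ideal_add I y), I `<=` ideal_add I y & ideal_add I y y].
Proof.
move=> iI Oy; have IJ : I `<=` ideal_add I y.
  by move=> x Ix; exists x, 0; rewrite mul0r addr0; split=> //; exact: OK0.
split=> //; last first.
  by exists 0, 1; rewrite mul1r add0r; split; [exact: nzi0|exact: OK1|].
split.
- by move=> _ [x [c [Ix Oc ->]]]; apply: OKD; [exact: (nzi_sub iI)|exact: OKM].
- move=> _ _ [x [c [Ix Oc ->]]] [x' [c' [Ix' Oc' ->]]]; exists (x - x'), (c - c').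
  by split; [exact: nziB|exact: OKB|ring].
- move=> a _ Oa [x [c [Ix Oc ->]]]; exists (a * x), (a * c).
  by split; [exact: nziM|exact: OKM|ring].
- by have [x Ix x0] := nzi_neq0 iI; exists x => //; exact: IJ.
Qed.

Lemma ideal_add_lt I y : nzideal I -> OK y -> ~ I y ->
  (ideal_norm (ideal_add I y) < ideal_norm I)%N.
Proof.
move=> iI Oy nIy; have [iJ IJ Jy] := ideal_addP iI Oy.
by apply: ideal_norm_lt => //; exists y.
Qed.

(** Induction on the index. If ab lies in I but a and b do not, I + (a) has smaller index and is
    still proper: 1 = x + ca would give b = xb + cab in I. *)
Lemma prime_above I : nzideal I -> ~ I 1 -> exists v, I `<=` val v.
Proof.
have [k] := ubnP (ideal_norm I); elim: k I => // k IHk I; rewrite ltnS => Ik iI I1.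
have [pI|npI] := pselect (is_finplace I).
  by exists (exist _ I (asboolT pI)).
have [a [b [Oa Ob Iab [na nb]]]] : exists a b, [/\ OK a, OK b, I (a * b) & ~ I a /\ ~ I b].
  apply: contrapT => H; apply: npI; split=> //.
  - by split; [exact: nzi_sub|exact: nzi_neq0].
  - by split; [exact: nzi0|move=> x y; exact: nziB].
  - by move=> a x; exact: nziM.
  - move=> a b Oa Ob Iab; apply: contrapT => /not_orP[na nb].
    by apply: H; exists a, b.
have [iJ IJ Ja] := ideal_addP iI Oa.
have [||v Jv] := IHk (ideal_add I a) _ iJ.
- exact: leq_trans (ideal_add_lt iI Oa na) Ik.
- move=> [x [c [Ix Oc E]]]; apply: nb; rewrite -[b]mul1r E mulrDl.
  apply: nziD => //; first by rewrite mulrC; exact: nziM.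
  by rewrite -mulrA; exact: nziM.
by exists v; exact: subset_trans Jv.
Qed.

(** The annihilator of y modulo I is v, so c -> cy identifies OK / v with (I + OK y) / I. The
    representatives modulo I are sums of one modulo I + OK y and y times one modulo v. *)
Lemma ideal_norm_step v I y : nzideal I -> OK y ->
  (forall s, OK s -> ~ val v s -> ~ I (s * y)) -> (forall p, val v p -> I (p * y)) ->
  ideal_norm I = (ideal_norm (ideal_add I y) * ideal_norm (val v))%N.
Proof.
move=> iI Oy ny yP; have [iJ IJ Jy] := ideal_addP iI Oy.
have [T [f rf]] := residues_exist iJ.
have [S [g rg]] := residues_exist (fp_ideal v).
rewrite (ideal_norm_residues iJ rf) (ideal_norm_residues (fp_ideal v) rg).
have [[fO finj fs] [gO ginj gs]] := (rf, rg).
rewrite -card_prod; apply: (@ideal_norm_residues _ _ _ (fun ts => f ts.1 + g ts.2 * y)) => //.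
split=> [[t s]|[t s] [t' s'] /= E|x Ox] /=.
- by apply: OKD => //; exact: OKM.
- have tt : t = t'.
    apply: finj.
    have -> : f t - f t' = f t + g s * y - (f t' + g s' * y) + (g s' - g s) * y by ring.
    by apply: nziD => //; [exact: IJ|apply: nziM => //; exact: OKB].
  rewrite tt; congr pair; apply: ginj; apply: contrapT => np.
  apply: (ny (g s - g s')) => //; first exact: OKB.
  by move: E; rewrite tt; congr I; ring.
have [t [i [c [Ii Oc E]]]] := fs x Ox; have [s Ps] := gs c Oc.
exists (t, s); have -> : x - (f t + g s * y) = x - f t - g s * y by ring.
rewrite /= E; have -> : i + c * y - g s * y = i + (c - g s) * y by ring.
by apply: nziD => //; exact: yP.
Qed.

Lemma ideal_norm_OK : ideal_norm (@OK K) = 1%N.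
Proof.
rewrite (@ideal_norm_residues _ _ unit (fun=> 0)) ?card_unit //; first exact: nzideal_OK.
split=> [t|[] []//|x Ox]; first exact: OK0.
by exists tt; rewrite subr0.
Qed.

Lemma fp_separate v w : w != v -> exists s, val v s /\ ~ val w s.
Proof.
move=> wv; apply: contrapT => H; move/eqP: wv; apply; symmetry; apply: fp_maximal.
by move=> s vs; apply: contrapT => ws; apply: H; exists s.
Qed.

Variable R : realType.
Local Notation abs := (@absK R K).
Local Notation N v := ((ideal_norm (val v))%:R : R).

(** The value is required to be attained, which makes it unique and lets it be transported by
    multiplying a maximizer. *)
Definition is_lnorm v I (t : R) :=
  (forall x, I x -> abs v x <= t) /\ (exists2 x, I x & abs v x = t).

Lemma is_lnorm_uniq v I s t : is_lnorm v I s -> is_lnorm v I t -> s = t.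
Proof.
move=> [sM [x Ix xs]] [tM [y Iy yt]]; apply/eqP; rewrite eq_le.
by rewrite -{1}xs -{2}yt tM // sM.
Qed.

(** Stands in for unique factorization. Passing from I to I + OK y with y a socle element at v
    divides the index by [N v], multiplies the local norm at v by [N v] and leaves the other local
    norms unchanged; the induction ends at OK. *)
Lemma ideal_norm_prod I : nzideal I -> exists t : finplace K -> R,
  [/\ forall v, is_lnorm v I (t v),
      exists s : seq (finplace K), forall v, t v != 1 -> v \in s
    & forall s : seq (finplace K), uniq s -> (forall v, t v != 1 -> v \in s) ->
        (ideal_norm I)%:R^-1 = \prod_(v <- s) t v].
Proof.
have [k] := ubnP (ideal_norm I); elim: k I => // k IHk I; rewrite ltnS => Ik iI.
have [I1|nI1] := pselect (I 1).
  have IE : I = @OK K.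
    apply/seteqP; split; first exact: nzi_sub.
    by move=> x Ox; rewrite -[x]mulr1; exact: nziM.
  exists (fun=> 1); split=> [v||s _ _]; last 1 first.
  - by rewrite big1 // IE ideal_norm_OK invr1.
  - split=> [x /(nzi_sub iI)|]; first exact: absK_OK.
    by exists 1; [|rewrite absK1].
  - by exists [::] => v; rewrite eqxx.
have [v Iv] := prime_above iI nI1; have [y [Oy ny yP]] := socle iI Iv.
have [iJ IJ Jy] := ideal_addP iI Oy.
have nIy : ~ I y by move=> Iy; apply: (ny 1); rewrite ?mul1r //; [exact: OK1|exact: fp_not1].
have [|t [tP [s0 s0P] tprod]] := IHk (ideal_add I y) _ iJ.
  exact: leq_trans (ideal_add_lt iI Oy nIy) Ik.
have N0 : 0 < N v := fp_normR_gt0 R v.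
have [Pq q0 _] := uniformizerP v.
pose t' w := if w == v then t v / N v else t w.
have tv1 : t' v < 1.
  rewrite /t' eqxx ltr_pdivrMr // mul1r.
  have [_ [x Jx <-]] := tP v.
  by apply: le_lt_trans (absK_OK _ _ (nzi_sub iJ Jx)) (fp_normR_gt1 _ _).
exists t'; split=> [w||s us sP].
- rewrite /t'; have [->|wv] := eqVneq w v.
    have [tM [x Jx xt]] := tP v; split; last first.
      exists (x * uniformizer v); last by rewrite absKM xt absK_uniformizer.
      have [i [c [Ii Oc ->]]] := Jx; rewrite mulrDl; apply: nziD => //.
        by rewrite mulrC; apply: nziM => //; exact: fp_OK Pq.
      have -> : c * y * uniformizer v = c * (uniformizer v * y) by ring.
      by apply: nziM => //; exact: yP.
    (* By discreteness an element z of I beyond [t v / N v] has v-value at least [t v], hence at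
       least that of y. Then y is z times an element of the local ring, and some b outside v sends y
       into I, against [ny]. *)
    move=> z Iz; rewrite leNgt; apply/negP => lt.
    have zt : t v <= abs v z.
      rewrite leNgt; apply/negP => zt; move: lt; rewrite ltNge => /negP; apply.
      by rewrite -xt; apply: absK_discrete; rewrite xt.
    have z0 : z != 0.
      apply: contraTneq lt => ->; rewrite absK0 -leNgt divr_ge0 ?ler0n //.
      by rewrite -xt absK_ge0.
    have /absK_le1[a [b [Oa Ob nb E]]] : abs v (y / z) <= 1.
      rewrite absKM absKV ler_pdivrMr ?absK_gt0 // mul1r.
      by apply: le_trans zt; exact: tM.
    apply: (ny b) => //; rewrite (_ : b * y = a * z); first exact: nziM.
    have b0 := notv_neq0 nb.
    have -> : y = a / b * z by rewrite -E divfK.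
    by field.
  have [tM [x Jx xt]] := tP w; split; first by move=> z /IJ; exact: tM.
  (* An s in v outside w sends I + OK y into I and is a unit at w, so a maximizer at w for the
     larger ideal yields one for I. *)
  have [s [vs nws]] := fp_separate wv; have Os := fp_OK vs.
  exists (s * x); last by rewrite absKM (absK_notP R Os nws) mul1r.
  have [i [c [Ii Oc ->]]] := Jx; rewrite mulrDr; apply: nziD => //; first exact: nziM.
  by rewrite mulrCA; apply: nziM => //; exact: yP.
- exists (v :: s0) => w; rewrite /t'; have [->|wv tw] := eqVneq w v.
    by rewrite mem_head.
  by rewrite inE s0P ?orbT.
have vs : v \in s by apply: sP; rewrite lt_eqF.
have sP' w : t w != 1 -> w \in s.
  by move=> tw; have [->//|wv] := eqVneq w v; apply: sP; rewrite /t' (negbTE wv).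
rewrite (ideal_norm_step iI Oy ny yP) natrM invfM (tprod s us sP').
rewrite (bigD1_seq v) //= [RHS](bigD1_seq v) //= {1}/t' eqxx mulrAC; congr (_ * _).
by apply: eq_bigr => w wv; rewrite /t' (negbTE wv).
Qed.

(** Removes the v-part of (M): as long as J is inside v, a socle element of J at v is added. It does
    not spoil the bounds at w != v, since an element of v outside w, of w-value 1, sends it into J.
    The index decreases until J leaves v. *)
Lemma comaximal v M : OK M -> M != 0 ->
  exists t, [/\ OK t, ~ val v t & forall w, w != v -> abs w t <= abs w M].
Proof.
move=> OM M0.
suff H J : nzideal J -> (forall w x, w != v -> J x -> abs w x <= abs w M) ->
    exists t, [/\ OK t, ~ val v t & forall w, w != v -> abs w t <= abs w M].
  apply: (H [set M * x | x in @OK K]); first exact: nzideal_principal.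
  by move=> w _ _ [x Ox <-]; rewrite absKM ler_piMr ?absK_ge0 ?absK_OK.
have [k] := ubnP (ideal_norm J); elim: k J => // k IHk J; rewrite ltnS => Jk iJ JM.
have [Jv|nJv] := pselect (J `<=` val v); last first.
  have [t [Jt nt]] : exists t, J t /\ ~ val v t.
    apply: contrapT => H; apply: nJv => t Jt; apply: contrapT => nt; apply: H.
    by exists t.
  by exists t; split=> // [|w wv]; [exact: (nzi_sub iJ)|exact: JM].
have [y [Oy ny yP]] := socle iJ Jv; have [iJ' JJ' Jy] := ideal_addP iJ Oy.
apply: (IHk _ _ iJ') => [|w _ wv [x [c [Jx Oc ->]]]].
  apply: leq_trans (ideal_add_lt iJ Oy _) Jk => Jy'.
  by apply: (ny 1); rewrite ?mul1r //; [exact: OK1|exact: fp_not1].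
apply: absKD; first exact: JM.
rewrite absKM; apply: le_trans (ler_piMl (absK_ge0 _ _ _) (absK_OK _ _ Oc)) _.
have [s [vs nws]] := fp_separate wv; have Os := fp_OK vs.
rewrite -[abs w y]mul1r -(absK_notP R Os nws) -absKM.
by apply: JM => //; exact: yP.
Qed.

Lemma absK_nat v M : OK M -> M != 0 -> exists k : nat, abs v M = (N v)^-1 ^+ k.
Proof.
move=> OM M0; rewrite absKE //.
have := (vord_ge0 v M0).2 (locring_OK v OM).
by case: (vord v M) => // k _; exists k; rewrite -exprnN exprVn.
Qed.

(** With t from [comaximal] and tc congruent to 1 modulo v, take e = 1 - (1 - tc)^k: it is a
    multiple of t, and k is the v-order of M, so e - 1 has value at most [N v ^- k]. *)
Lemma crt v M : OK M -> M != 0 -> exists e, [/\ OK e, abs v (e - 1) <= abs v M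
  & forall w, w != v -> abs w e <= abs w M].
Proof.
move=> OM M0; have [t [Ot nt tw]] := comaximal v OM M0.
have [c Oc Pc] := inv_mod Ot nt; have Op := fp_OK Pc.
have [k kE] := absK_nat v OM M0.
exists (1 - (1 - t * c) ^+ k); split=> [||w wv].
- by apply: OKB; [exact: OK1|exact: OKX].
- rewrite [_ - 1]addrAC subrr add0r absKN absKX kE lerXn2r ?nnegrE ?absK_ge0 ?invr_ge0 ?ler0n //.
  have := @absK_discrete _ R v (1 - t * c) 1; rewrite absK1 div1r; apply.
  exact/absK_lt1.
- have -> : 1 - (1 - t * c) ^+ k = t * (c * \sum_(i < k) (1 - t * c) ^+ i).
    by rewrite -opprB subrX1 -mulNr opprB subKr mulrA.
  rewrite absKM; apply: le_trans (tw w wv); rewrite ler_piMr ?absK_ge0 // absK_OK //.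
  by apply: OKM => //; apply: OK_sum => i _; exact: OKX.
Qed.

End IdealNorm.

(** * Products over the finite places *)

Section FinProd.
Variables (R : realType) (K : fieldExtType rat).
Implicit Types (v : finplace K) (f g : finplace K -> R).

(** The product over all finite places collapses to 1 when the support is infinite; this condition
    guards its multiplicativity. *)
Definition finsupp1 f := exists s : seq (finplace K), forall v, f v != 1 -> v \in s.

Definition PV f : R := \big[*%R/1]_(v \in [set: finplace K]) f v.

Lemma PVE (s : seq (finplace K)) f : uniq s -> (forall v, f v != 1 -> v \in s) ->
  PV f = \prod_(v <- s) f v.
Proof.
move=> us fs; rewrite /PV (fsbigE s) //=.
  by apply: eq_bigl => v; rewrite in_setT.
by move=> v _; apply: contraNeq; exact: fs.
Qed.

Lemma PV_M f g : finsupp1 f -> finsupp1 g ->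
  finsupp1 (fun v => f v * g v) /\ PV (fun v => f v * g v) = PV f * PV g.
Proof.
move=> [s fs] [t gt]; pose r := undup (s ++ t); have ur : uniq r := undup_uniq _.
have fr v : f v != 1 -> v \in r by move=> /fs; rewrite mem_undup mem_cat => ->.
have gr v : g v != 1 -> v \in r by move=> /gt; rewrite mem_undup mem_cat orbC => ->.
have fgr v : f v * g v != 1 -> v \in r.
  apply: contraNT => vr; have -> : f v = 1 by apply: contraNeq vr; exact: fr.
  have -> : g v = 1 by apply: contraNeq vr; exact: gr.
  by rewrite mulr1.
split; first by exists r.
by rewrite (PVE ur fr) (PVE ur gr) (PVE ur fgr) big_split.
Qed.

Lemma PV_X f k : finsupp1 f ->
  finsupp1 (fun v => f v ^+ k) /\ PV (fun v => f v ^+ k) = PV f ^+ k.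
Proof.
move=> [s fs]; have us : uniq (undup s) := undup_uniq _.
have fr v : f v != 1 -> v \in undup s by move=> /fs; rewrite mem_undup.
have fk v : f v ^+ k != 1 -> v \in undup s.
  by apply: contraNT => vr; rewrite (eqP (contraNT (fr v) vr)) expr1n.
split; first by exists (undup s).
by rewrite (PVE us fr) (PVE us fk) prodrXl.
Qed.

Lemma PV_gt0 f : finsupp1 f -> (forall v, 0 < f v) -> 0 < PV f.
Proof.
move=> [s fs] f0; rewrite (@PVE (undup s)) ?undup_uniq //; last first.
  by move=> v /fs; rewrite mem_undup.
exact: prodr_gt0.
Qed.

End FinProd.

(** * Local norms of vectors *)

Section VectorNorm.
Variables (R : realType) (K : fieldExtType rat) (n : nat).
Implicit Types (v : finplace K) (x y : 'cV[K]_n).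
Local Notation abs := (@absK R K).

Definition nv v x : R := \big[Num.max/0]_i abs v (x i 0).

Lemma nv_ge0 v x : 0 <= nv v x.
Proof. by rewrite /nv; elim/big_rec: _ => // i y _ y0; rewrite le_max y0 orbT. Qed.

Lemma nv_le v x c : 0 <= c -> (forall i, abs v (x i 0) <= c) -> nv v x <= c.
Proof.
by move=> c0 xc; rewrite /nv; elim/big_rec: _ => // i y _ yc; rewrite ge_max xc.
Qed.

Lemma le_nv v x i : abs v (x i 0) <= nv v x.
Proof. by rewrite /nv (bigD1 i) //= le_max lexx. Qed.

Lemma nv0 v : nv v 0 = 0.
Proof. by apply/eqP; rewrite eq_le nv_ge0 nv_le // => i; rewrite mxE absK0. Qed.

Lemma nv_gt0 v x : x != 0 -> 0 < nv v x.
Proof.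
move=> /cV0Pn[i xi]; apply: lt_le_trans (le_nv v x i).
by apply: absK_gt0.
Qed.

Lemma nv_attained v x : x != 0 -> exists i, nv v x = abs v (x i 0).
Proof.
move=> x0; apply: contrapT => H.
have lt i : abs v (x i 0) < nv v x.
  rewrite lt_neqAle le_nv andbT; apply/eqP => E; apply: H; by exists i.
have : nv v x < nv v x; last by rewrite ltxx.
rewrite {1}/nv; elim/big_rec: _ => [|i y _ yc]; first exact: nv_gt0.
by rewrite gt_max lt.
Qed.

Lemma nvZ v a x : nv v (a *: x) = abs v a * nv v x.
Proof.
have [->|a0] := eqVneq a 0; first by rewrite scale0r nv0 absK0 mul0r.
have [->|x0] := eqVneq x 0; first by rewrite scaler0 nv0 mulr0.
apply/eqP; rewrite eq_le; apply/andP; split.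
  apply: nv_le => [|i]; first by rewrite mulr_ge0 ?absK_ge0 ?nv_ge0.
  by rewrite mxE absKM ler_wpM2l ?absK_ge0 ?le_nv.
by have [i ->] := nv_attained v x0; rewrite -absKM; have := le_nv v (a *: x) i; rewrite mxE.
Qed.

Lemma nv_mulmx v (A : 'M[K]_n) x : (forall i j, abs v (A i j) <= 1) ->
  nv v (A *m x) <= nv v x.
Proof.
move=> A1; apply: nv_le => [|i]; first exact: nv_ge0.
rewrite mxE; apply: absK_sum => [|j _]; first exact: nv_ge0.
by rewrite absKM; apply: le_trans (le_nv v x j); rewrite ler_piMl ?absK_ge0.
Qed.

Lemma abs_det_le1 k v (A : 'M[K]_k) : (forall i j, abs v (A i j) <= 1) ->
  abs v (\det A) <= 1.
Proof.
move=> A1; apply: absK_sum => // s _; rewrite absKM absK_prod.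
rewrite absKX absKN absK1 expr1n mul1r.
by apply: prodr_ile1 => i _; rewrite absK_ge0 A1.
Qed.

Lemma abs_adj_le1 v (A : 'M[K]_n) : (forall i j, abs v (A i j) <= 1) ->
  forall i j, abs v ((\adj A) i j) <= 1.
Proof.
move=> A1 i j; rewrite mxE /cofactor absKM absKX absKN absK1 expr1n mul1r.
by apply: abs_det_le1 => s t; rewrite !mxE.
Qed.

Lemma nv_SL v (A : 'M[K]_n) x : (forall i j, abs v (A i j) <= 1) -> \det A = 1 ->
  nv v (A *m x) = nv v x.
Proof.
move=> A1 dA; apply/eqP; rewrite eq_le nv_mulmx //=.
have -> : x = \adj A *m (A *m x) by rewrite mulmxA mul_adj_mx dA mul1mx.
rewrite [in leRHS]mulmxA [in leRHS]mulmxA -[in leRHS](mulmxA A) mul_adj_mx dA mulmx1.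
by apply: nv_mulmx; exact: abs_adj_le1.
Qed.

Definition OKvec x := forall i, @OK K (x i 0).

Lemma coord_ideal_nz x : OKvec x -> x != 0 -> nzideal (coord_ideal x).
Proof.
move=> Ox x0; split.
- by move=> _ [c Oc ->]; apply: OK_sum => i _; exact: OKM.
- move=> _ _ [c Oc ->] [d Od ->]; exists (c - d) => [i|].
    by rewrite !mxE; exact: OKB.
  by rewrite -sumrB; apply: eq_bigr => i _; rewrite !mxE mulrBl.
- move=> a _ Oa [c Oc ->]; exists (a *: c) => [i|].
    by rewrite !mxE; exact: OKM.
  by rewrite mulr_sumr; apply: eq_bigr => i _; rewrite !mxE mulrA.
- have /cV0Pn[i xi] := x0; exists (x i 0) => //; exists (delta_mx i 0) => [j|].
    by rewrite mxE; exact: OK_nat.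
  rewrite (bigD1 i) //= mxE !eqxx mul1r big1 ?addr0 // => j ji.
  by rewrite mxE (negbTE ji) mul0r.
Qed.

Lemma coord_ideal_coord x i : coord_ideal x (x i 0).
Proof.
exists (delta_mx i 0) => [j|]; first by rewrite mxE; exact: OK_nat.
rewrite (bigD1 i) //= mxE !eqxx mul1r big1 ?addr0 // => j ji.
by rewrite mxE (negbTE ji) mul0r.
Qed.

Lemma coord_ideal_lnorm v x : x != 0 -> is_lnorm v (coord_ideal x) (nv v x).
Proof.
move=> x0; split=> [_ [c Oc ->]|].
  apply: absK_sum => [|i _]; first exact: nv_ge0.
  rewrite absKM; apply: le_trans (le_nv v x i).
  by rewrite ler_piMl ?absK_ge0 ?absK_OK.
by have [i ->] := nv_attained v x0; exists (x i 0) => //; exact: coord_ideal_coord.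
Qed.

Lemma PV_lnorm (I : set K) (t : finplace K -> R) : nzideal I ->
  (forall v, is_lnorm v I (t v)) -> finsupp1 t /\ PV t = (ideal_norm I)%:R^-1.
Proof.
move=> iI tP; have [t' [t'P [s sP] tprod]] := ideal_norm_prod R iI.
have tt v : t v = t' v by exact: is_lnorm_uniq (tP v) (t'P v).
have -> : t = t' by apply/funext.
split; first by exists s.
have us : uniq (undup s) := undup_uniq _.
have s'P v : t' v != 1 -> v \in undup s by move=> /sP; rewrite mem_undup.
by rewrite (PVE us s'P) -tprod.
Qed.

Lemma PV_nv x : OKvec x -> x != 0 ->
  finsupp1 (nv ^~ x) /\ PV (nv ^~ x) = (ideal_norm (coord_ideal x))%:R^-1.
Proof.
move=> Ox x0; apply: PV_lnorm; first exact: coord_ideal_nz.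
by move=> v; exact: coord_ideal_lnorm.
Qed.

Lemma PV_abs (a : K) : OK a -> a != 0 ->
  finsupp1 (fun v => abs v a) /\
  PV (fun v => abs v a) = (ideal_norm [set a * x | x in @OK K])%:R^-1.
Proof.
move=> Oa a0; apply: PV_lnorm; first exact: nzideal_principal.
move=> v; split=> [_ [x Ox <-]|]; first by rewrite absKM ler_piMr ?absK_ge0 ?absK_OK.
by exists a => //; exists 1; [exact: OK1|rewrite mulr1].
Qed.

Lemma common_denominator x : exists2 N : nat, (0 < N)%N & OKvec (N%:R *: x).
Proof.
have h i := cid2 (denominator (x i 0)).
pose N i := s2val (h i).
exists (\prod_i N i)%N; first by rewrite prodn_gt0 // => i; exact: s2valP (h i).
move=> i; rewrite mxE (bigD1 i) //= natrM -mulrA mulrCA.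
by apply: OKM; [exact: OK_nat|exact: s2valP' (h i)].
Qed.

End VectorNorm.

Section FractionalProducts.
Variables (R : realType) (K : fieldExtType rat).
Local Notation abs := (@absK R K).

Lemma finsupp1_abs (a : K) : a != 0 -> finsupp1 (fun v => abs v a).
Proof.
move=> a0; have [N N0 ON] := denominator a.
have Nz : N%:R != 0 :> K by rewrite natK_eq0 -lt0n.
have [[s sP] _] := PV_abs R ON (mulf_neq0 Nz a0).
have [[t tP] _] := PV_abs R (OK_nat K N) Nz.
exists (s ++ t) => v; rewrite mem_cat; apply: contraNT; rewrite negb_or => /andP[vs vt].
have h1 : abs v (N%:R * a) = 1 by apply/eqP; exact: contraNT (sP v) vs.
have h2 : abs v N%:R = 1 by apply/eqP; exact: contraNT (tP v) vt.
by rewrite -h1 absKM h2 mul1r.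
Qed.

Lemma finsupp1_nv n (x : 'cV[K]_n) : x != 0 -> finsupp1 (fun v => nv R v x).
Proof.
move=> x0; have [N N0 ON] := common_denominator x.
have Nz : N%:R != 0 :> K by rewrite natK_eq0 -lt0n.
have Nx0 : N%:R *: x != 0 by rewrite scaler_eq0 negb_or Nz.
have [[s sP] _] := PV_nv R ON Nx0.
have [t tP] := finsupp1_abs Nz.
exists (s ++ t) => v; rewrite mem_cat; apply: contraNT; rewrite negb_or => /andP[vs vt].
have h1 : nv R v (N%:R *: x) = 1 by apply/eqP; exact: contraNT (sP v) vs.
have h2 : abs v N%:R = 1 by apply/eqP; exact: contraNT (tP v) vt.
by rewrite -h1 nvZ h2 mul1r.
Qed.

End FractionalProducts.

(** * Archimedean embeddings and the product formula *)

Section SquaredModulus.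
Variable R : realType.
Implicit Types z w : R[i].

Definition N2 z : R := complex.Re z ^+ 2 + complex.Im z ^+ 2.

Lemma N2M z w : N2 (z * w) = N2 z * N2 w.
Proof. by case: z w => a b [c d]; rewrite /N2 /=; ring. Qed.

Lemma N2_ge0 z : 0 <= N2 z. Proof. by rewrite addr_ge0 ?sqr_ge0. Qed.

Lemma N2_eq0 z : (N2 z == 0) = (z == 0).
Proof.
case: z => a b; rewrite /N2 /= paddr_eq0 ?sqr_ge0 // !sqrf_eq0.
by rewrite eq_complex.
Qed.

Lemma N2_gt0 z : z != 0 -> 0 < N2 z.
Proof. by move=> z0; rewrite lt_neqAle eq_sym N2_eq0 z0 N2_ge0. Qed.

Lemma N2_conj z : N2 (conjc z) = N2 z.
Proof. by case: z => a b; rewrite /N2 /= sqrrN. Qed.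

Lemma N2_real (a : R) : N2 (a%:C)%C = a ^+ 2.
Proof. by rewrite /N2 /= expr0n addr0. Qed.

Lemma N2_1 : N2 1 = 1. Proof. by rewrite /N2 /= expr1n expr0n addr0. Qed.

Lemma N2_int (k : int) : N2 (k%:~R : R[i]) = k%:~R ^+ 2.
Proof.
by have -> : k%:~R = ((k%:~R)%:C)%C :> R[i]; rewrite ?N2_real // rmorph_int.
Qed.

Lemma N2_prod (T : Type) (r : seq T) (F : T -> R[i]) :
  N2 (\prod_(i <- r) F i) = \prod_(i <- r) N2 (F i).
Proof. by elim/big_rec2: _ => [|i y z _ <-]; rewrite ?N2_1 ?N2M. Qed.

Lemma N2D z w : N2 (z + w) <= 2 * (N2 z + N2 w).
Proof.
case: z w => a b [c d]; rewrite /N2 /=.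
rewrite -subr_ge0; set t := (X in 0 <= X).
have -> : t = (a - c) ^+ 2 + (b - d) ^+ 2 by rewrite /t; ring.
by rewrite addr_ge0 ?sqr_ge0.
Qed.

(** The constant is crude: it only enters finiteness and compactness arguments, where any constant
    depending on the sizes alone will do. *)
Lemma N2_sum (T : finType) (F : T -> R[i]) :
  N2 (\sum_i F i) <= 2 ^+ #|T| * \sum_i N2 (F i).
Proof.
rewrite cardE -!big_enum /=; elim: (enum T) => [|i s IHs].
  by rewrite !big_nil mulr0 /N2 /= expr0n addr0.
rewrite !big_cons (le_trans (N2D _ _)) // exprS -mulrA ler_pM2l // mulrDr lerD //.
by rewrite ler_peMl ?N2_ge0 // exprn_ege1 // ler1n.
Qed.

Lemma N2E z : conjc z * z = ((N2 z)%:C)%C.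
Proof. by case: z => a b; apply/eqP; rewrite eq_complex /N2 /=; apply/andP; split; apply/eqP; ring. Qed.

Lemma N2_normr z : complex.Re `|z| ^+ 2 = N2 z.
Proof. by rewrite normc_def /= sqr_sqrtr // N2_ge0. Qed.

End SquaredModulus.

Lemma int_vec_bounded (R : realType) n (M : 'I_n -> R) :
  exists s : seq 'cV[int]_n, forall x : 'cV[int]_n, (forall i, (x i 0)%:~R ^+ 2 <= M i) -> x \in s.
Proof.
have [T TM] : exists T : nat, forall i, M i <= T%:R.
  have h i : exists T : nat, M i <= T%:R.
    exists `|Num.ceil (M i)|%N; rewrite natr_absz (le_trans (ceil_ge _)) //.
    by rewrite intr_norm ler_norm.
  pose t i := sval (cid (h i)); exists (\sum_i t i)%N => i.
  apply: le_trans (svalP (cid (h i))) _.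
  by rewrite ler_nat (bigD1 i) //= leq_addr.
pose g (f : {ffun 'I_n -> 'I_(T.*2.+1)}) : 'cV[int]_n := \col_i ((f i : nat)%:Z - T%:Z).
exists (codom g) => x xM.
have xT i : `|x i 0| <= T%:Z.
  have : x i 0 ^+ 2 <= T%:Z.
    by rewrite -(ler_int R) rmorphXn /= -pmulrn; apply: le_trans (TM i).
  by nia.
have lt i : (`|(x i 0 + T%:Z)%R|%N < T.*2.+1)%N by have := xT i; lia.
apply/codomP; exists [ffun i => Ordinal (lt i)]; apply/colP => i; rewrite mxE ffunE /=.
by have := xT i; lia.
Qed.

Section Embeddings.
Variables (R : realType) (K : fieldExtType rat) (E : embeddings R K).
Local Notation C := R[i].
Local Notation m := (\dim {:K}).
Local Notation J := ('I_(nreal E) + ('I_(ncomplex E) + 'I_(ncomplex E)))%type.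

Definition emb (k : J) : K -> C := emb_fun (@real_emb _ _ E) (@complex_emb _ _ E) k.

Fact emb_is_zmod_morphism k : zmod_morphism (emb k).
Proof.
case: k => [i|[j|j]] x y; by rewrite /emb /emb_fun ?rmorphB //= !rmorphB.
Qed.

Fact emb_is_monoid_morphism k : monoid_morphism (emb k).
Proof.
by case: k => [i|[j|j]]; split=> [|x y]; rewrite /emb /emb_fun ?rmorph1 ?rmorphM.
Qed.

HB.instance Definition _ k :=
  GRing.isZmodMorphism.Build K C (emb k) (emb_is_zmod_morphism k).
HB.instance Definition _ k :=
  GRing.isMonoidMorphism.Build K C (emb k) (emb_is_monoid_morphism k).

Definition bar (k : J) : J :=
  match k with
  | inl i => inl i
  | inr (inl j) => inr (inr j)
  | inr (inr j) => inr (inl j)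
  end.

Lemma barK : involutive bar. Proof. by case=> [|[]]. Qed.

Lemma emb_bar k x : emb (bar k) x = conjc (emb k x).
Proof. by case: k => [i|[j|j]]; rewrite /emb /emb_fun /bar ?conjc_real ?conjcK. Qed.

Lemma emb_rat k (a : rat) x : emb k (a *: x) = ratr a * emb k x.
Proof.
have -> : a *: x = (in_alg K a) * x by rewrite mulr_algl.
rewrite rmorphM; congr (_ * _).
by rewrite -[LHS]/((emb k \o in_alg K) a) [LHS]fmorph_eq_rat.
Qed.

Lemma primitive_element : exists t : K,
  basis_of {:K} [tuple t ^+ i | i < m] /\
  exists p : {poly rat}, [/\ size p = m.+1, separable_poly p,
     root (map_poly (in_alg K) p) t
     & forall q : {poly rat}, root (map_poly (in_alg K) q) t -> p %| q].
Proof.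
have ch0 : has_pchar0 K.
  by move=> p; rewrite inE /= natK_eq0; case: p => // p; rewrite andbF.
have sep : separable 1%AS {:K}.
  by apply/separableP => x _; exact: pcharf0_separable.
have tE := eq_adjoin_separable_generator sep (subvf _).
set t := separable_generator _ _ in tE.
have /polyOver1P[p pE] := minPolyOver 1%AS t.
have dE : adjoin_degree 1%AS t = m.
  by have := dim_Fadjoin 1%AS t; rewrite -tE dimv1 muln1 => ->.
have sp : size p = m.+1 by rewrite -dE -size_minPoly pE size_map_poly.
have pmin (q : {poly rat}) : root (map_poly (in_alg K) q) t -> p %| q.
  move=> rq; rewrite -(dvdp_map (in_alg K)) -pE; apply: minPoly_dvdp => //.
  by apply/polyOver1P; exists q.
have pt : root (map_poly (in_alg K) p) t by rewrite -pE root_minPoly.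
exists t; split; last first.
  exists p; split=> //; rewrite -(separable_map (in_alg K)) -pE.
  exact: pcharf0_separable.
rewrite basisEfree subvf size_tuple leqnn !andbT; apply/freeP => k k0 i.
pose q := \poly_(j < m) (if insub j is Some i then k i else 0).
have qk (j : 'I_m) : q`_j = k j by rewrite coef_poly ltn_ord valK.
have /pmin pq : root (map_poly (in_alg K) q) t.
  rewrite /root; apply/eqP; rewrite -[RHS]k0 (@horner_coef_wide _ m); last first.
    by rewrite size_map_poly size_poly.
  apply: eq_bigr => j _; rewrite coef_map qk -[_`_j]tnth_nth tnth_mktuple.
  by rewrite mulr_algl.
have q0 : q = 0.
  apply/eqP; apply: contraT => q0; have := dvdp_leq q0 pq.
  by rewrite sp leqNgt ltnS size_poly.
by rewrite -qk q0 coef0.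
Qed.

(** Each x is [P x] evaluated at t; its image is [P x] evaluated at z. Since p generates the
    relations of t and vanishes at z, the image does not depend on the polynomial chosen, whence
    additivity and multiplicativity. *)
Lemma emb_exists_root (t : K) (p : {poly rat}) (z : C) :
  basis_of {:K} [tuple t ^+ i | i < m] ->
  root (map_poly (in_alg K) p) t ->
  (forall q : {poly rat}, root (map_poly (in_alg K) q) t -> p %| q) ->
  root (map_poly ratr p) z -> exists h : {rmorphism K -> C}, h t = z.
Proof.
move=> bP pt pmin pz; set b := [tuple _ | _ < m] in bP.
pose P x := \poly_(j < m) (if insub j is Some i then coord b i x else 0).
have Pc x (j : 'I_m) : (P x)`_j = coord b j x by rewrite coef_poly ltn_ord valK.
have Pt x : (map_poly (in_alg K) (P x)).[t] = x.
  rewrite (@horner_coef_wide _ m); last by rewrite size_map_poly size_poly.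
  rewrite [RHS](coordE bP); apply: eq_bigr => j _.
  by rewrite coef_map Pc -[b`_j]tnth_nth tnth_mktuple mulr_algl.
pose f x := (map_poly ratr (P x)).[z] : C.
have fP q x : (map_poly (in_alg K) q).[t] = x -> f x = (map_poly ratr q).[z].
  move=> qx; have : p %| (P x - q).
    by apply: pmin; rewrite /root rmorphB hornerD hornerN Pt qx subrr.
  rewrite -(dvdp_map (@ratr C)) => /dvdpP[r rE].
  have : (map_poly ratr (P x - q)).[z] = 0 :> C by rewrite rE hornerM (rootP pz) mulr0.
  by rewrite rmorphB hornerD hornerN => /eqP; rewrite subr_eq0 => /eqP.
have fB : zmod_morphism f.
  move=> x y; rewrite (fP (P x - P y)) ?rmorphB /= ?hornerD ?hornerN //.
  by rewrite !Pt.
have fM : monoid_morphism f.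
  split=> [|x y]; first by rewrite (fP 1) ?rmorph1 ?hornerC.
  by rewrite (fP (P x * P y)) ?rmorphM /= ?hornerM // !Pt.
pose fZ := GRing.isZmodMorphism.Build K C f fB.
pose fM' := GRing.isMonoidMorphism.Build K C f fM.
pose h : {rmorphism K -> C} := HB.pack f fZ fM'.
by exists h; rewrite -[LHS]/(f t) (fP 'X) map_polyX hornerX.
Qed.

(** Evaluation at a primitive element t maps J bijectively to the m distinct complex roots of its
    minimal polynomial: injectively because embeddings equal at t coincide and [embeddingsP] lists
    each once, onto because each root defines an embedding, which is listed. *)
Lemma card_emb_det : #|{: J}| = m /\ exists t : K,
  basis_of {:K} [tuple t ^+ i | i < m] /\ injective (fun k => emb k t).
Proof.
have [t [bP [p [sp sep pt pmin]]]] := primitive_element.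
have einj : injective (fun k => emb k t).
  move=> k k' /= kk; have [k0 [_ k0u]] := embeddingsP E (emb k).
  have ext : emb k =1 emb k'.
    move=> x; rewrite (coordE bP x) !rmorph_sum; apply: eq_bigr => i _.
    rewrite [LHS]emb_rat [RHS]emb_rat; congr (_ * _).
    by rewrite nth_mktuple !rmorphXn /= kk.
  by rewrite -(k0u k) //; exact: k0u.
split; last by exists t.
have [rs rsE] := closed_field_poly_normal (map_poly (@ratr C) p).
have p0 : p != 0 by rewrite -size_poly_gt0 sp.
have lc0 : lead_coef (map_poly (@ratr C) p) != 0 by rewrite lead_coef_eq0 map_poly_eq0.
have urs : uniq rs.
  rewrite -separable_prod_XsubC; move: sep; rewrite -(separable_map (@ratr C)) rsE.
  by rewrite -mul_polyC separable_mul => /and3P[].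
have srs : size rs = m.
  have := size_map_poly (@ratr C) p; rewrite rsE size_scale // size_prod_XsubC sp.
  by case.
have rsP z : z \in rs -> root (map_poly (@ratr C) p) z.
  by move=> zr; rewrite rsE rootZ // root_prod_XsubC.
have rsP' z : root (map_poly (@ratr C) p) z -> z \in rs.
  by rewrite {1}rsE rootZ // root_prod_XsubC.
have embr k : emb k t \in rs.
  apply: rsP'; have : root (map_poly (emb k) (map_poly (in_alg K) p)) (emb k t).
    by rewrite rmorph_root.
  rewrite -map_poly_comp; congr root; apply: eq_map_poly => a.
  by rewrite /= [LHS]emb_rat rmorph1 mulr1.
rewrite -srs cardE -(size_map (fun k => emb k t)); apply: perm_size.
apply: uniq_perm => //; first by rewrite map_inj_uniq ?enum_uniq.
move=> z; apply/mapP/idP => [[k _ ->]//|zr].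
have [h hz] := emb_exists_root bP pt pmin (rsP _ zr).
have [k [kE _]] := embeddingsP E h.
by exists k; rewrite ?mem_enum // -hz kE.
Qed.

Lemma card_emb : #|{: J}| = m. Proof. by have [] := card_emb_det. Qed.

Definition embi (i : 'I_m) : J := enum_val (cast_ord (esym card_emb) i).
Definition iemb (k : J) : 'I_m := cast_ord card_emb (enum_rank k).

Lemma embiK : cancel embi iemb.
Proof. by move=> i; rewrite /iemb /embi enum_valK cast_ordKV. Qed.

Lemma iembK : cancel iemb embi.
Proof. by move=> k; rewrite /iemb /embi cast_ordK enum_rankK. Qed.

Lemma prod_emb (F : J -> R) : \prod_k F k = \prod_i F (embi i).
Proof. by rewrite (reindex embi) //; exists iemb => x _; [exact: embiK|exact: iembK]. Qed.

Lemma sum_emb (V : nmodType) (F : J -> V) : \sum_k F k = \sum_i F (embi i).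
Proof. by rewrite (reindex embi) //; exists iemb => x _; [exact: embiK|exact: iembK]. Qed.

Definition emb_mx (c : m.-tuple K) : 'M[C]_m := \matrix_(k, i) emb (embi k) c`_i.

Lemma emb_mx_change (b c : m.-tuple K) : basis_of {:K} b ->
  emb_mx c = emb_mx b *m map_mx ratr (\matrix_(i, j) coord b i c`_j).
Proof.
move=> bP; apply/matrixP => k j; rewrite !mxE (coordE bP c`_j) rmorph_sum.
by apply: eq_bigr => i _; rewrite !mxE /= emb_rat mulrC.
Qed.

(** For the powers of a primitive element this is a Vandermonde determinant with distinct nodes; any
    other basis differs by a change of basis. *)
Lemma emb_mx_unit (c : m.-tuple K) : basis_of {:K} c -> \det (emb_mx c) != 0.
Proof.
move=> cP; have [_ [t [bP einj]]] := card_emb_det.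
have : \det (emb_mx [tuple t ^+ i | i < m]) != 0; last first.
  by rewrite (emb_mx_change _ cP) det_mulmx mulf_eq0 negb_or => /andP[].
have -> : emb_mx [tuple t ^+ i | i < m] = (Vandermonde m (\row_k emb (embi k) t))^T.
  apply/matrixP => k i; rewrite !mxE.
  by rewrite -[_`_i]tnth_nth tnth_mktuple rmorphXn.
rewrite det_tr det_Vandermonde; apply/prodf_neq0 => i _; apply/prodf_neq0 => j ij.
rewrite !mxE subr_eq0; apply/eqP => /einj /(can_inj embiK) ji.
by move: ij; rewrite ji ltnn.
Qed.

(** For a Z-basis of a lattice, its squared covolume at infinity up to a power of 2; for a Z-basis
    of OK it is the absolute discriminant of K. *)
Definition covol2 (c : m.-tuple K) : R := N2 (\det (emb_mx c)).

Lemma covol2_gt0 (c : m.-tuple K) : basis_of {:K} c -> 0 < covol2 c.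
Proof. by move=> cP; apply: N2_gt0; exact: emb_mx_unit. Qed.

(** Each determinant is a nonzero integer multiple of the other, so neither squared modulus exceeds
    the other. *)
Lemma covol2_Zbasis (L : set K) (b c : m.-tuple K) : Zbasis L b -> Zbasis L c ->
  covol2 b = covol2 c.
Proof.
move=> bZ cZ.
have int_change (b' c' : m.-tuple K) : Zbasis L b' -> Zbasis L c' ->
    exists2 k : int, \det (emb_mx c') = k%:~R * \det (emb_mx b') & k != 0.
  move=> b'Z c'Z.
  have h (j : 'I_m) := cid (int_coord b'Z (Zbasis_mem j c'Z)).
  pose M : 'M[int]_m := \matrix_(i, j) sval (h j) i.
  have E1 : \det (emb_mx c') = (\det M)%:~R * \det (emb_mx b').
    rewrite (emb_mx_change _ b'Z.1) det_mulmx mulrC; congr (_ * _).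
    rewrite -det_map_mx; congr (\det _).
    by apply/matrixP => i j; rewrite !mxE (svalP (h j) i) ratr_int.
  exists (\det M) => //; apply/eqP => M0.
  by have := emb_mx_unit c'Z.1; rewrite E1 M0 mul0r eqxx.
have le b' c' : Zbasis L b' -> Zbasis L c' -> covol2 b' <= covol2 c'.
  move=> b'Z c'Z; have [k E1 k0] := int_change _ _ b'Z c'Z.
  rewrite /covol2 E1 N2M N2_int ler_peMl ?N2_ge0 //.
  by rewrite -rmorphXn /= ler1z -gtz0_ge1 exprn_even_gt0.
by apply/eqP; rewrite eq_le !le.
Qed.

Lemma covol2_scale (b c : m.-tuple K) (a : K) : (forall i : 'I_m, c`_i = a * b`_i) ->
  covol2 c = (\prod_k N2 (emb k a)) * covol2 b.
Proof.
move=> cE; rewrite /covol2; have -> : emb_mx c = diag_mx (\row_k emb (embi k) a) *m emb_mx b.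
  by apply/matrixP => i j; rewrite mul_diag_mx !mxE cE rmorphM.
rewrite det_mulmx det_diag N2M N2_prod prod_emb; congr (_ * _).
by apply: eq_bigr => i _; rewrite mxE.
Qed.

Lemma mul_basis (b : m.-tuple K) (a : K) : basis_of {:K} b -> a != 0 ->
  basis_of {:K} [tuple a * b`_i | i < m].
Proof.
move=> bP a0; rewrite basisEfree subvf size_tuple leqnn !andbT.
apply/freeP => k k0 i; have : a * \sum_i k i *: b`_i = 0.
  rewrite -[RHS]k0 mulr_sumr; apply: eq_bigr => j _.
  by rewrite nth_mktuple scalerAr.
move/eqP; rewrite mulf_eq0 (negbTE a0) => /eqP /(congr1 (coord b i)).
by rewrite (coord_comb bP k) linear0.
Qed.

Lemma mul_coord (b : m.-tuple K) (a x : K) i : basis_of {:K} b -> a != 0 ->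
  coord [tuple a * b`_i | i < m] i (a * x) = coord b i x.
Proof.
move=> bP a0; have abP := mul_basis bP a0.
rewrite {1}(coordE bP x) mulr_sumr.
rewrite -[RHS](coord_comb abP (coord b ^~ x)); congr coord.
by apply: eq_bigr => j _; rewrite nth_mktuple scalerAr.
Qed.

Lemma Zbasis_scale (L L' : set K) (b : m.-tuple K) a : Zbasis L b -> a != 0 ->
  (forall x, L' (a * x) <-> L x) -> Zbasis L' [tuple a * b`_i | i < m].
Proof.
move=> [bP LP] a0 LL'; split=> [|x]; first exact: mul_basis.
have -> : x = a * (x / a) by rewrite mulrC divfK.
rewrite LL' LP; split=> xi i; first by rewrite mul_coord.
by rewrite -(mul_coord _ _ bP a0).
Qed.

Lemma covol2_ideal (I : set K) (b c : m.-tuple K) : nzideal I ->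
  Zbasis (@OK K) b -> Zbasis I c -> covol2 c = (ideal_norm I)%:R ^+ 2 * covol2 b.
Proof.
move=> iI bZ cZ; have [b' [d [d0 b'Z IP ->]]] := adapted_Zbasis_norm iI.
have dq (i : 'I_m) : (d i)%:R != 0 :> rat by rewrite pnatr_eq0 -lt0n.
rewrite (covol2_Zbasis bZ b'Z).
pose e : m.-tuple K := [tuple (d i)%:R * b'`_i | i < m].
have eE (i : 'I_m) : e`_i = ((d i)%:R : rat) *: b'`_i.
  by rewrite nth_mktuple scaler_nat mulr_natl.
have eP : basis_of {:K} e.
  rewrite basisEfree subvf size_tuple leqnn !andbT.
  apply/freeP => k k0 i; have := coord_comb b'Z.1 (fun i => k i * (d i)%:R) i.
  have -> : \sum_j (k j * (d j)%:R) *: b'`_j = 0.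
    by rewrite -[RHS]k0; apply: eq_bigr => j _; rewrite eE scalerA.
  by rewrite linear0 => /esym/eqP; rewrite mulf_eq0 (negbTE (dq i)) orbF => /eqP.
have ec x i : coord b' i x = coord e i x * (d i)%:R.
  rewrite -[RHS](coord_comb b'Z.1 (fun i => coord e i x * (d i)%:R)); congr coord.
  by rewrite [LHS](coordE eP); apply: eq_bigr => j _; rewrite eE scalerA.
have eZ : Zbasis I e.
  split=> // x; rewrite IP; split=> [xi i|xi i].
    by have [z] := xi i; rewrite ec => /(mulIf (dq i)) ->; rewrite rpred_int.
  by have /intrP[z zE] := xi i; exists z; rewrite ec zE.
rewrite (covol2_Zbasis cZ eZ).
rewrite /covol2; have -> : emb_mx e = emb_mx b' *m diag_mx (\row_i (d i)%:R).
  apply/matrixP => k i; rewrite mul_mx_diag !mxE nth_mktuple rmorphM rmorph_nat.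
  by rewrite mulrC.
rewrite det_mulmx det_diag N2M mulrC; congr (_ * _).
under eq_bigr => i _ do rewrite mxE.
by rewrite -natr_prod; exact: (N2_int R (Posz _)).
Qed.

(** For integral x, the covolume of x OK is computed twice: from multiplication by x at each
    embedding, and from the index of x OK. Hence the product of the [N2 (emb k x)] is the squared
    index, which [PV_abs] turns into finite absolute values. A denominator reduces the general case
    to this one. *)
Lemma product_formula (a : K) : a != 0 ->
  PV (fun v => absK R v a) ^+ 2 * \prod_k N2 (emb k a) = 1.
Proof.
have int_case x : OK x -> x != 0 ->
    PV (fun v => absK R v x) ^+ 2 * \prod_k N2 (emb k x) = 1.
  move=> Ox x0; have [_ ->] := PV_abs R Ox x0.
  have iI := nzideal_principal Ox x0.
  have [b bZ] := nzideal_Zbasis (nzideal_OK K).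
  have cZ : Zbasis [set x * y | y in @OK K] [tuple x * b`_i | i < m].
    apply: (Zbasis_scale bZ) => // y; split=> [[z Oz]|Oy]; last by exists y.
    by move/(mulfI x0) <-.
  have := covol2_ideal iI bZ cZ.
  rewrite (@covol2_scale b _ x) => [|i]; last by rewrite nth_mktuple.
  have cv0 := covol2_gt0 bZ.1; move/(mulIf (lt0r_neq0 cv0)) => ->.
  by rewrite -exprMn mulVf ?expr1n // pnatr_eq0 -lt0n ideal_norm_gt0.
move=> a0; have [N N0 ON] := denominator a.
have Nz : N%:R != 0 :> K by rewrite natK_eq0 -lt0n.
have h1 := int_case _ ON (mulf_neq0 Nz a0); have h2 := int_case _ (OK_nat K N) Nz.
move: h1.
have -> : (fun v => absK R v (N%:R * a)) = (fun v => absK R v N%:R * absK R v a).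
  by apply/funext => v; rewrite absKM.
have [_ ->] := PV_M (finsupp1_abs R Nz) (finsupp1_abs R a0).
have -> : \prod_k N2 (emb k (N%:R * a)) = \prod_k N2 (emb k N%:R) * \prod_k N2 (emb k a).
  by rewrite -big_split; apply: eq_bigr => k _; rewrite rmorphM N2M.
by rewrite exprMn mulrACA h2 mul1r.
Qed.

(* x |-> (x^tau_k)_k embeds OK as a discrete subset of C^m. *)
Lemma northcott (B : R) : exists s : seq K, forall x, OK x ->
  (forall k, N2 (emb k x) <= B) -> x \in s.
Proof.
have [b bZ] := nzideal_Zbasis (nzideal_OK K).
have uE : emb_mx b \in unitmx by rewrite unitmxE unitfE emb_mx_unit // bZ.1.
pose iE := invmx (emb_mx b).
pose M (i : 'I_m) : R := 2 ^+ m * \sum_k N2 (iE i k) * B.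
have [s sP] := int_vec_bounded M.
exists [seq \sum_i ((z i 0)%:~R : rat) *: b`_i | z : 'cV[int]_m <- s] => x Ox xB.
have [z zE] := int_coord bZ Ox.
apply/mapP; exists (\col_i z i); last first.
  by rewrite [LHS](coordE bZ.1 x); apply: eq_bigr => i _; rewrite zE mxE.
apply: sP => i; rewrite mxE.
have zi : (z i)%:~R = \sum_k iE i k * emb (embi k) x :> C.
  have E1 : \col_k emb (embi k) x = emb_mx b *m \col_j (z j)%:~R.
    apply/colP => k; rewrite !mxE {1}(coordE bZ.1 x) rmorph_sum.
    by apply: eq_bigr => j _; rewrite !mxE [LHS]emb_rat zE ratr_int mulrC.
  have /colP/(_ i) : iE *m \col_k emb (embi k) x = \col_j (z j)%:~R.
    by rewrite E1 mulmxA mulVmx // mul1mx.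
  by rewrite !mxE => <-; apply: eq_bigr => k _; rewrite mxE.
rewrite -N2_int zi (le_trans (N2_sum _)) // card_ord.
rewrite /M ler_pM2l ?exprn_gt0 //; apply: ler_sum => k _.
by rewrite N2M ler_wpM2l ?N2_ge0.
Qed.

End Embeddings.

(** * Strong approximation *)

Section Transvections.
Variable F : fieldType.

Definition transv n (i j : 'I_n) (a : F) : 'M[F]_n := 1%:M + a *: delta_mx i j.

Lemma det_transv n (i j : 'I_n) a : i != j -> \det (transv i j a) = 1.
Proof.
have H (r s : 'I_n) : (s < r)%N -> \det (transv r s a) = 1.
  move=> sr; rewrite det_trig; last first.
    apply/is_trig_mxP => k l kl; rewrite !mxE.
    have -> : (k == l) = false by apply/negbTE; rewrite neq_ltn kl.
    case: andP => [[/eqP kE /eqP lE]|_]; last by rewrite mulr0 addr0.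
    by move: kl; rewrite kE lE ltnNge ltnW.
  rewrite big1 // => k _; rewrite !mxE eqxx; case: andP => [[/eqP -> /eqP E]|_].
    by move: sr; rewrite E ltnn.
  by rewrite mulr0 addr0.
rewrite neq_ltn => /orP[ij|ji]; last exact: H.
rewrite -det_tr; have -> : (transv i j a)^T = transv j i a; last exact: H.
by rewrite /transv linearD /= linearZ /= trmx1 trmx_delta.
Qed.

Lemma transvN n (i j : 'I_n) a : i != j -> transv i j (- a) *m transv i j a = 1%:M.
Proof.
move=> ij; rewrite /transv mulmxDl mul1mx mulmxDr mulmx1 -scalemxAl -scalemxAr.
by rewrite mul_delta_mx_0 ?scaler0 1?eq_sym // addr0 scaleNr addrK.
Qed.

(** SL_n is generated by transvections, in the form of an induction principle. Closure under
    products suffices, the inverse of a transvection being one. *)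
Lemma SL_ind n (P : 'M[F]_n -> Prop) : P 1%:M ->
  (forall A B, P A -> P B -> P (A *m B)) ->
  (forall i j a, i != j -> P (transv i j a)) ->
  forall A, \det A = 1 -> P A.
Proof.
elim: n P => [|n IHn] P P1 PM PT A; first by rewrite [A]flatmx0 => _; rewrite -[0](flatmx0 1%:M).
move: P P1 PM PT A; rewrite -[n.+1]/(1 + n)%N => P P1 PM PT A dA.
pose U b : 'M[F]_(1 + n) := block_mx 1%:M b 0 1%:M.
pose L c : 'M[F]_(1 + n) := block_mx 1%:M 0 c 1%:M.
have PU b : P (U b).
  have UD b1 b2 : P (U b1) -> P (U b2) -> P (U (b1 + b2)).
    move=> h1 h2; have := PM _ _ h1 h2.
    by rewrite mulmx_block !mul1mx !mulmx1 !mul0mx !mulmx0 !addr0 add0r addrC.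
  have U0 : P (U 0) by rewrite /U -scalar_mx_block.
  rewrite [b]matrix_sum_delta; apply: (big_ind (fun b => P (U b))) => // i _.
  apply: (big_ind (fun b => P (U b))) => // j _.
  have -> : U (b i j *: delta_mx i j) = transv (lshift n 0) (rshift 1 j) (b i j).
    apply/matrixP => r s; case: (split_ordP r) => r' ->; case: (split_ordP s) => s' ->;
    rewrite ?(block_mxEul, block_mxEur, block_mxEdl, block_mxEdr) !mxE
      ?(eq_lshift, eq_rshift, eq_lrshift, eq_rlshift) ?ord1 ?eqxx ?andbF
      ?mulr0 ?addr0 ?add0r //.
  by apply: PT; rewrite eq_lrshift.
have PL c : P (L c).
  have LD c1 c2 : P (L c1) -> P (L c2) -> P (L (c1 + c2)).
    move=> h1 h2; have := PM _ _ h1 h2.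
    by rewrite mulmx_block !mul1mx !mulmx1 !mul0mx !mulmx0 !addr0 add0r.
  have L0 : P (L 0) by rewrite /L -scalar_mx_block.
  rewrite [c]matrix_sum_delta; apply: (big_ind (fun c => P (L c))) => // i _.
  apply: (big_ind (fun c => P (L c))) => // j _.
  have -> : L (c i j *: delta_mx i j) = transv (rshift 1 i) (lshift n 0) (c i j).
    apply/matrixP => r s; case: (split_ordP r) => r' ->; case: (split_ordP s) => s' ->;
    rewrite ?(block_mxEul, block_mxEur, block_mxEdl, block_mxEdr) !mxE
      ?(eq_lshift, eq_rshift, eq_lrshift, eq_rlshift) ?ord1 ?eqxx ?andbF
      ?mulr0 ?addr0 ?add0r //.
  by apply: PT; rewrite eq_rlshift.
have P'D D : \det D = 1 -> P (block_mx 1%:M 0 0 D).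
  apply: (IHn (fun D => P (block_mx 1%:M 0 0 D))).
  - by rewrite -scalar_mx_block.
  - move=> B C PB PC; have := PM _ _ PB PC.
    by rewrite mulmx_block !mul1mx !mulmx0 !mul0mx !addr0 !add0r.
  - move=> i j a ij; have := PT (rshift 1 i) (rshift 1 j) a.
    rewrite (inj_eq (@rshift_inj _ _)) => /(_ ij); congr P.
    apply/matrixP => r s; case: (split_ordP r) => r' ->; case: (split_ordP s) => s' ->;
    rewrite ?(block_mxEul, block_mxEur, block_mxEdl, block_mxEdr) !mxE
      ?(eq_lshift, eq_rshift, eq_lrshift, eq_rlshift) ?ord1 ?eqxx ?andbF
      ?mulr0 ?addr0 ?add0r //.
(* With corner 1, the matrix is lower unipotent times diag(1, Schur complement) times upper
   unipotent; the Schur complement has determinant 1 and is covered by the induction. *)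
have claim1 b c D : \det (block_mx 1%:M b c D) = 1 -> P (block_mx 1%:M b c D).
  have -> : block_mx 1%:M b c D = block_mx 1%:M 0 c 1%:M *m
      block_mx 1%:M 0 0 (D - c *m b) *m block_mx 1%:M b 0 1%:M.
    rewrite !mulmx_block !mul1mx !mulmx1 !mul0mx !mulmx0 !addr0 !add0r.
    by rewrite mul1mx [c *m b + _]addrC subrK.
  rewrite !det_mulmx !det_lblock !det_ublock !det1 !mul1r !mulr1 => dD.
  by apply: (PM _ _ (PM _ _ (PL c) (P'D _ dD)) (PU b)).
(* A nonzero entry below the corner allows one row operation, of coefficient t, that turns the
   corner into 1. *)
have claim2 B : \det B = 1 -> (exists i, dlsubmx B i 0 != 0) -> P B.
  move=> dB [i Bi]; pose t := (1 - ulsubmx B 0 0) / dlsubmx B i 0.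
  have ij : lshift n 0 != rshift 1 i by rewrite eq_lrshift.
  pose B' := transv (lshift n 0) (rshift 1 i) t *m B.
  have dB' : \det B' = 1 by rewrite det_mulmx det_transv // dB mulr1.
  have uB' : ulsubmx B' = 1%:M.
    apply/matrixP => r s; rewrite !ord1 /B' mulmxDl mul1mx !mxE (bigD1 (rshift 1 i)) //=.
    rewrite big1 => [|k k0]; last by rewrite !mxE (negbTE k0) andbF mulr0 mul0r.
    rewrite !mxE !eqxx mulr1 addr0 mulr1n.
    have -> : B (rshift 1 i) (lshift n 0) = dlsubmx B i 0 by rewrite !mxE.
    by rewrite /t divfK // !mxE addrC subrK.
  have PB' : P B'.
    by move: dB'; rewrite -[B']submxK uB'; exact: claim1.
  have -> : B = transv (lshift n 0) (rshift 1 i) (- t) *m B'.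
    by rewrite mulmxA transvN // mul1mx.
  by apply: PM => //; apply: PT.
(* If the first column vanishes below the corner, the corner is nonzero because the determinant is
   1; adding the first row to the next one leads back to [claim2]. In size 1 the corner is already
   1. *)
have [c0|/cV0Pn[i ci]] := eqVneq (dlsubmx A) 0; last by apply: claim2 => //; exists i.
have aD : ulsubmx A 0 0 * \det (drsubmx A) = 1.
  by have := dA; rewrite -{1}[A]submxK c0 det_ublock det_mx11.
have [n0|n_gt0] := posnP n.
  have uA : ulsubmx A = 1%:M.
    apply/matrixP => r s; rewrite !ord1 -[LHS]mulr1 [RHS]mxE /= mulr1n -[RHS]aD.
    congr (_ * _); move: (drsubmx A); clear -n0; move: n0 => -> D.
    by rewrite det_mx00.
  by move: dA; rewrite -[A]submxK uA; exact: claim1.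
pose i0 := Ordinal n_gt0.
have ij : rshift 1 i0 != lshift n 0 by rewrite eq_rlshift.
have -> : A = transv (rshift 1 i0) (lshift n 0) (- 1) *m
    (transv (rshift 1 i0) (lshift n 0) 1 *m A).
  by rewrite mulmxA transvN // mul1mx.
apply: PM; first exact: PT.
apply: claim2; first by rewrite det_mulmx det_transv // dA mulr1.
exists i0; rewrite mulmxDl mul1mx scale1r !mxE (bigD1 (lshift n 0)) //=.
rewrite big1 => [|k k0]; last by rewrite mxE (negbTE k0) andbF mul0r.
rewrite mxE !eqxx mul1r addr0.
have -> : A (rshift 1 i0) (lshift n 0) = dlsubmx A i0 0 by rewrite !mxE.
have -> : A (lshift n 0) (lshift n 0) = ulsubmx A 0 0 by rewrite !mxE.
rewrite c0 mxE add0r; apply: contraTneq (oner_neq0 F) => a0.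
by rewrite -aD a0 mul0r eqxx.
Qed.
End Transvections.

Section StrongApproximation.
Variables (R : realType) (K : fieldExtType rat).
Local Notation abs := (@absK R K).
Implicit Types (T : seq (finplace K)) (v w : finplace K).

Lemma half_powers (e : R) : 0 < e -> exists k : nat, 2^-1 ^+ k <= e.
Proof.
move=> e0; pose k := `|Num.ceil e^-1|%N; exists k.
rewrite exprVn -[e]invrK lef_pV2 ?posrE ?invr_gt0 ?exprn_gt0 //.
apply: (@le_trans _ _ k%:R).
  by rewrite /k natr_absz (le_trans (ceil_ge _)) // intr_norm ler_norm.
by rewrite -natrX ler_nat ltnW // ltn_expl.
Qed.

(** Take a = c al, with c congruent to 1 at v0 and to 0 elsewhere modulo D Q: the factor D clears
    the denominator of al, and Q, a product of powers of uniformizers, provides the precision e at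
    v0 and on T. *)
Lemma approx_element T v0 (al : K) (e : R) : 0 < e -> exists a,
  [/\ abs v0 (a - al) <= e, forall w, w != v0 -> w \in T -> abs w a <= e
    & forall w, w != v0 -> abs w a <= 1].
Proof.
move=> e0; have [k ke] := half_powers e0.
have [D D0 OD] := denominator al; have Dz : D%:R != 0 :> K by rewrite natK_eq0 -lt0n.
have q0 w : uniformizer w != 0 by have [] := uniformizerP w.
have Oq w : OK (uniformizer w) by have [/fp_OK] := uniformizerP w.
pose Q := \prod_(w <- v0 :: T) uniformizer w ^+ k.
have OQ : OK Q by apply: OK_prod => w _; exact: OKX.
have Q0 : Q != 0.
  rewrite /Q; elim/big_ind: _ => [|x y x0 y0|w _]; first exact: oner_neq0.
    exact: mulf_neq0.
  by rewrite expf_neq0.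
have Qw w : w \in v0 :: T -> abs w Q <= e.
  move=> wT; rewrite /Q (big_rem w wT) /= absKM; apply: le_trans (ler_piMr _ _) _.
  - exact: absK_ge0.
  - by apply: absK_OK; apply: OK_prod => u _; exact: OKX.
  - apply: le_trans ke; rewrite absKX absK_uniformizer lerXn2r ?nnegrE ?invr_ge0 ?ler0n //.
    by rewrite lef_pV2 ?posrE ?fp_normR_gt0 // ler_nat fp_norm_ge2.
have OM : OK (D%:R * Q) by apply: OKM => //; exact: OK_nat.
have M0 : D%:R * Q != 0 by rewrite mulf_neq0.
have Mw w : abs w (D%:R * Q) * abs w al <= abs w Q.
  rewrite -absKM (_ : D%:R * Q * al = D%:R * al * Q); last by ring.
  by rewrite absKM ler_piMl ?absK_ge0 ?absK_OK.
have [c [Oc c1 cw]] := crt R v0 OM M0.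
exists (c * al); split=> [|w wv wT|w wv].
- rewrite -[X in _ - X]mul1r -mulrBl absKM.
  apply: le_trans (ler_wpM2r (absK_ge0 _ _ _) c1) _.
  by apply: le_trans (Mw _) _; apply: Qw; exact: mem_head.
- rewrite absKM; apply: le_trans (ler_wpM2r (absK_ge0 _ _ _) (cw w wv)) _.
  by apply: le_trans (Mw _) _; apply: Qw; rewrite inE wT orbT.
- rewrite absKM; apply: le_trans (ler_wpM2r (absK_ge0 _ _ _) (cw w wv)) _.
  by apply: le_trans (Mw _) _; exact: absK_OK.
Qed.

Variable n : nat.

Lemma abs_mulmx v k p (A : 'M[K]_(k, n)) (B : 'M[K]_(n, p)) (a b : R) : 0 <= a ->
  (forall i j, abs v (A i j) <= a) -> (forall i j, abs v (B i j) <= b) -> 0 <= b ->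
  forall i j, abs v ((A *m B) i j) <= a * b.
Proof.
move=> a0 Aa Bb b0 i j; rewrite mxE; apply: absK_sum => [|l _]; first exact: mulr_ge0.
by rewrite absKM ler_pM ?absK_ge0.
Qed.

(** Closeness is asked on T only, integrality at all other places; both survive products, which
    makes the property fit for [SL_ind]. *)
Definition approximable T (h : finplace K -> 'M[K]_n) := forall e : R, 0 < e ->
  exists g : 'M[K]_n, [/\ \det g = 1,
    forall v, v \in T -> forall i j, abs v ((g - h v) i j) <= e
  & forall v, v \notin T -> forall i j, abs v (g i j) <= 1].

Lemma entries_bounded T (h : finplace K -> 'M[K]_n) : exists2 B : R, 1 <= B &
  forall v, v \in T -> forall i j, abs v (h v i j) <= B.
Proof.
exists (1 + \sum_(v <- T) \sum_i \sum_j abs v (h v i j)).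
  rewrite lerDl; apply: sumr_ge0 => v _; apply: sumr_ge0 => i _.
  by apply: sumr_ge0 => j _; exact: absK_ge0.
move=> v vT i j; rewrite ler_wpDl // (big_rem v vT) /= (bigD1 i) //= (bigD1 j) //=.
rewrite -!addrA lerDl; repeat (apply: addr_ge0 || apply: sumr_ge0 => ? _) => //;
by exact: absK_ge0.
Qed.

Lemma approximableM T h1 h2 : approximable T h1 -> approximable T h2 ->
  approximable T (fun v => h1 v *m h2 v).
Proof.
move=> a1 a2 e e0.
have [B1 B11 hB1] := entries_bounded T h1; have [B2 B21 hB2] := entries_bounded T h2.
pose B := B1 * B2; have B1_0 : 0 < B1 by exact: lt_le_trans B11.
have B2_0 : 0 < B2 by exact: lt_le_trans B21.
(* d <= 1 keeps the entries of g2 bounded by B on T, and d B <= e bounds both error terms of the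
   product. *)
pose d := Num.min e 1 / B.
have B0 : 0 < B by rewrite mulr_gt0.
have d0 : 0 < d by rewrite divr_gt0 // lt_min e0 ltr01.
have B1le : B1 <= B by rewrite ler_peMr // ltW.
have B2le : B2 <= B by rewrite ler_peMl // ltW.
have B_1 : 1 <= B by exact: le_trans B1le.
have dB : d * B <= e by rewrite /d divfK ?gt_eqF // ge_min lexx.
have d1 : d <= 1 by rewrite ler_pdivrMr // mul1r ge_min B_1 orbT.
have [g1 [dg1 g1T g1n]] := a1 d d0; have [g2 [dg2 g2T g2n]] := a2 d d0.
exists (g1 *m g2); split=> [|v vT i j|v vT i j].
- by rewrite det_mulmx dg1 dg2 mulr1.
- have -> : g1 *m g2 - h1 v *m h2 v = (g1 - h1 v) *m g2 + h1 v *m (g2 - h2 v).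
    by rewrite mulmxBl mulmxBr addrA subrK.
  have g2B k l : abs v (g2 k l) <= B.
    have -> : g2 k l = (g2 - h2 v) k l + h2 v k l by rewrite !mxE subrK.
    apply: absKD; first by apply: le_trans (g2T v vT k l) _; exact: le_trans d1 B_1.
    by apply: le_trans (hB2 v vT k l) _.
  rewrite mxE; apply: absKD; apply: le_trans dB.
    by apply: abs_mulmx => //; [exact: ltW|exact: g1T|exact: ltW].
  rewrite mulrC; apply: abs_mulmx => //; [exact: ltW| |exact: g2T|exact: ltW].
  by move=> k l; apply: le_trans (hB1 v vT k l) _.
- by rewrite -[leRHS]mulr1; apply: abs_mulmx => //; [exact: g1n|exact: g2n].
Qed.

Definition single v0 (A : 'M[K]_n) v : 'M[K]_n := if v == v0 then A else 1%:M.

Lemma approximable1 T : approximable T (fun=> 1%:M).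
Proof.
move=> e e0; exists 1%:M; split=> [|v _ i j|v _ i j].
- exact: det1.
- by rewrite subrr mxE absK0 ltW.
- by apply: absK_OK; rewrite mxE; exact: OK_nat.
Qed.

(** By [SL_ind] only a transvection at v0 has to be treated, and [approx_element] approximates its
    one parameter. *)
Lemma approximable_single T v0 (A : 'M[K]_n) : v0 \in T -> \det A = 1 ->
  approximable T (single v0 A).
Proof.
move=> v0T; apply: (SL_ind (P := fun A => approximable T (single v0 A))).
- have -> : single v0 1%:M = fun=> 1%:M by apply/funext => v; rewrite /single if_same.
  exact: approximable1.
- move=> B C aB aC; have := approximableM aB aC; congr approximable.
  by apply/funext => v; rewrite /single; case: eqP; rewrite ?mulmx1.
- move=> i j al ij e e0; have [a [a1 a2 a3]] := approx_element T v0 al e0.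
  exists (transv i j a); split=> [|v vT k l|v vT k l]; first exact: det_transv.
    rewrite /single; case: eqVneq => [->|vv0].
      rewrite !mxE; set d := (_ && _).
      have -> : (k == l)%:R + a * d%:R - ((k == l)%:R + al * d%:R) = (a - al) * d%:R by ring.
      rewrite absKM; apply: le_trans a1; rewrite ler_piMr ?absK_ge0 //.
      by apply: absK_OK; exact: OK_nat.
    rewrite !mxE addrAC subrr add0r absKM; apply: le_trans (a2 v vv0 vT).
    by rewrite ler_piMr ?absK_ge0 //; apply: absK_OK; exact: OK_nat.
  have vv0 : v != v0 by apply: contra vT => /eqP ->.
  rewrite !mxE; apply: absKD; first by apply: absK_OK; exact: OK_nat.
  rewrite absKM; apply: le_trans (a3 v vv0).
  by rewrite ler_piMr ?absK_ge0 //; apply: absK_OK; exact: OK_nat.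
Qed.

Lemma approximable_family T (h : finplace K -> 'M[K]_n) : uniq T ->
  (forall v, \det (h v) = 1) -> approximable T (fun v => if v \in T then h v else 1%:M).
Proof.
move=> uT dh.
suff H S : uniq S -> {subset S <= T} -> approximable T (fun v => if v \in S then h v else 1%:M).
  exact: H.
elim: S => [|v0 S IHS] /=; first by move=> _ _; exact: approximable1.
move=> /andP[v0S uS] ST.
have ap1 := approximable_single (ST _ (mem_head _ _)) (dh v0).
have ap2 : approximable T (fun v => if v \in S then h v else 1%:M).
  by apply: IHS => // v vS; apply: ST; rewrite inE vS orbT.
have := approximableM ap1 ap2; congr approximable; apply/funext => v.
rewrite /single inE; case: eqVneq => [->|_] /=; last by rewrite mul1mx.
by rewrite (negbTE v0S) mulmx1.
Qed.

Lemma strong_approximation T (A : finplace K -> 'M[K]_n) : uniq T ->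
  (forall v, \det (A v) = 1) -> exists g : 'M[K]_n, [/\ \det g = 1,
    forall v, v \in T -> forall i j, abs v ((A v *m g) i j) <= 1
  & forall v, v \notin T -> forall i j, abs v (g i j) <= 1].
Proof.
move=> uT dA; pose h v := \adj (A v).
have Ah v : A v *m h v = 1%:M by rewrite mul_mx_adj dA.
have dh v : \det (h v) = 1.
  by have := congr1 determinant (Ah v); rewrite det_mulmx dA mul1r det1.
have [B B1 AB] := entries_bounded T A; have B0 : 0 < B by exact: lt_le_trans B1.
(* Approximating the inverse of [A v] to precision 1 / B, with B bounding the entries of [A v],
   makes [A v *m g - 1] integral. *)
have [|g [dg gT gn]] := approximable_family uT dh (e := B^-1); first by rewrite invr_gt0.
exists g; split=> // v vT i j.
have -> : A v *m g = A v *m (g - h v) + 1%:M by rewrite mulmxBr Ah subrK.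
rewrite mxE; apply: absKD; last by apply: absK_OK; rewrite mxE; exact: OK_nat.
have BB : 1 = B * B^-1 by rewrite divff // gt_eqF.
rewrite BB; apply: abs_mulmx; [exact: ltW|exact: AB| |by rewrite invr_ge0 ltW].
by move=> k l; have := gT v vT k l; rewrite vT.
Qed.

End StrongApproximation.

(** * Completions *)

Section Completion.
Variables (R : realType) (K : fieldExtType rat) (v : finplace K).
Local Notation abs := (@absK R K v).
Local Notation Kv := (completion v).
Implicit Types u w : cauchy_seq v.

Local Open Scope quotient_scope.

Definition seq_at (k : nat) u : K := seqval u k.

Fact seq_at_zmod k : zmod_morphism (seq_at k).
Proof. by move=> u w; rewrite /seq_at -[seqval _]/(val (u - w)) rmorphB. Qed.

Fact seq_at_monoid k : monoid_morphism (seq_at k).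
Proof.
split=> [|u w]; first by rewrite /seq_at -[seqval _]/(val 1) rmorph1.
by rewrite /seq_at -[seqval _]/(val (u * w)) rmorphM.
Qed.

HB.instance Definition _ k :=
  GRing.isZmodMorphism.Build (cauchy_seq v) K (seq_at k) (seq_at_zmod k).
HB.instance Definition _ k :=
  GRing.isMonoidMorphism.Build (cauchy_seq v) K (seq_at k) (seq_at_monoid k).

Lemma abs_isosceles (x y : K) : abs (x - y) < abs y -> abs x = abs y.
Proof.
move=> xy; apply/eqP; rewrite eq_le; apply/andP; split.
  by rewrite -(subrK y x); apply: absKD => //; exact: ltW.
rewrite leNgt; apply/negP => lt.
have : abs y <= Num.max (abs (x - y)) (abs x).
  by rewrite -{1}(subKr x y); apply: absKB; rewrite le_max lexx ?orbT.
by rewrite leNgt gt_max xy lt.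
Qed.

Lemma small_abs (e : R) : 0 < e -> exists2 d : K, d != 0 & abs d <= e.
Proof.
move=> e0; have [k ke] := half_powers e0; have [_ q0 _] := uniformizerP v.
exists (uniformizer v ^+ k); first by rewrite expf_neq0.
apply: le_trans ke; rewrite absKX absK_uniformizer lerXn2r ?nnegrE ?invr_ge0 ?ler0n //.
by rewrite lef_pV2 ?posrE ?fp_normR_gt0 // ler_nat fp_norm_ge2.
Qed.

Lemma cauchy_seqP u (e : R) : 0 < e ->
  exists N, forall k l, (N <= k)%N -> (N <= l)%N -> abs (seq_at k u - seq_at l u) <= e.
Proof.
move=> e0; have [d d0 de] := small_abs e0.
have /asboolP /(_ d d0)[N HN] := valP u; exists N => k l Nk Nl.
by apply: le_trans de; apply/absK_vball => //; exact: HN.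
Qed.

Lemma null_seqP u (e : R) : \pi_Kv u = 0 -> 0 < e ->
  exists N, forall k, (N <= k)%N -> abs (seq_at k u) <= e.
Proof.
move=> u0 e0; have [d d0 de] := small_abs e0.
have : u \in null_seq (v := v).
  by rewrite -[u]subr0 Quotient.idealrBE u0 rmorph0.
move/asboolP => /(_ d d0)[N HN]; exists N => k Nk.
by apply: le_trans de; apply/absK_vball => //; exact: HN.
Qed.

(** [absv] is a limit along the representative picked by [repr]; this frees it from that choice.
    Either u is null, and so is every representative of its class, or its absolute values are
    eventually constant, and any sequence differing from u by a null one eventually has the same
    values. *)
Lemma absv_cvg u : (fun k => abs (seq_at k u)) @ \oo --> absv R (\pi_Kv u).
Proof.
pose w : cauchy_seq v := repr (\pi_Kv u).
have wu0 : \pi_Kv (w - u) = 0 by rewrite rmorphB /= reprK subrr.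
have absvE : absv R (\pi_Kv u) = lim ((fun k => abs (seq_at k w)) @ \oo) by [].
have evc (f : nat -> R) (c : R) N : (forall k, (N <= k)%N -> f k = c) -> f @ \oo --> c.
  move=> fc; apply/cvgrPdist_le => e e0; exists N => // k /= Nk.
  by rewrite fc // subrr normr0 ltW.
have ev0 (f : nat -> R) : (forall k, 0 <= f k) ->
    (forall e, 0 < e -> exists N, forall k, (N <= k)%N -> f k <= e) -> f @ \oo --> (0 : R).
  move=> f0 fe; apply/cvgrPdist_le => e e0; have [N HN] := fe e e0.
  by exists N => // k /= Nk; rewrite sub0r normrN ger0_norm ?HN.
have lim_cst (f : nat -> R) c : f @ \oo --> c -> lim (f @ \oo) = c.
  by move=> fc; exact: cvg_lim fc.
have [un|] := pselect (forall e : R, 0 < e ->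
    exists N, forall k, (N <= k)%N -> abs (seq_at k u) <= e).
  have -> : absv R (\pi_Kv u) = 0.
    rewrite absvE; apply: lim_cst; apply: ev0 => [k|e e0]; first exact: absK_ge0.
    have [N HN] := un e e0; have [M HM] := null_seqP wu0 e0.
    exists (maxn N M) => k; rewrite geq_max => /andP[Nk Mk].
    have -> : seq_at k w = seq_at k (w - u) + seq_at k u by rewrite rmorphB /= subrK.
    by apply: absKD; [exact: HM|exact: HN].
  by apply: ev0 => // k; exact: absK_ge0.
move=> /existsNP[e /not_implyP[e0 /forallNP nN]].
have [N HN] := cauchy_seqP u e0.
have /existsNP[k0 /not_implyP[Nk0 /negP]] := nN N; rewrite -ltNge => ek0.
have uc k : (k0 <= k)%N -> abs (seq_at k u) = abs (seq_at k0 u).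
  move=> k0k; apply: abs_isosceles; apply: le_lt_trans ek0; apply: HN => //.
  exact: leq_trans k0k.
suff -> : absv R (\pi_Kv u) = abs (seq_at k0 u) by exact: evc uc.
have [M HM] := null_seqP wu0 e0.
rewrite absvE; apply: lim_cst; apply: (evc _ _ (maxn k0 M)) => k.
rewrite geq_max => /andP[k0k Mk]; rewrite -(uc k k0k); apply: abs_isosceles.
by rewrite -rmorphB /= (le_lt_trans (HM k Mk)) // uc.
Qed.

Lemma absv_to_completion (x : K) : absv R (to_completion v x) = abs x.
Proof.
have h := @absv_cvg (CauchySeq (vcauchy_cst v x)).
have h' : abs (seq_at k (CauchySeq (vcauchy_cst v x))) @[k --> \oo] --> abs x.
  by rewrite /seq_at /=; exact: cvg_cst.
exact: (cvg_unique _ h h').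
Qed.

Variable n : nat.

Definition mx_at k (U : 'M[cauchy_seq v]_n) : 'M[K]_n := map_mx (seq_at k) U.

Lemma near_entries (P : nat -> 'I_n -> 'I_n -> Prop) :
  (forall i j, exists N, forall k, (N <= k)%N -> P k i j) ->
  exists N, forall k, (N <= k)%N -> forall i j, P k i j.
Proof.
move=> h; have h' i j := cid (h i j).
exists (\sum_i \sum_j sval (h' i j))%N => k Nk i j.
apply: (svalP (h' i j)); apply: leq_trans Nk.
by rewrite (bigD1 i) //= (bigD1 j) //= -addnA leq_addr.
Qed.

Lemma mx_cauchy (U : 'M[cauchy_seq v]_n) (e : R) : 0 < e -> exists N, forall k l,
  (N <= k)%N -> (N <= l)%N -> forall i j, abs ((mx_at k U - mx_at l U) i j) <= e.
Proof.
move=> e0; have [|N HN] := @near_entries (fun N i j => forall k l,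
    (N <= k)%N -> (N <= l)%N -> abs (seq_at k (U i j) - seq_at l (U i j)) <= e).
  move=> i j; have [N HN] := cauchy_seqP (U i j) e0.
  by exists N => M NM k l Mk Ml; apply: HN; exact: leq_trans NM _.
by exists N => k l Nk Nl i j; rewrite !mxE; apply: (HN N).
Qed.

Lemma mx_bounded (U : 'M[cauchy_seq v]_n) : exists2 B : R, 0 < B &
  exists N, forall k, (N <= k)%N -> forall i j, abs ((mx_at k U) i j) <= B.
Proof.
have [N HN] := mx_cauchy U ltr01.
exists (1 + \sum_i \sum_j abs ((mx_at N U) i j)).
  rewrite ltr_wpDr ?ltr01 //; apply: sumr_ge0 => i _; apply: sumr_ge0 => j _.
  exact: absK_ge0.
have le i j : abs ((mx_at N U) i j) <= \sum_i \sum_j abs ((mx_at N U) i j).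
  rewrite (bigD1 i) //= (bigD1 j) //= -addrA lerDl.
  by repeat (apply: addr_ge0 || apply: sumr_ge0 => ? _); exact: absK_ge0.
exists N => k Nk i j.
have -> : (mx_at k U) i j = (mx_at k U - mx_at N U) i j + (mx_at N U) i j.
  by rewrite !mxE subrK.
apply: absKD.
  apply: le_trans (HN k N Nk (leqnn _) i j) _; rewrite lerDl.
  by apply: sumr_ge0 => ? _; apply: sumr_ge0 => ? _; exact: absK_ge0.
by apply: le_trans (le i j) _; rewrite lerDr ler01.
Qed.

Hypothesis n_gt0 : (0 < n)%N.

(** A late enough term of Cauchy sequences representing the entries has the same effect on the norms
    of vectors of K^n as g itself, because norms are unchanged under matrices that are integral
    together with their inverse. *)
Lemma completion_approx (g : 'M[Kv]_n) : \det g = 1 -> exists A : 'M[K]_n,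
  [/\ \det A = 1,
      forall x : 'cV[K]_n, height_fin R (g *m map_mx (to_completion v) x) =
        nv R v (A *m x) `^ (\dim {:K})%:R^-1
    & (forall i j, absv R (g i j) <= 1) -> forall i j, abs (A i j) <= 1].
Proof.
move=> dg; pose U : 'M[cauchy_seq v]_n := \matrix_(i, j) repr (g i j).
have gE i j : g i j = \pi_Kv (U i j) by rewrite mxE reprK.
have gU : g = map_mx \pi_Kv U by apply/matrixP => i j; rewrite gE [RHS]mxE.
have [N1 HN1] : exists N, forall k, (N <= k)%N -> abs (\det (mx_at k U)) = 1.
  have d0 : \pi_Kv (\det U - 1) = 0.
    by rewrite rmorphB rmorph1 /= -det_map_mx -gU dg subrr.
  have h0 : 0 < 2^-1 :> R by rewrite invr_gt0.
  have [N HN] := null_seqP d0 h0; exists N => k Nk; rewrite -[RHS](absK1 R v).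
  apply: abs_isosceles; rewrite absK1; apply: (@le_lt_trans _ _ 2^-1); last first.
    by rewrite invf_lt1 ?ltr1n.
  by have := HN k Nk; rewrite rmorphB rmorph1 /= -det_map_mx.
have [B B0 [N2 HN2]] := mx_bounded (\adj U).
have [|N3 HN3] := @mx_cauchy U B^-1; first by rewrite invr_gt0.
have [N4 HN4] : exists N, (forall i j, absv R (g i j) <= 1) ->
    forall k, (N <= k)%N -> forall i j, abs ((mx_at k U) i j) <= 1.
  have [g1|ng1] := pselect (forall i j, absv R (g i j) <= 1); last by exists 0%N.
  have [|N HN] := @near_entries (fun k i j => abs ((mx_at k U) i j) <= 1).
    move=> i j; have h := @absv_cvg (U i j); rewrite -gE in h.
    have lt : absv R (g i j) < (ideal_norm (val v))%:R :> R.
      exact: le_lt_trans (g1 i j) (fp_normR_gt1 R v).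
    have [N _ HN] := cvgr_lt _ h _ lt.
    exists N => k Nk; rewrite mxE.
    (* The inverse of the uniformizer has absolute value [N v]: being below [N v] means being at
       most 1, so integrality of the limit passes to late terms. *)
    have := @absK_discrete _ R v (seq_at k (U i j)) (uniformizer v)^-1.
    rewrite absKV absK_uniformizer invrK divff; last by rewrite gt_eqF // fp_normR_gt0.
    by apply; exact: HN.
  by exists N.
pose N := (N1 + N2 + N3 + N4)%N.
have [le1 le2 le3 le4] : [/\ (N1 <= N)%N, (N2 <= N)%N, (N3 <= N)%N & (N4 <= N)%N].
  by rewrite /N; split; lia.
(* The matrix [U_k U_l^-1 = 1 + (U_k - U_l) U_l^-1] is integral, B bounding the adjugate of U.
   Exchanging k and l, the norm is constant from N on. *)
have nvle k l (x : 'cV[K]_n) : (N <= k)%N -> (N <= l)%N ->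
    nv R v (mx_at k U *m x) <= nv R v (mx_at l U *m x).
  move=> Nk Nl; have dl : abs (\det (mx_at l U)) = 1 by apply: HN1; exact: leq_trans Nl.
  have dl0 : \det (mx_at l U) != 0 by rewrite -(absK_eq0 R v) dl oner_eq0.
  pose iA := (\det (mx_at l U))^-1 *: \adj (mx_at l U).
  have iAE : iA *m mx_at l U = 1%:M.
    by rewrite -scalemxAl mul_adj_mx scale_scalar_mx mulVf.
  have AiE : mx_at l U *m iA = 1%:M.
    by rewrite -scalemxAr mul_mx_adj scale_scalar_mx mulVf.
  have -> : mx_at k U *m x = (mx_at k U *m iA) *m (mx_at l U *m x).
    by rewrite mulmxA -[X in _ = X *m x]mulmxA iAE mulmx1.
  apply: nv_mulmx => i j.
  have -> : mx_at k U *m iA = (mx_at k U - mx_at l U) *m iA + 1%:M.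
    by rewrite mulmxBl AiE subrK.
  rewrite mxE; apply: absKD; last by apply: absK_OK; rewrite mxE; exact: OK_nat.
  have BB : 1 = B^-1 * B by rewrite mulVf // gt_eqF.
  rewrite BB; apply: abs_mulmx => [||s t|]; [by rewrite invr_ge0 ltW| | |exact: ltW].
    by apply: HN3; apply: leq_trans le3 _.
  rewrite mxE absKM absKV dl invr1 mul1r -map_mx_adj.
  by apply: HN2; exact: leq_trans Nl.
have nvE k (x : 'cV[K]_n) : (N <= k)%N -> nv R v (mx_at k U *m x) = nv R v (mx_at N U *m x).
  by move=> Nk; apply/eqP; rewrite eq_le !nvle.
pose i0 := Ordinal n_gt0.
(* The determinant of the chosen term is only a v-unit; dividing the first row by it makes it 1
   without changing norms or integrality. *)
pose s : 'rV[K]_n := \row_i (if i == i0 then (\det (mx_at N U))^-1 else 1).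
have dN := HN1 N le1.
have dN0 : \det (mx_at N U) != 0 by rewrite -(absK_eq0 R v) dN oner_eq0.
have s1 i : abs (s 0 i) = 1 by rewrite mxE; case: eqP; rewrite ?absKV ?dN ?invr1 ?absK1.
have nvs (y : 'cV[K]_n) : nv R v (diag_mx s *m y) = nv R v y.
  by apply: eq_bigr => i _; rewrite mul_diag_mx mxE absKM s1 mul1r.
exists (diag_mx s *m mx_at N U); split=> [|x|g1 i j].
- rewrite det_mulmx det_diag (bigD1 i0) //= big1 => [|i /negbTE ii]; last by rewrite mxE ii.
  by rewrite mxE eqxx mulr1 mulVf.
- rewrite -mulmxA nvs /height_fin; congr (_ `^ _).
  pose Z i : cauchy_seq v := \sum_j U i j * CauchySeq (vcauchy_cst v (x j 0)).
  have ZE i : (g *m map_mx (to_completion v) x) i 0 = \pi_Kv (Z i).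
    rewrite mxE rmorph_sum; apply: eq_bigr => j _.
    by rewrite rmorphM /= -gE mxE.
  have Zk k i : seq_at k (Z i) = (mx_at k U *m x) i 0.
    by rewrite mxE rmorph_sum; apply: eq_bigr => j _; rewrite rmorphM; congr (_ * _); rewrite [RHS]mxE.
  have Zc i : (fun k => abs ((mx_at k U *m x) i 0)) @ \oo -->
      absv R ((g *m map_mx (to_completion v) x) i 0).
    by rewrite ZE; have := @absv_cvg (Z i); under eq_fun => k do rewrite Zk.
  apply/eqP; rewrite eq_le; apply/andP; split.
    apply: bigmax_le => [|i _]; first exact: nv_ge0.
    apply: (cvgr_to_le (Zc i)); exists N => // k /= Nk.
    by rewrite -(nvE k x Nk); exact: le_nv.
  (* From N on the norm equals c. If all limits were below c, then at some later stage all
     coordinates, hence the norm, would be below c. *)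
  set c := nv R v _; set M := \big[_/_]_i _; rewrite leNgt; apply/negP => Mc.
  have [|N5 HN5] := @near_entries (fun k i _ => abs ((mx_at k U *m x) i 0) < c).
    move=> i _.
    have lt : absv R ((g *m map_mx (to_completion v) x) i 0) < c.
      apply: le_lt_trans Mc; rewrite /M (bigD1 i) //= le_max lexx.
      by [].
    by have [N5 _ HN5] := cvgr_lt _ (Zc i) _ lt; exists N5.
  have c0 : 0 < c by apply: le_lt_trans Mc; rewrite /M; elim/big_rec: _ => // i y _ y0; rewrite le_max y0 orbT.
  have : nv R v (mx_at (N + N5) U *m x) < c.
    rewrite /nv; elim/big_rec: _ => // i y _ yc; rewrite gt_max yc andbT.
    by apply: (HN5 (N + N5)%N _ i i0); rewrite leq_addl.
  by rewrite nvE ?leq_addr // ltxx.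
- by rewrite mul_diag_mx [X in absK _ _ X]mxE absKM s1 mul1r; exact: HN4.
Qed.

End Completion.

(** * Positive definite forms *)

Section Cholesky.
Variables (F : fieldType) (th : {rmorphism F -> F}) (pos : F -> Prop).
Hypothesis thK : involutive th.
Hypothesis posP : forall a, pos a -> a != 0 /\ exists c, a = th c * c.

(** With [th] the identity over the reals and conjugation over the complex numbers, one Cholesky
    factorization serves symmetric and hermitian forms. *)
Definition adjmx m n (A : 'M[F]_(m, n)) : 'M[F]_(n, m) := (map_mx th A)^T.

Lemma adjmxM m n p (A : 'M[F]_(m, n)) (B : 'M[F]_(n, p)) :
  adjmx (A *m B) = adjmx B *m adjmx A.
Proof. by rewrite /adjmx map_mxM trmx_mul. Qed.

Lemma adjmxK m n (A : 'M[F]_(m, n)) : adjmx (adjmx A) = A.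
Proof. by apply/matrixP => i j; rewrite !mxE thK. Qed.

Lemma adjmx_block m1 m2 n1 n2 (a : 'M[F]_(m1, n1)) (b : 'M[F]_(m1, n2))
    (c : 'M[F]_(m2, n1)) (d : 'M[F]_(m2, n2)) :
  adjmx (block_mx a b c d) = block_mx (adjmx a) (adjmx c) (adjmx b) (adjmx d).
Proof. by rewrite /adjmx map_block_mx tr_block_mx. Qed.

Lemma adjmxZ m n (a : F) (A : 'M[F]_(m, n)) : adjmx (a *: A) = th a *: adjmx A.
Proof. by rewrite /adjmx map_mxZ; apply/matrixP => i j; rewrite !mxE. Qed.

Lemma adjmx0 m n : adjmx (0 : 'M[F]_(m, n)) = 0.
Proof. by rewrite /adjmx map_mx0 trmx0. Qed.

Lemma adjmx1 n : adjmx (1%:M : 'M[F]_n) = 1%:M.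
Proof. by rewrite /adjmx map_mx1 trmx1. Qed.

Definition hform n (S : 'M[F]_n) (y : 'cV[F]_n) : F := (adjmx y *m S *m y) 0 0.

Definition posdef n (S : 'M[F]_n) :=
  adjmx S = S /\ forall y : 'cV[F]_n, y != 0 -> pos (hform S y).

Lemma hform_conj n (S P : 'M[F]_n) y : hform (adjmx P *m S *m P) y = hform S (P *m y).
Proof. by rewrite /hform adjmxM !mulmxA. Qed.

Lemma posdef_split n (S : 'M[F]_(1 + n)) : posdef S -> exists (a : F) r D,
  [/\ S = adjmx (block_mx 1%:M r 0 1%:M) *m block_mx a%:M 0 0 D *m block_mx 1%:M r 0 1%:M,
      pos a & posdef D].
Proof.
move=> [SS Spos]; pose a : F := ulsubmx S 0 0.
have aE : a%:M = ulsubmx S by apply/matrixP => i j; rewrite !ord1 [LHS]mxE mulr1n.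
pose e : 'cV[F]_(1 + n) := col_mx 1%:M 0.
have pa : pos a.
  have -> : a = hform S e.
    rewrite /hform -[S in RHS]submxK /e /adjmx map_col_mx tr_col_mx map_mx1 map_mx0 trmx1 trmx0.
    by rewrite mul_row_block !mul1mx !mul0mx !addr0 mul_row_col mulmx1 mulmx0 addr0.
  apply: Spos; apply/eqP => /colP/(_ (lshift n 0)); rewrite col_mxEu !mxE eqxx.
  by move/eqP; rewrite oner_eq0.
have [a0 _] := posP pa.
have := SS; rewrite -{1 2}[S]submxK adjmx_block => /eq_block_mx[Eul Edl _ Edr].
have tha : th a = a by move/matrixP: Eul => /(_ 0 0); rewrite /adjmx [LHS]mxE [LHS]mxE.
clearbody a.
have [r rE] : exists r, a *: r = ursubmx S.
  by exists (a^-1 *: ursubmx S); rewrite scalerA divff // scale1r.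
pose D := drsubmx S - adjmx r *m (a *: r).
have SE : S = adjmx (block_mx 1%:M r 0 1%:M) *m block_mx a%:M 0 0 D *m block_mx 1%:M r 0 1%:M.
  rewrite adjmx_block !adjmx1 adjmx0 !mulmx_block !mul1mx !mulmx1 !mul0mx !mulmx0.
  rewrite !addr0 !add0r mul_scalar_mx mul_mx_scalar.
  have rE' : a *: adjmx r = dlsubmx S.
    by rewrite -[dlsubmx S]adjmxK Edl -rE adjmxZ tha.
  by rewrite -scalemxAl scalemxAr rE rE' /D rE addrC subrK aE submxK.
exists a, r, D; split=> //; split.
  rewrite /D /adjmx; apply/matrixP => i j.
  rewrite !mxE rmorphB; congr (_ - _).
    by move/matrixP: Edr => /(_ i j); rewrite !mxE.
  rewrite rmorph_sum; apply: eq_bigr => k _; rewrite !mxE !rmorphM /= thK tha; ring.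
move=> y y0; pose z : 'cV[F]_(1 + n) := col_mx (- (r *m y)) y.
have Pz : block_mx 1%:M r 0 1%:M *m z = col_mx 0 y.
  by rewrite mul_block_col !mul1mx mul0mx add0r addrC subrr.
have -> : hform D y = hform S z.
  rewrite SE hform_conj Pz /hform /adjmx map_col_mx tr_col_mx map_mx0 trmx0.
  by rewrite mul_row_block !mul0mx !mulmx0 !add0r mul_row_col mul0mx add0r.
apply: Spos; apply: contra y0 => /eqP z0; apply/eqP/colP => i.
by move/colP: z0 => /(_ (rshift 1 i)); rewrite col_mxEd !mxE.
Qed.

Lemma cholesky n (S : 'M[F]_n) : posdef S -> exists g : 'M[F]_n, S = adjmx g *m g.
Proof.
elim: n S => [|n IHn]; first by move=> S _; exists 0; rewrite [S]flatmx0 [RHS]flatmx0.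
rewrite -[n.+1]/(1 + n)%N => S pS.
have [a [r [D [SE pa /IHn[h hE]]]]] := @posdef_split n S pS.
have [a0 [c cE]] := posP pa.
exists (block_mx c%:M 0 0 h *m block_mx 1%:M r 0 1%:M).
rewrite {1}SE adjmxM mulmxA -[in RHS](mulmxA (adjmx _)); congr (_ *m _ *m _).
rewrite adjmx_block !adjmx0 mulmx_block !mul0mx !mulmx0 !addr0 !add0r -hE.
congr block_mx; apply/matrixP => i j; rewrite !ord1 !mxE big_ord_recl big_ord0 !mxE.
by rewrite !mulr1n addr0.
Qed.

End Cholesky.

Lemma finite_min (R : realType) (T : eqType) (f : T -> R) (P : T -> Prop) (s : seq T) t0 :
  t0 \in s -> P t0 ->
  exists t, [/\ t \in s, P t & forall t', t' \in s -> P t' -> f t <= f t'].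
Proof.
move=> ts Pt; suff H : (exists t, t \in s /\ P t) -> exists t,
    [/\ t \in s, P t & forall t', t' \in s -> P t' -> f t <= f t'].
  by apply: H; exists t0.
elim: s {t0 ts Pt} => [|a s IHs]; first by move=> [t []].
have [H _|nH] := pselect (exists t, t \in s /\ P t); last first.
  move=> [t []]; rewrite inE => /orP[/eqP -> Pa|ts Pt]; last by case: nH; exists t.
  exists a; split=> // [|t']; first exact: mem_head.
  by rewrite inE => /orP[/eqP -> //|t's Pt']; case: nH; exists t'.
have [t [ts Pt tmin]] := IHs H.
have [[Pa lt]|ng] := pselect (P a /\ f a < f t).
  exists a; split=> // [|t']; first exact: mem_head.
  rewrite inE => /orP[/eqP -> //|t's Pt'].
  by apply: le_trans (ltW lt) _; exact: tmin.
exists t; split=> // [|t']; first by rewrite inE ts orbT.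
rewrite inE => /orP[/eqP -> Pa|]; last exact: tmin.
by rewrite leNgt; apply/negP => lt; apply: ng.
Qed.

(** * Hermite reduction of positive definite forms over the integers *)

Section HermiteReduction.
Variable R : realType.

Definition rposdef n (A : 'M[R]_n) :=
  A^T = A /\ forall y : 'cV[R]_n, y != 0 -> 0 < (y^T *m A *m y) 0 0.

Lemma rposdefE n (A : 'M[R]_n) :
  rposdef A <-> posdef [the {rmorphism R -> R} of idfun] (fun a => 0 < a) A.
Proof.
have id k l (B : 'M[R]_(k, l)) : adjmx [the {rmorphism R -> R} of idfun] B = B^T.
  by rewrite /adjmx map_mx_id.
rewrite /rposdef /posdef id; split=> -[AA Ap]; split=> // y y0.
  by rewrite /hform id; exact: Ap.
by have := Ap y y0; rewrite /hform id.
Qed.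

Lemma rposP (a : R) : 0 < a -> a != 0 /\ exists c, a = idfun c * c.
Proof.
move=> a0; split; first by rewrite gt_eqF.
by exists (Num.sqrt a); rewrite /= -expr2 sqr_sqrtr // ltW.
Qed.

Lemma rcholesky n (A : 'M[R]_n) : rposdef A -> exists g : 'M[R]_n, A = g^T *m g.
Proof.
move=> /rposdefE/(@cholesky _ [the {rmorphism R -> R} of idfun] _ (fun x => erefl) rposP)[g ->]; exists g.
by rewrite /adjmx map_mx_id.
Qed.

Definition rqf n (A : 'M[R]_n) (x : 'cV[R]_n) : R := (x^T *m A *m x) 0 0.

Lemma rqf_gram n (g : 'M[R]_n) x : rqf (g^T *m g) x = \sum_i (g *m x) i 0 ^+ 2.
Proof.
rewrite /rqf -!mulmxA mulmxA -trmx_mul mxE.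
by apply: eq_bigr => i _; rewrite mxE expr2.
Qed.

Lemma rposdef_discrete n (A : 'M[R]_n) (B : R) : rposdef A ->
  exists s : seq 'cV[int]_n, forall x, rqf A (map_mx intr x) <= B -> x \in s.
Proof.
move=> pA; have [g gE] := rcholesky pA.
have ug : g \in unitmx.
  rewrite -unitmx_tr unitmxE unitfE; apply/negP => /det0P[y y0 gy].
  have : y^T != 0 by rewrite -trmx0 (inj_eq trmx_inj).
  by move/pA.2; rewrite gE trmxK mulmxA gy !mul0mx mxE ltxx.
pose h := invmx g.
have [s sP] := int_vec_bounded (fun i : 'I_n => 2 ^+ n * (\sum_j h i j ^+ 2) * B).
exists s => x xB; apply: sP => i.
pose z : 'cV[R]_n := g *m map_mx intr x.
have xi : (x i 0)%:~R = \sum_j h i j * z j 0.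
  have E : h *m z = map_mx intr x by rewrite /z mulmxA mulVmx // mul1mx.
  by move/colP: E => /(_ i); rewrite [LHS]mxE [RHS]mxE => <-.
rewrite -N2_real xi rmorph_sum; apply: le_trans (N2_sum _) _; rewrite card_ord.
rewrite -mulrA ler_pM2l ?exprn_gt0 // mulr_suml; apply: ler_sum => j _.
rewrite N2_real exprMn ler_wpM2l ?sqr_ge0 //; apply: le_trans xB.
rewrite gE rqf_gram (bigD1 j) //= lerDl; apply: sumr_ge0 => k _; exact: sqr_ge0.
Qed.

Lemma rqfZ n (A : 'M[R]_n) k (x : 'cV[R]_n) : rqf A (k *: x) = k ^+ 2 * rqf A x.
Proof.
have E : (k *: x)^T = k *: x^T by apply/matrixP => i j; rewrite !mxE.
by rewrite /rqf E -scalemxAr -!scalemxAl scalerA mxE expr2.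
Qed.

Lemma minimal_vector n (A : 'M[R]_n.+1) : rposdef A ->
  exists u : 'cV[int]_n.+1, u != 0 /\
    forall w : 'cV[int]_n.+1, w != 0 -> rqf A (map_mx intr u) <= rqf A (map_mx intr w).
Proof.
move=> pA; pose e : 'cV[int]_n.+1 := delta_mx 0 0.
have e0 : e != 0 by apply/cV0Pn; exists 0; rewrite mxE !eqxx oner_eq0.
have [s sP] := rposdef_discrete (rqf A (map_mx intr e)) pA.
have [u [us u0 umin]] := finite_min (fun x => rqf A (map_mx intr x)) (P := fun x => x != 0) (sP e (lexx _)) e0.
exists u; split=> // w w0.
have [we|/ltW ew] := leP (rqf A (map_mx intr w)) (rqf A (map_mx intr e)).
  by apply: umin => //; exact: sP.
by apply: le_trans ew; apply: umin => //; exact: sP.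
Qed.

(** Smith's form of the single column u writes it as k times the first column of a unimodular V. As
    k^2 >= 1, that column is minimal too, so primitivity of u need not be discussed. *)
Lemma minimal_vector_basis n (A : 'M[R]_n.+1) : rposdef A ->
  exists2 V : 'M[int]_n.+1, V \in unitmx &
    forall w : 'cV[int]_n.+1, w != 0 ->
      rqf A (map_mx intr (col 0 V)) <= rqf A (map_mx intr w).
Proof.
move=> pA; have [u [u0 umin]] := minimal_vector pA.
have [V uV [W uW [d _ uE]]] := int_Smith_normal_form u.
exists V => // w w0; apply: le_trans (umin w w0).
pose k := d`_0 * W 0 0.
have {}uE : u = k *: col 0 V.
  rewrite uE; apply/colP => i; rewrite !mxE big_ord_recl big_ord0 addr0 !mxE.
  rewrite big_ord_recl big1 => [|j _]; last by rewrite !mxE mulr0n mulr0.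
  by rewrite !mxE mulr1n addr0 /k; ring.
have k0 : k != 0 by apply: contra u0 => /eqP k0; rewrite uE k0 scale0r.
rewrite uE; have -> : map_mx intr (k *: col 0 V) = k%:~R *: map_mx intr (col 0 V) :> 'cV[R]_n.+1.
  by apply/colP => i; rewrite !mxE rmorphM.
rewrite rqfZ ler_peMl //.
  by have [g ->] := rcholesky pA; rewrite rqf_gram; apply: sumr_ge0 => i _; exact: sqr_ge0.
by rewrite -rmorphXn /= ler1z -gtz0_ge1 exprn_even_gt0.
Qed.

Lemma rposdef_split n (A : 'M[R]_(1 + n)) : rposdef A -> exists (a : R) r D,
  [/\ A = (block_mx 1%:M r 0 1%:M)^T *m block_mx a%:M 0 0 D *m block_mx 1%:M r 0 1%:M,
      0 < a, rposdef D & \det A = a * \det D].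
Proof.
move=> /rposdefE/(@posdef_split _ [the {rmorphism R -> R} of idfun] _ (fun x => erefl) rposP)[a [r [D [-> a0 /rposdefE pD]]]].
exists a, r, D; split=> //; rewrite /adjmx map_mx_id //.
by rewrite !det_mulmx det_tr !det_ublock !det1 !mul1r mulr1 det_scalar1.
Qed.

Lemma rqf_conj n (A P : 'M[R]_n) x : rqf (P^T *m A *m P) x = rqf A (P *m x).
Proof. by rewrite /rqf trmx_mul !mulmxA. Qed.

Lemma rqf_block n a (D : 'M[R]_n) (x : 'cV_1) y :
  rqf (block_mx a%:M 0 0 D) (col_mx x y) = a * x 0 0 ^+ 2 + rqf D y.
Proof.
rewrite /rqf tr_col_mx mul_row_block !mulmx0 addr0 add0r mul_row_col mxE; congr (_ + _).
by rewrite mul_mx_scalar -scalemxAl !mxE big_ord_recl big_ord0 addr0 mxE expr2.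
Qed.

Lemma rposdef_conj n (A P : 'M[R]_n) : rposdef A -> P \in unitmx ->
  rposdef (P^T *m A *m P).
Proof.
move=> [AA Ap] uP; split=> [|y y0]; first by rewrite !trmx_mul trmxK AA mulmxA.
have := rqf_conj A P y; rewrite /rqf => ->; apply: Ap; apply: contra y0 => /eqP Py.
by rewrite -(mulKmx uP y) Py mulmx0.
Qed.

Lemma det_unit_int n (V : 'M[int]_n) : V \in unitmx -> \det V ^+ 2 = 1.
Proof.
rewrite unitmxE => uV; have /orP[/eqP ->|/eqP ->] : (\det V == 1) || (\det V == -1) by [].
  by rewrite expr1n.
by rewrite sqrrN expr1n.
Qed.

Lemma unit_int_real n (V : 'M[int]_n) : V \in unitmx -> map_mx intr V \in @unitmx R n.
Proof.
move=> uV; rewrite unitmxE det_map_mx unitfE intr_eq0.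
by apply: contraTneq (oner_neq0 int) => d0; rewrite -(det_unit_int uV) d0 expr0n eqxx.
Qed.

Lemma col_unit_neq0 n (U : 'M[int]_n) i : U \in unitmx -> col i U != 0.
Proof.
move=> uU; apply/eqP => Ui; have : delta_mx i 0 = 0 :> 'cV[int]_n.
  by rewrite -(mulKmx uU (delta_mx i 0)) -colE Ui mulmx0.
by move/colP/(_ i); rewrite !mxE !eqxx => /eqP; rewrite oner_eq0.
Qed.

(** Start a basis with a minimal vector, of value a, and reduce the Schur complement D by induction.
    Lifting the reduced basis of D with rounded first coordinates costs a factor 4/3 per vector. *)
Lemma hermite_reduction n : exists2 C : R, 0 < C & forall A : 'M[R]_n, rposdef A ->
  exists2 U : 'M[int]_n, U \in unitmx &
    \prod_i (rqf A (map_mx intr (col i U))) <= C * \det A.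
Proof.
elim: n => [|n [C C0 IHn]].
  exists 1 => // A _; exists 1%:M; first exact: unitmx1.
  by rewrite big_ord0 det_mx00 mulr1.
exists ((4 / 3) ^+ n * C); first by rewrite mulr_gt0 // exprn_gt0 // divr_gt0.
move=> A pA; have [V uV Vmin] := minimal_vector_basis pA.
pose VR : 'M[R]_n.+1 := map_mx intr V.
have uVR : VR \in unitmx by exact: unit_int_real.
have pA1 : @rposdef (1 + n) (VR^T *m A *m VR) by exact: rposdef_conj.
have dA1 : \det (VR^T *m A *m VR) = \det A.
  rewrite !det_mulmx det_tr mulrAC -expr2 /VR det_map_mx -rmorphXn /=.
  by rewrite det_unit_int // mul1r.
have [a [r [D [A1E a0 pD dA1D]]]] := rposdef_split pA1.
have dA : \det A = a * \det D by rewrite -dA1.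
have [U' uU' U'D] := IHn D pD.
pose s i : R := (r *m map_mx intr U') 0 i.
(* Rounding to the nearest integer: [t + s] has absolute value at most 1/2. *)
pose t : 'rV[int]_n := \row_i - Num.floor (s i + 2^-1).
have ts i : ((t 0 i)%:~R + s i) ^+ 2 <= 4^-1.
  rewrite mxE rmorphN /= addrC; set f := Num.floor _.
  have f1 : f%:~R <= s i + 2^-1 by exact: floor_le_tmp.
  have f2 : s i + 2^-1 < f%:~R + 1 by rewrite -intrD1; exact: floorD1_gt.
  move: (s i) (f%:~R) f1 f2 => p q f1 f2.
  by nra.
pose W : 'M[int]_(1 + n) := block_mx 1%:M t 0 U'.
have uW : W \in unitmx by rewrite unitmxE det_ublock det1 mul1r -unitmxE.
have uVW : (V : 'M[int]_(1 + n)) *m W \in unitmx by rewrite unitmx_mul uV.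
have rqf_col i : rqf A (map_mx intr (col i ((V : 'M[int]_(1 + n)) *m W))) =
    rqf (block_mx a%:M 0 0 D) (block_mx 1%:M r 0 1%:M *m map_mx intr (col i W)).
  by rewrite -rqf_conj -A1E rqf_conj /VR -map_mxM !colE mulmxA.
have W0 : col (lshift n 0) W = delta_mx (lshift n 0) 0.
  apply/colP => k; case: (split_ordP k) => k' ->;
  by rewrite [LHS]mxE ?block_mxEul ?block_mxEdl !mxE ?eq_lshift ?eq_rlshift ?ord1.
have VW0 : col (lshift n 0) ((V : 'M[int]_(1 + n)) *m W) = col 0 V.
  rewrite colE -mulmxA -colE W0 -colE; congr (col _ V).
  exact: val_inj.
have rE (w : 'cV[int]_n) : (r *m map_mx intr w) 0 0 = \sum_j r 0 j * (w j 0)%:~R.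
  by rewrite mxE; apply: eq_bigr => j _; rewrite mxE.
have col0 : rqf A (map_mx intr (col (lshift n 0) ((V : 'M[int]_(1 + n)) *m W))) = a.
  rewrite rqf_col.
  have -> : map_mx intr (col (lshift n 0) W) = col_mx 1%:M 0 :> 'cV[R]_(1 + n).
    rewrite W0; apply/colP => k; case: (split_ordP k) => k' ->;
    by rewrite ?col_mxEu ?col_mxEd !mxE ?eq_lshift ?eq_rlshift ?ord1.
  rewrite mul_block_col !mul1mx !mulmx0 mul0mx !addr0 rqf_block !mxE mulr1n expr1n mulr1.
  by rewrite /rqf mulmx0 mxE addr0.
have coli i : rqf A (map_mx intr (col (rshift 1 i) ((V : 'M[int]_(1 + n)) *m W))) =
    a * ((t 0 i)%:~R + s i) ^+ 2 + rqf D (map_mx intr (col i U')).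
  rewrite rqf_col.
  have -> : map_mx intr (col (rshift 1 i) W) =
      col_mx ((t 0 i)%:~R)%:M (map_mx intr (col i U')) :> 'cV[R]_(1 + n).
    apply/colP => k; case: (split_ordP k) => k' ->.
      rewrite col_mxEu [LHS]mxE [RHS]mxE !ord1 mulr1n; congr (_%:~R).
      by rewrite mxE /W block_mxEur.
    by rewrite col_mxEd [LHS]mxE [RHS]mxE; congr (_%:~R); rewrite [LHS]mxE [RHS]mxE /W block_mxEdr.
  rewrite mul_block_col !mul1mx mul0mx add0r rqf_block mxE rE mxE mulr1n.
  by congr (a * (_ + _) ^+ 2 + _); rewrite /s mxE; apply: eq_bigr => j _; rewrite !mxE.
(* Each lifted vector has value a q + d with q <= 1/4, and minimality gives a <= a q + d. Hence a <=
   4 d / 3, and the value is at most a / 4 + d <= 4 d / 3. *)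
have amin i : a <= rqf A (map_mx intr (col (rshift 1 i) ((V : 'M[int]_(1 + n)) *m W))).
  by rewrite -{1}col0 VW0; apply: Vmin; exact: col_unit_neq0.
exists ((V : 'M[int]_(1 + n)) *m W) => //.
have prodE (G : 'I_(1 + n) -> R) : \prod_(i < n.+1) G i = G (lshift n 0) * \prod_i G (rshift 1 i).
  rewrite big_ord_recl; congr (G _ * _); first exact: val_inj.
  by apply: eq_bigr => i _; congr G; exact: val_inj.
rewrite (prodE (fun i => rqf A (map_mx intr (col i ((V : 'M[int]_(1 + n)) *m W))))).
rewrite col0 dA mulrCA ler_pM2l // -mulrA.
apply: le_trans (_ : \prod_i (4 / 3 * rqf D (map_mx intr (col i U'))) <= _).
  apply: ler_prod => i _; apply/andP; split; first by apply: le_trans (amin i); exact: ltW.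
  have := amin i; rewrite coli; have := ts i; move: (rqf D _) (_ ^+ 2) => d q q4 ad.
  by nra.
by rewrite big_split /= prodr_const card_ord ler_pM2l // exprn_gt0 // divr_gt0.
Qed.

End HermiteReduction.

Section Minkowski.
Variable R : realType.
Local Notation C := R[i].
Local Notation rc := (real_complex R).

(** Conjugation permutes the rows of W, so the Gram matrix of its columns is real and positive
    definite, of determinant the squared modulus of [\det W]; Hermite's bound over the integers
    applies to it. *)
Lemma lattice_reduction n : exists2 c : R, 0 < c & forall (W : 'M[C]_n) (rho : 'I_n -> 'I_n),
  involutive rho -> (forall k i, W (rho k) i = conjc (W k i)) -> \det W != 0 ->
  exists2 U : 'M[int]_n, U \in unitmx &
    \prod_i (\sum_k N2 ((W *m map_mx intr (col i U)) k 0)) <= c * N2 (\det W).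
Proof.
have [c c0 H] := hermite_reduction R n; exists c => // W rho rhoK Wrho dW.
pose G : 'M[R]_n := \matrix_(i, j) complex.Re (\sum_k conjc (W k i) * W k j).
pose aW : 'M[C]_n := (map_mx conjc W)^T.
have GW : map_mx rc G = aW *m W.
  apply/matrixP => i j; rewrite !mxE.
  have -> : \sum_k aW i k * W k j = \sum_k conjc (W k i) * W k j.
    by apply: eq_bigr => k _; rewrite !mxE.
  set z := \sum_k _; rewrite -[RHS]RRe_real //.
  have zz : conjc z = z.
    rewrite /z rmorph_sum (reindex_inj (inv_inj rhoK)) /=; apply: eq_bigr => k _.
    by rewrite !Wrho rmorphM /= !conjcK.
  move: zz; case: (z) => a b [] /eqP; rewrite -subr_eq0 -opprD oppr_eq0 -mulr2n mulrn_eq0 /=.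
  by rewrite complex_real.
have dG : \det G = N2 (\det W).
  apply: (@complexI R); rewrite -[LHS]det_map_mx GW det_mulmx det_tr det_map_mx.
  exact: N2E.
have qG (x : 'cV[R]_n) : rqf G x = \sum_k N2 ((W *m map_mx rc x) k 0).
  apply: (@complexI R); have -> : (rqf G x)%:C%C = ((map_mx rc x)^T *m map_mx rc G *m map_mx rc x) 0 0.
    by rewrite map_trmx -!map_mxM [RHS]mxE.
  rewrite GW mulmxA -mulmxA.
  have -> : (map_mx rc x)^T *m aW = (map_mx conjc (W *m map_mx rc x))^T.
    rewrite map_mxM trmx_mul; congr (_ *m _); apply/matrixP => i j; rewrite !mxE.
    exact: esym (conjc_real _).
  rewrite mxE rmorph_sum; apply: eq_bigr => k _; rewrite [X in X * _]mxE [X in X * _]mxE.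
  by rewrite N2E.
have pG : rposdef G.
  split=> [|y y0].
    apply/matrixP => i j; rewrite !mxE !raddf_sum; apply: eq_bigr => k _.
    by case: (W k i) (W k j) => a b [a' b'] /=; ring.
  have -> : (y^T *m G *m y) 0 0 = rqf G y by [].
  rewrite qG; have : W *m map_mx rc y != 0.
    apply: contra y0 => /eqP Wy; have uW : W \in unitmx by rewrite unitmxE unitfE.
    have : map_mx rc y = 0 by rewrite -(mulKmx uW (map_mx rc y)) Wy mulmx0.
    by move/eqP; rewrite map_mx_eq0.
  move=> /cV0Pn[k zk]; rewrite (bigD1 k) //= ltr_pwDl ?N2_gt0 //.
  by apply: sumr_ge0 => i _; exact: N2_ge0.
have [U uU UG] := H G pG; exists U => //.
rewrite -dG; apply: le_trans UG; apply: ler_prod => i _; apply/andP; split.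
  by apply: sumr_ge0 => k _; exact: N2_ge0.
rewrite qG -map_mx_comp; apply: ler_sum => k _; set z := map_mx _ _; set z' := map_mx _ _.
have -> : z = z' by apply/matrixP => a b; rewrite !mxE /= rmorph_int.
by [].
Qed.

End Minkowski.

(** * The function Phi and its minima *)

Section Families.
Variables (R : realType) (K : fieldExtType rat) (E : embeddings R K) (n : nat).
Local Notation C := R[i].
Local Notation m := (\dim {:K}).
Local Notation J := ('I_(nreal E) + ('I_(ncomplex E) + 'I_(ncomplex E)))%type.
Implicit Types (h : J -> 'M[C]_n) (x y : 'cV[K]_n).

Definition Qf h k x : R := \sum_i N2 ((h k *m map_mx (emb k) x) i 0).

Definition conj_family h := forall k, h (bar k) = map_mx conjc (h k).

(* A complex place contributes through both of its embeddings; the finite part is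
   N<x>^-2 when x is integral, by PV_nv. *)
Definition Phi h x : R := (\prod_k Qf h k x) * PV (fun v => nv R v x) ^+ 2.

Lemma Qf_ge0 h k x : 0 <= Qf h k x.
Proof. by apply: sumr_ge0 => i _; exact: N2_ge0. Qed.

Lemma Qf_gt0 h k x : \det (h k) != 0 -> x != 0 -> 0 < Qf h k x.
Proof.
move=> dh x0; have : h k *m map_mx (emb k) x != 0.
  apply: contra x0 => /eqP hx; have uh : h k \in unitmx by rewrite unitmxE unitfE.
  have : map_mx (emb k) x = 0 by rewrite -(mulKmx uh (map_mx _ x)) hx mulmx0.
  by move/eqP; rewrite map_mx_eq0.
move=> /cV0Pn[i zi]; rewrite /Qf (bigD1 i) //= ltr_pwDl ?N2_gt0 //.
by apply: sumr_ge0 => j _; exact: N2_ge0.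
Qed.

Lemma Qf_bar h k x : conj_family h -> Qf h (bar k) x = Qf h k x.
Proof.
move=> hc; apply: eq_bigr => i _; rewrite hc -[RHS]N2_conj !mxE rmorph_sum.
congr N2; apply: eq_bigr => j _; rewrite !mxE rmorphM /=; congr (_ * _).
exact: emb_bar.
Qed.

Lemma QfZ h k a x : Qf h k (a *: x) = N2 (emb k a) * Qf h k x.
Proof.
rewrite /Qf mulr_sumr; apply: eq_bigr => i _; rewrite -N2M; congr N2.
by rewrite map_mxZ -scalemxAr mxE.
Qed.

Lemma PhiZ h a x : a != 0 -> x != 0 -> Phi h (a *: x) = Phi h x.
Proof.
move=> a0 x0; rewrite /Phi; under eq_bigr => k _ do rewrite QfZ.
rewrite big_split /=.
have -> : (fun v => nv R v (a *: x)) = (fun v => absK R v a * nv R v x).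
  by apply/funext => v; rewrite nvZ.
have [_ ->] := PV_M (finsupp1_abs R a0) (finsupp1_nv R x0).
by rewrite exprMn mulrACA [X in X * _]mulrC product_formula // mul1r.
Qed.

Lemma PV_nv_gt0 x : x != 0 -> 0 < PV (fun v => nv R v x).
Proof. by move=> x0; apply: PV_gt0 => [|v]; [exact: finsupp1_nv|exact: nv_gt0]. Qed.

Lemma Phi_gt0 h x : (forall k, \det (h k) != 0) -> x != 0 -> 0 < Phi h x.
Proof.
move=> dh x0; rewrite mulr_gt0 ?exprn_gt0 ?PV_nv_gt0 //.
by apply: prodr_gt0 => k _; exact: Qf_gt0.
Qed.

Lemma Phi_le_prod h x : OKvec x -> x != 0 -> Phi h x <= \prod_k Qf h k x.
Proof.
move=> Ox x0; rewrite ler_piMr //; first by apply: prodr_ge0 => k _; exact: Qf_ge0.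
have [_ ->] := PV_nv R Ox x0.
rewrite exprn_ile1 ?invr_ge0 ?ler0n // invf_le1 ?ltr0n ?ler1n ideal_norm_gt0 //;
by exact: coord_ideal_nz.
Qed.

(* The lattice {a in K | a x in OK^n} is the inverse of the ideal of x. *)
Lemma inverse_lattice x (b : m.-tuple K) : x != 0 -> Zbasis (@OK K) b ->
  exists2 c : m.-tuple K, Zbasis [set a | OKvec (a *: x)] c &
    covol2 E c = PV (fun v => nv R v x) ^+ 2 * covol2 E b.
Proof.
move=> x0 bZ; have /cV0Pn[i0 xi0] := x0; pose a := x i0 0.
(* The lattice multiplied by the nonzero coordinate a of x: an ideal inside OK, because multiplying
   x by y / a puts y itself in position i0. Its local norms are those of a divided by those of x. *)
pose I : set K := [set y | OKvec ((y / a) *: x)].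
have [N N0 ON] := common_denominator x.
have Nz : N%:R != 0 :> K by rewrite natK_eq0 -lt0n.
have iI : nzideal I.
  split=> [y /(_ i0)|y z Iy Iz i|t y Ot Iy i|].
  - by rewrite mxE divfK.
  - by have := OKB (Iy i) (Iz i); rewrite !mxE -mulrBl -mulrBl.
  - by have := OKM Ot (Iy i); rewrite !mxE !mulrA.
  - by exists (N%:R * a); rewrite ?mulf_neq0 // /I /= mulfK.
pose t v : R := absK R v a / nv R v x.
have tP v : is_lnorm v I (t v).
  split=> [y Iy|].
    have [i iE] := nv_attained R v x0.
    rewrite /t ler_pdivlMr ?nv_gt0 // iE -absKM.
    have : absK R v (y / a * x i 0) <= 1 by have := absK_OK R v (Iy i); rewrite mxE.
    have -> : absK R v (y / a * x i 0) = absK R v (y * x i 0) / absK R v a.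
      by rewrite mulrAC (absKM R v (_ * _)) absKV.
    by rewrite ler_pdivrMr ?mul1r ?absK_gt0.
  have [i iE] := nv_attained R v x0.
  have xi : x i 0 != 0 by rewrite -(absK_eq0 R v) -iE gt_eqF // nv_gt0.
  (* Divided by a coordinate of maximal v-value, all coordinates are v-integral. The product of
     their denominators outside v has v-value 1 and carries [a / x i 0] into I, where it attains the
     expected norm. *)
  have hl j : exists s, [/\ OK s, ~ val v s & OK (s * (x j 0 / x i 0))].
    have /absK_le1[p [q [Op Oq nq ->]]] : absK R v (x j 0 / x i 0) <= 1.
      by rewrite absKM absKV ler_pdivrMr ?mul1r -iE ?le_nv ?nv_gt0.
    by exists q; split=> //; rewrite mulrC divfK // (notv_neq0 nq).
  pose s j := sval (cid (hl j)).
  have Os j : OK (s j) by have [] := svalP (cid (hl j)).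
  have ns j : ~ val v (s j) by have [] := svalP (cid (hl j)).
  have Osx j : OK (s j * (x j 0 / x i 0)) by have [] := svalP (cid (hl j)).
  exists ((\prod_j s j) * (a / x i 0)).
    move=> j; rewrite mxE (bigD1 j) //=; set w := \prod_(_ | _) _.
    have -> : s j * w * (a / x i 0) / a * x j 0 = w * (s j * (x j 0 / x i 0)).
      by field; rewrite xi.
    by apply: OKM => //; apply: OK_prod => l _; exact: Os.
  rewrite absKM (absK_notP R (OK_prod _ _)) ?mul1r //; last exact: fp_not_prod.
  by rewrite absKM absKV /t iE.
have [_ tN] := PV_lnorm iI tP.
have [c' c'Z] := nzideal_Zbasis iI.
have ia0 : a^-1 != 0 by rewrite invr_eq0.
exists [tuple a^-1 * c'`_i | i < m].
  apply: (Zbasis_scale c'Z) => // y /=.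
  by rewrite /I /= mulrC.
have -> : covol2 E [tuple a^-1 * c'`_i | i < m] = \prod_(k : J) N2 (emb k a^-1) * covol2 E c'.
  by apply: covol2_scale => i; rewrite nth_mktuple.
rewrite (covol2_ideal E iI bZ c'Z) mulrA; congr (_ * _).
have [fa PVa] := PV_M (finsupp1_abs R ia0) (finsupp1_nv R x0).
have tE : PV t * PV (fun v => absK R v a^-1 * nv R v x) = 1.
  have ft : finsupp1 t by have [] := PV_lnorm iI tP.
  have [_ <-] := PV_M ft fa.
  rewrite (@PVE _ _ [::]) ?big_nil // => v.
  suff -> : t v * (absK R v a^-1 * nv R v x) = 1 by rewrite eqxx.
  rewrite /t absKV; field.
  by apply/andP; split; rewrite gt_eqF ?nv_gt0 ?absK_gt0.
have NE : (ideal_norm I)%:R = PV (fun v => absK R v a^-1) * PV (fun v => nv R v x) :> R.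
  rewrite -PVa -[LHS]invrK -tN; apply: (mulfI (x := PV t)).
    by rewrite tN invr_eq0 pnatr_eq0 -lt0n ideal_norm_gt0.
  by rewrite tE divff // tN invr_eq0 pnatr_eq0 -lt0n ideal_norm_gt0.
by rewrite NE exprMn mulrA [X in X * _]mulrC product_formula // mul1r.
Qed.

(** The lattice of multipliers is reduced for the metric weighted by the [Qf h k x]. Its determinant
    is [Phi h x] up to a constant depending on K only, which makes the bound uniform in h and x. *)
Lemma small_multiple : exists2 c : R, 0 < c & forall h x, conj_family h ->
  (forall k, \det (h k) != 0) -> x != 0 ->
  exists a, [/\ a != 0, OKvec (a *: x) &
    forall k, Qf h k (a *: x) <= Num.max 1 (c * Phi h x)].
Proof.
have [b bZ] := nzideal_Zbasis (nzideal_OK K).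
have [c c0 H] := lattice_reduction R m.
exists (c * covol2 E b); first by rewrite mulr_gt0 // covol2_gt0 // bZ.1.
move=> h x hc dh x0; have [e eZ eV] := inverse_lattice x0 bZ.
(* With this weight on row k, the squared length of the column of a multiplier a is the sum of the
   [Qf h k (a *: x)]. *)
pose s k := Num.sqrt (Qf h k x).
have s2 k : s k ^+ 2 = Qf h k x by rewrite sqr_sqrtr // Qf_ge0.
pose W : 'M[C]_m := \matrix_(k, i) ((s (embi E k))%:C%C * emb (embi E k) e`_i).
pose rho (k : 'I_m) : 'I_m := iemb (bar (embi E k)).
have rhoK : involutive rho by move=> k; rewrite /rho iembK barK embiK.
have Wrho k i : W (rho k) i = conjc (W k i).
  rewrite !mxE iembK rmorphM; congr (_ * _); last exact: emb_bar.
  by rewrite /s Qf_bar //; exact: esym (conjc_real _).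
have WE : W = diag_mx (\row_k (s (embi E k))%:C%C) *m emb_mx E e.
  by apply/matrixP => k i; rewrite mul_diag_mx !mxE.
have dW : N2 (\det W) = covol2 E b * Phi h x.
  rewrite WE det_mulmx det_diag N2M N2_prod -/(covol2 E e) eV /Phi mulrA [RHS]mulrC.
  congr (_ * _ * _); rewrite prod_emb; apply: eq_bigr => k _.
  by rewrite mxE N2_real s2.
have dW0 : \det W != 0.
  by rewrite -N2_eq0 dW mulf_neq0 // gt_eqF ?Phi_gt0 ?covol2_gt0 ?bZ.1.
have [U uU Uprod] := H W rho rhoK Wrho dW0.
pose a i := \sum_j ((U j i)%:~R : rat) *: e`_j.
have aE i : \sum_k N2 ((W *m map_mx intr (col i U)) k 0) = \sum_k Qf h k (a i *: x).
  rewrite [RHS]sum_emb; apply: eq_bigr => k _; rewrite QfZ -s2 -N2_real -N2M; congr N2.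
  rewrite mulrC /a rmorph_sum mulr_sumr mxE; apply: eq_bigr => j _.
  by rewrite !mxE /= [X in _ = _ * X]emb_rat ratr_int mulrAC mulrA.
rewrite dW mulrA in Uprod.
have ca i j : coord e j (a i) = (U j i)%:~R.
  by rewrite (coord_comb eZ.1 (fun j => (U j i)%:~R)).
have a0 i : a i != 0.
  have := col_unit_neq0 i uU; apply: contra => /eqP ai0; apply/eqP/colP => j.
  by have := ca i j; rewrite ai0 linear0 !mxE => /esym/eqP; rewrite intr_eq0 => /eqP.
have Oa i : OKvec (a i *: x).
  by apply/(eZ.2 (a i)) => j; rewrite ca rpred_int.
set X := c * covol2 E b * Phi h x in Uprod *.
(* The product of the m >= 1 sums is at most X, so they cannot all exceed both 1 and X. *)
have [i iX] : exists i, \sum_k Qf h k (a i *: x) <= Num.max 1 X.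
  apply: contrapT => /forallNP nH.
  have lt i : Num.max 1 X < \sum_k Qf h k (a i *: x) by rewrite ltNge; apply/negP; exact: nH.
  pose i0 := Ordinal (dimK_gt0 K).
  have : X < \prod_i \sum_k N2 ((W *m map_mx intr (col i U)) k 0); last by rewrite ltNge Uprod.
  rewrite (bigD1 i0) //= aE; apply: lt_le_trans (_ : \sum_k Qf h k (a i0 *: x) <= _).
    by apply: le_lt_trans (lt i0); rewrite le_max lexx orbT.
  rewrite ler_peMr //; first by apply: sumr_ge0 => k _; exact: Qf_ge0.
  apply: (big_ind (fun z => 1 <= z)) => // [y z|i _]; first exact: mulr_ege1.
  by rewrite aE ltW //; apply: le_lt_trans (lt i); rewrite le_max lexx.
exists (a i); split=> // k; apply: le_trans iX; rewrite (bigD1 k) //= lerDl.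
by apply: sumr_ge0 => l _; exact: Qf_ge0.
Qed.

End Families.

(** * Finiteness of short vectors and attainment of the minima *)

Section Minima.
Variables (R : realType) (K : fieldExtType rat) (E : embeddings R K) (n : nat).
Local Notation C := R[i].
Local Notation m := (\dim {:K}).
Local Notation J := ('I_(nreal E) + ('I_(ncomplex E) + 'I_(ncomplex E)))%type.
Implicit Types (h : J -> 'M[C]_n) (x y : 'cV[K]_n).

Lemma northcott_vec (B : R) : exists s : seq 'cV[K]_n, forall x, OKvec x ->
  (forall (k : J) i, N2 (emb k (x i 0)) <= B) -> x \in s.
Proof.
have [s sP] := northcott E B.
exists [seq \col_i val (t i) | t : {ffun 'I_n -> seq_sub s}] => x Ox xB.
have xs i : x i 0 \in s by apply: sP => [|k]; [exact: Ox|exact: xB].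
apply/mapP; exists [ffun i => SeqSub (xs i)]; first by rewrite mem_enum.
by apply/colP => i; rewrite mxE ffunE.
Qed.

Lemma N2_mulmx (p q r : nat) (A : 'M[C]_(p, q)) (B : 'M[C]_(q, r)) i j :
  N2 ((A *m B) i j) <= 2 ^+ q * \sum_k N2 (A i k) * N2 (B k j).
Proof.
rewrite mxE (le_trans (N2_sum _)) // card_ord ler_wpM2l ?exprn_ge0 //.
by apply: ler_sum => k _; rewrite N2M.
Qed.

Lemma Qf_entry h k : \det (h k) != 0 -> exists2 c : R, 0 <= c &
  forall x i, N2 (emb k (x i 0)) <= c * Qf h k x.
Proof.
move=> dh; have uh : h k \in unitmx by rewrite unitmxE unitfE.
exists (2 ^+ n * \sum_i \sum_j N2 (invmx (h k) i j)) => [|x i].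
  by rewrite mulr_ge0 ?exprn_ge0 // !sumr_ge0 // => i _; rewrite sumr_ge0 // => j _; exact: N2_ge0.
have -> : emb k (x i 0) = (invmx (h k) *m (h k *m map_mx (emb k) x)) i 0.
  by rewrite mulKmx // mxE.
rewrite (le_trans (N2_mulmx _ _ _ _)) // -mulrA ler_wpM2l ?exprn_ge0 //.
rewrite [X in X * _](bigD1 i) //= mulrDl ler_wpDr //.
  rewrite mulr_ge0 ?Qf_ge0 //; apply: sumr_ge0 => j _.
  by apply: sumr_ge0 => l _; exact: N2_ge0.
rewrite mulr_suml; apply: ler_sum => j _; rewrite ler_wpM2l ?N2_ge0 //.
by rewrite /Qf (bigD1 j) //= lerDl sumr_ge0 // => l _; exact: N2_ge0.
Qed.

Lemma Qf_finite h B : (forall k, \det (h k) != 0) -> exists s : seq 'cV[K]_n,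
  forall x, OKvec x -> (forall k, Qf h k x <= B) -> x \in s.
Proof.
move=> dh; have H k := cid2 (Qf_entry (dh k)).
pose c k : R := s2val (H k).
have c0 k : 0 <= c k by exact: (s2valP (H k)).
have cP k : forall x i, N2 (emb k (x i 0)) <= c k * Qf h k x by exact: (s2valP' (H k)).
have [s sP] := northcott_vec (\sum_k c k * B).
exists s => x Ox xB; apply: sP => // k i.
apply: le_trans (cP k x i) _.
rewrite (le_trans (ler_wpM2l (c0 k) (xB k))) // (bigD1 k) //= lerDl.
apply: sumr_ge0 => l _; rewrite mulr_ge0 //.
by apply: le_trans (xB l); exact: Qf_ge0.
Qed.

Lemma Phi_min h : (0 < n)%N -> conj_family h -> (forall k, \det (h k) != 0) ->
  exists x, [/\ OKvec x, x != 0 & forall y, y != 0 -> Phi h x <= Phi h y].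
Proof.
move=> n0 hc dh; have [c c0 cP] := small_multiple E n.
pose i0 := Ordinal n0; pose x0 : 'cV[K]_n := delta_mx i0 0.
have x00 : x0 != 0.
  by apply/cV0Pn; exists i0; rewrite mxE !eqxx oner_eq0.
have Ox0 : OKvec x0 by move=> i; rewrite mxE; exact: OK_nat.
(* One bound for all competitors: any line where Phi is at most [Phi h x0] has an integral generator
   below B, hence in the finite list s. *)
pose B : R := Num.max 1 (c * Phi h x0).
have [s sP] := Qf_finite B dh.
have key y : y != 0 -> Phi h y <= Phi h x0 -> exists z, [/\ z \in s, OKvec z, z != 0 & Phi h z = Phi h y].
  move=> y0 yx; have [a [a0 Oa aB]] := cP h y hc dh y0.
  exists (a *: y); split=> //; last 2 first.
  - by rewrite scaler_eq0 negb_or a0.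
  - exact: PhiZ.
  apply: sP => // k; apply: le_trans (aB k) _.
  by rewrite /B ge_max !le_max lexx /= ler_pM2l // yx orbT.
have [z0 [z0s Oz0 z00 z0E]] := key x0 x00 (lexx _).
have [z [zs [Oz z0'] zmin]] := @finite_min R _ (Phi h) (fun z => OKvec z /\ z != 0) s z0 z0s (conj Oz0 z00).
exists z; split=> // y y0; have [yx|/ltW xy] := leP (Phi h y) (Phi h x0).
  have [w [ws Ow w0 <-]] := key y y0 yx.
  exact: zmin.
by apply: le_trans xy; rewrite -z0E; apply: zmin.
Qed.

End Minima.

(** * Block diagonal and tensor product matrices *)

Section IndexedMatrices.
Variables (F : fieldType) (T : finType).

Definition fmx (f : T -> T -> F) : 'M[F]_#|T| := \matrix_(p, q) f (enum_val p) (enum_val q).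

Lemma sum_enum_val (f : T -> F) : \sum_(p < #|T|) f (enum_val p) = \sum_t f t.
Proof.
by rewrite -(big_enum_val f). Qed.

Lemma sum_pairs (T' : finType) (f : T * T' -> F) : \sum_p f p = \sum_a \sum_b f (a, b).
Proof. by rewrite pair_bigA; apply: eq_bigr => -[]. Qed.

Lemma fmxM f g : fmx f *m fmx g = fmx (fun p q => \sum_r f p r * g r q).
Proof.
apply/matrixP => p q; rewrite !mxE -sum_enum_val; apply: eq_bigr => r _.
by rewrite !mxE.
Qed.

Lemma fmx1 : fmx (fun p q => (p == q)%:R) = 1%:M.
Proof. by apply/matrixP => p q; rewrite !mxE (inj_eq enum_val_inj). Qed.

End IndexedMatrices.

Section Blocks.
Variables (F : fieldType) (m n : nat).
Local Notation T := ('I_m * 'I_n)%type.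
Implicit Types A B : 'I_m -> 'M[F]_n.

Definition blocks A (p q : T) : F := if p.1 == q.1 then A p.1 p.2 q.2 else 0.

Lemma fmx_blocksM A (g : T -> T -> F) :
  fmx (blocks A) *m fmx g = fmx (fun p q => \sum_j A p.1 p.2 j * g (p.1, j) q).
Proof.
rewrite fmxM; congr fmx; apply/funext => p; apply/funext => q.
rewrite sum_pairs.
rewrite (bigD1 p.1) //= [X in _ + X]big1 ?addr0.
  by apply: eq_bigr => j _; rewrite /blocks eqxx.
move=> k kp; apply: big1 => j _.
by rewrite /blocks /= eq_sym (negbTE kp) mul0r.
Qed.

Lemma blocksM A B : fmx (blocks (fun k => A k *m B k)) = fmx (blocks A) *m fmx (blocks B).
Proof.
rewrite fmx_blocksM; congr fmx; apply/funext => p; apply/funext => q.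
rewrite /blocks; case: eqP => pq; last by rewrite big1 // => j _; rewrite mulr0.
by rewrite mxE.
Qed.

Lemma blocks1 : fmx (blocks (fun=> 1%:M)) = 1%:M.
Proof.
rewrite -fmx1; congr fmx; apply/funext => -[k i]; apply/funext => -[l j].
by rewrite /blocks /= xpair_eqE mxE; case: eqP.
Qed.

(** By [SL_ind]: a transvection placed in one diagonal block is a transvection of the large
    matrix. *)
Lemma det_block k0 (A : 'M[F]_n) : \det A = 1 ->
  \det (fmx (blocks (fun k => if k == k0 then A else 1%:M))) = 1.
Proof.
pose D (A : 'M[F]_n) := fmx (blocks (fun k => if k == k0 then A else 1%:M)).
apply: (SL_ind (P := fun A : 'M[F]_n => \det (D A) = 1)) => [|B B' dB dB'|i j a ij].
- rewrite /D (_ : (fun k => _) = fun=> 1%:M) ?blocks1 ?det1 //.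
  by apply/funext => k; case: ifP.
- rewrite /D (_ : (fun k => _) = fun k => (if k == k0 then B else 1%:M) *m (if k == k0 then B' else 1%:M)).
    by rewrite blocksM det_mulmx dB dB' mulr1.
  by apply/funext => k; case: ifP => // _; rewrite mulmx1.
- rewrite -[RHS](@det_transv F _ (enum_rank (k0, i)) (enum_rank (k0, j)) a); last first.
    by apply: contra ij => /eqP/enum_rank_inj[->].
  congr (\det _); apply/matrixP => p q; rewrite !mxE.
  rewrite -[p]enum_valK -[q]enum_valK !(inj_eq enum_rank_inj) !enum_rankK.
  case: (enum_val p) (enum_val q) => [k i'] [l j'].
  rewrite !xpair_eqE /blocks /=; case: (eqVneq k l) => [<-|kl] /=.
    case: (eqVneq k k0) => kk0; rewrite !mxE /= ?mulr0 ?addr0 //.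
  case: (eqVneq k k0) => [kk0|]; rewrite /= ?mulr0 ?addr0 //.
  by rewrite -kk0 [l == k]eq_sym (negbTE kl) andbF mulr0 addr0.
Qed.

Lemma det_blocks1 A : (forall k, \det (A k) = 1) -> \det (fmx (blocks A)) = 1.
Proof.
move=> dA; have H (s : seq 'I_m) : uniq s ->
    \det (fmx (blocks (fun k => if k \in s then A k else 1%:M))) = 1.
  elim: s => [_|k s IHs /= /andP[ks us]].
    rewrite (_ : (fun k => _) = fun=> 1%:M) ?blocks1 ?det1 //.
  rewrite (_ : (fun _ => _) = fun l => (if l == k then A k else 1%:M) *m (if l \in s then A l else 1%:M)).
    by rewrite blocksM det_mulmx IHs // mulr1 det_block.
  apply/funext => l; rewrite inE; case: eqP => [->|_] /=; last by rewrite mul1mx.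
  by rewrite (negbTE ks) mulmx1.
rewrite -[RHS](H (enum 'I_m)) ?enum_uniq //; congr (\det (fmx (blocks _))).
by apply/funext => k; rewrite mem_enum.
Qed.

(** The matrix is the tensor product of the identity with Q; the same construction on the inverse of
    Q inverts it. *)
Lemma det_tensor1_neq0 (Q : 'M[F]_m) : Q \in unitmx ->
  \det (fmx (fun p q : T => (p.2 == q.2)%:R * Q p.1 q.1)) != 0.
Proof.
move=> uQ; set W := fmx _; pose W' := fmx (fun p q : T => (p.2 == q.2)%:R * invmx Q p.1 q.1).
have WW : W *m W' = 1%:M.
  rewrite fmxM -fmx1; congr fmx; apply/funext => -[k i]; apply/funext => -[l j] /=.
  rewrite sum_pairs /=.
  transitivity ((i == j)%:R * (Q *m invmx Q) k l).
    rewrite mxE mulr_sumr; apply: eq_bigr => a _.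
    rewrite (bigD1 i) //= big1 => [|b bi]; last by rewrite eq_sym (negbTE bi) !mul0r.
    by rewrite eqxx addr0 mul1r mulrCA.
  by rewrite mulmxV // mxE xpair_eqE andbC -natrM mulnb.
apply/negP => /eqP dW; have := congr1 determinant WW.
by rewrite det_mulmx dW mul0r det1 => /esym/eqP; rewrite oner_eq0.
Qed.

End Blocks.

(** * Reduction modulo SL_n(OK) *)

Section IntegralMatrices.
Variables (R : realType) (K : fieldExtType rat) (E : embeddings R K).
Local Notation C := R[i].
Local Notation m := (\dim {:K}).
Local Notation J := ('I_(nreal E) + ('I_(ncomplex E) + 'I_(ncomplex E)))%type.

Lemma N2_det n (A : 'M[C]_n) B : (forall i j, N2 (A i j) <= B) ->
  N2 (\det A) <= 2 ^+ #|{perm 'I_n}| * \sum_(s : {perm 'I_n}) B ^+ n.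
Proof.
move=> AB; rewrite (le_trans (N2_sum _)) // ler_wpM2l ?exprn_ge0 //.
apply: ler_sum => s _; rewrite N2M N2_prod.
have -> : N2 ((-1) ^+ s : C) = 1.
  by rewrite -[N2 _]mul1r; case: (odd_perm s); rewrite ?expr1 ?expr0 /N2 /= ?mul1r; ring.
rewrite mul1r -[n in _ ^+ n]card_ord -prodr_const; apply: ler_prod => i _.
by rewrite N2_ge0 AB.
Qed.

Definition OKmx p q (A : 'M[K]_(p, q)) := forall i j, OK (A i j).

Lemma OKmx_mul p q r (A : 'M[K]_(p, q)) (B : 'M[K]_(q, r)) : OKmx A -> OKmx B -> OKmx (A *m B).
Proof. by move=> OA OB i j; rewrite mxE; apply: OK_sum => k _; apply: OKM. Qed.

Lemma OK_sign (b : bool) : OK ((-1) ^+ b : K).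
Proof. by apply: OKX; apply: OKN; exact: OK1. Qed.

Lemma OK_det n (A : 'M[K]_n) : OKmx A -> OK (\det A).
Proof.
move=> OA; apply: OK_sum => s _; apply: OKM; first exact: OK_sign.
by apply: OK_prod => i _; exact: OA.
Qed.

Lemma OKmx_adj n (A : 'M[K]_n) : OKmx A -> OKmx (\adj A).
Proof.
move=> OA i j; rewrite mxE; apply: OKM; first by apply: OKX; apply: OKN; exact: OK1.
by apply: OK_det => k l; rewrite !mxE; exact: OA.
Qed.

(* X Y^-1 = 1 + (X - Y) adj(Y) / det Y is integral of determinant 1 as soon as
   det X = det Y and X = Y modulo det Y. *)
Lemma finite_classes n (B : R) : exists (I : finType) (Y : I -> 'M[K]_n),
  forall X, OKmx X -> \det X != 0 -> (forall k : J, N2 (emb k (\det X)) <= B) ->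
  exists i, [/\ \det (Y i) != 0, OKmx (X *m invmx (Y i)) & \det (X *m invmx (Y i)) = 1].
Proof.
have [s sP] := northcott E B.
pose s' := [seq d <- s | (d != 0) && `[< OK d >]].
have s'P d : d \in s' -> d != 0 /\ OK d.
  by rewrite mem_filter => /andP[/andP[d0 /asboolP Od] _].
(* [s'] contains every determinant that can occur, and D is a common multiple of them, so congruence
   modulo D implies congruence modulo each determinant. *)
pose D := \prod_(d <- s') d.
have D0 : D != 0 by rewrite prodf_seq_neq0; apply/allP => d /s'P[].
have OD : OK D by rewrite /D big_seq; apply: OK_prod => d /s'P[].
have Ddvd d : d \in s' -> OK (D / d).
  move=> ds; have [d0 _] := s'P d ds.
  rewrite /D (big_rem d) //= mulrC mulKf // big_seq; apply: OK_prod => d' /mem_rem.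
  by case/s'P.
have [T [f [_ _ fP]]] := residues_exist (nzideal_principal OD D0).
pose key := (seq_sub s' * {ffun 'I_n * 'I_n -> T})%type.
pose good (k : key) Y := [/\ OKmx Y, \det Y = val k.1 &
  forall i j, [set D * x | x in @OK K] (Y i j - f (k.2 (i, j)))].
(* For each determinant and residues modulo D, one integral matrix realizing them; the identity if
   there is none, a case that no X meets. *)
pose Y k := if pselect (exists Y, good k Y) is left H then sval (cid H) else 1%:M.
exists key, Y => X OX dX XB.
have Xs : \det X \in s'.
  rewrite mem_filter dX /= sP ?andbT //; last exact: OK_det.
  by apply/asboolP; exact: OK_det.
have h i j := cid (fP _ (OX i j)).
pose k : key := (SeqSub Xs, [ffun p => sval (h p.1 p.2)]).
have gX : good k X.
  by split=> // i j; rewrite ffunE; exact: (svalP (h i j)).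
have [OY dY YX] : good k (Y k).
  by rewrite /Y; case: pselect => [H|[]]; [exact: svalP (cid H)|exists X].
have dY0 : \det (Y k) != 0 by rewrite dY.
have uY : Y k \in unitmx by rewrite unitmxE unitfE.
exists k; split=> //; last first.
  by rewrite det_mulmx det_inv dY divff.
have XE : X *m invmx (Y k) = 1%:M + (X - Y k) *m invmx (Y k).
  by rewrite mulmxBl mulmxV // addrC subrK.
move=> i j; rewrite XE mxE; apply: OKD; first by rewrite mxE; exact: OK_nat.
rewrite mxE; apply: OK_sum => l _; rewrite /invmx uY !mxE.
have [_ _ Xf] := gX.
have [y Oy yE] := Xf i l; have [z Oz zE] := YX i l.
have -> : X i l - Y k i l = D * (y - z).
  by rewrite mulrBr yE zE opprB addrA subrK.
rewrite mulrA; apply: OKM; last by have := OKmx_adj OY l j; rewrite mxE.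
by rewrite dY mulrAC; apply: OKM; [exact: Ddvd|exact: OKB].
Qed.

End IntegralMatrices.

Section Reduction.
Variables (R : realType) (K : fieldExtType rat) (E : embeddings R K) (n : nat).
Local Notation C := R[i].
Local Notation m := (\dim {:K}).
Local Notation J := ('I_(nreal E) + ('I_(ncomplex E) + 'I_(ncomplex E)))%type.
Local Notation T := ('I_m * 'I_n)%type.
Implicit Types (h : J -> 'M[C]_n) (x y : 'cV[K]_n).

(** When all factors are at most 1 their product is at most any single one. A lower bound c for Phi
    thus gives the lower bound min(c, 1) for the sums, the form needed by lattice reduction. *)
Lemma Phi_le_sum h x : OKvec x -> x != 0 -> \sum_k Qf h k x <= 1 ->
  Phi h x <= \sum_k Qf h k x.
Proof.
move=> Ox x0 S1; apply: le_trans (Phi_le_prod h Ox x0) _.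
have QS k : Qf h k x <= \sum_k Qf h k x.
  by rewrite [leRHS](bigD1 k) //= lerDl sumr_ge0 // => l _; exact: Qf_ge0.
pose k0 := embi E (Ordinal (dimK_gt0 K)).
apply: le_trans (QS k0); rewrite (bigD1 k0) //= ler_piMr ?Qf_ge0 //.
rewrite -[leRHS](@big1_eq R 1 *%R _ (index_enum J) (fun k => k != k0)).
by apply: ler_prod => k _; rewrite Qf_ge0 (le_trans (QS k)).
Qed.

(** Reduction of OK^n as a lattice of rank mn. The mn sums have bounded product and none is below c,
    so each is at most the bound divided by [c ^+ (mn - 1)]. The reduced basis spans K^n over K, so
    n of its vectors are independent. *)
Lemma short_columns : exists2 D : R, 0 < D & forall h c, conj_family h ->
  (forall k, \det (h k) = 1) -> 0 < c ->
  (forall x, OKvec x -> x != 0 -> c <= \sum_k Qf h k x) ->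
  exists X : 'M[K]_n, [/\ OKmx X, \det X != 0 &
    forall l, \sum_k Qf h k (col l X) <= D / c ^+ #|{: T}|.-1].
Proof.
have [b bZ] := nzideal_Zbasis (nzideal_OK K).
have [c0 c00 mink] := lattice_reduction R #|{: T}|.
have uQ : emb_mx E b \in unitmx by rewrite unitmxE unitfE emb_mx_unit // bZ.1.
pose W1 : 'M[C]_#|{: T}| := fmx (fun p q : T => (p.2 == q.2)%:R * emb_mx E b p.1 q.1).
have dW1 : \det W1 != 0 by exact: det_tensor1_neq0.
exists (c0 * N2 (\det W1)); first by rewrite mulr_gt0 // N2_gt0.
move=> h c hc dh c_gt0 hx.
(* Columns are indexed by the Z-basis of OK^n made of the products of a basis element of OK and a
   standard vector; rows by an embedding and a coordinate. The blocks h have determinant 1, so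
   [\det W] does not depend on h. *)
pose W : 'M[C]_#|{: T}| :=
  fmx (fun p q : T => h (embi E p.1) p.2 q.2 * emb (embi E p.1) b`_(q.1)).
have WE : W = fmx (blocks (fun k => h (embi E k))) *m W1.
  rewrite fmx_blocksM; congr fmx; apply/funext => p; apply/funext => q.
  rewrite (bigD1 q.2) //= big1 => [|j jq]; last by rewrite (negbTE jq) mul0r mulr0.
  by rewrite eqxx mul1r addr0 mxE.
have dW : \det W = \det W1 by rewrite WE det_mulmx det_blocks1 ?mul1r.
have dW0 : \det W != 0 by rewrite dW.
pose bt (p : T) : T := (iemb (bar (embi E p.1)), p.2).
pose rho (p : 'I_#|{: T}|) : 'I_#|{: T}| := enum_rank (bt (enum_val p)).
have rhoK : involutive rho.
  by move=> p; rewrite /rho enum_rankK /bt /= iembK barK embiK -surjective_pairing enum_valK.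
have Wrho p q : W (rho p) q = conjc (W p q).
  rewrite !mxE /rho enum_rankK /= iembK hc mxE rmorphM; congr (_ * _).
  exact: emb_bar.
have [U uU UW] := mink W rho rhoK Wrho dW0.
pose Bm : 'M[K]_(n, #|{: T}|) :=
  \matrix_(l < n, q < #|{: T}|) ((l == (enum_val q).2)%:R * b`_((enum_val q).1)).
pose F := Bm *m map_mx intr U.
have OF : OKmx F.
  apply: OKmx_mul => i j; rewrite mxE; last exact: OK_int.
  by apply: OKM; [exact: OK_nat|exact: (Zbasis_mem _ bZ)].
have WF p k i : (W *m map_mx intr (col p U)) (enum_rank (k, i)) 0 =
    (h (embi E k) *m map_mx (emb (embi E k)) (col p F)) i 0.
  rewrite !mxE.
  transitivity (\sum_l \sum_(q < #|{: T}|) (h (embi E k) i l * ((l == (enum_val q).2)%:R *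
      emb (embi E k) b`_((enum_val q).1) * (U q p)%:~R))).
    rewrite exchange_big; apply: eq_bigr => q _.
    rewrite (bigD1 (enum_val q).2) //= big1 => [|l lq]; last by rewrite (negbTE lq) !mul0r mulr0.
    by rewrite !mxE enum_rankK eqxx mul1r addr0 mulrA.
  apply: eq_bigr => l _; rewrite !mxE rmorph_sum mulr_sumr; apply: eq_bigr => q _.
  by rewrite !mxE !rmorphM rmorph_int rmorph_nat.
pose S p := \sum_k Qf h k (col p F).
have SW p : \sum_q N2 ((W *m map_mx intr (col p U)) q 0) = S p.
  rewrite /S sum_emb.
  rewrite (eq_bigr (fun q => N2 ((W *m map_mx intr (col p U)) (enum_rank (enum_val q)) 0))); last first.
    by move=> q _; rewrite enum_valK.
  rewrite (sum_enum_val (fun t => N2 ((W *m map_mx intr (col p U)) (enum_rank t) 0))) sum_pairs.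
  by apply: eq_bigr => k _; apply: eq_bigr => i _; rewrite WF.
have OFc p : OKvec (col p F) by move=> i; rewrite mxE; exact: OF.
have Fp0 p : col p F != 0.
  apply/negP => /eqP Fp; have : S p = 0.
    rewrite /S big1 // => k _; rewrite Fp /Qf big1 // => i _.
    by rewrite map_mx0 mulmx0 mxE; apply/eqP; rewrite N2_eq0.
  rewrite -SW => /eqP; rewrite psumr_eq0 => [/allP S0|q _]; last exact: N2_ge0.
  have uW : W \in unitmx by rewrite unitmxE unitfE.
  have : W *m map_mx intr (col p U) = 0.
    by apply/colP => q; have := S0 q (mem_index_enum _); rewrite /= N2_eq0 mxE [in RHS]mxE => /eqP.
  move/(congr1 (mulmx (invmx W))); rewrite mulKmx // mulmx0 => /matrixP Up0.
  have := col_unit_neq0 p uU; rewrite (_ : col p U = 0) ?eqxx //; apply/matrixP => i j.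
  by have := Up0 i j; rewrite !mxE => /eqP; rewrite intr_eq0 => /eqP.
have Sc p : c <= S p by exact: hx.
have SD p : S p <= c0 * N2 (\det W1) / c ^+ #|{: T}|.-1.
  rewrite ler_pdivlMr ?exprn_gt0 // -dW; apply: le_trans UW.
  rewrite (eq_bigr S) => [|q _]; last exact: SW.
  rewrite (bigD1 p) //= ler_wpM2l; first by [].
    by rewrite (le_trans _ (Sc p)) // ltW.
  have -> : c ^+ #|{: T}|.-1 = \prod_(i < #|{: T}| | i != p) c.
    by rewrite prodr_const cardC1 card_ord.
  by apply: ler_prod => q _; rewrite Sc ltW.
(* The coordinates of 1 in b recover the standard vectors from the columns of [Bm]; this right
   inverse shows that F has rank n over K. *)
pose Y : 'M[K]_(#|{: T}|, n) :=
  \matrix_(q < #|{: T}|, l < n) (((enum_val q).2 == l)%:R * (coord b (enum_val q).1 1)%:A).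
have BY : Bm *m Y = 1%:M.
  apply/matrixP => l l'; rewrite !mxE.
  under eq_bigr => q _ do rewrite !mxE.
  rewrite (sum_enum_val (fun q : T => (l == q.2)%:R * b`_(q.1) * ((q.2 == l')%:R * (coord b q.1 1)%:A))).
  rewrite sum_pairs /=.
  transitivity (\sum_j (l == l')%:R * (coord b j 1 *: b`_j)).
    apply: eq_bigr => j _.
    rewrite (bigD1 l) //= big1 => [|i il]; last by rewrite eq_sym (negbTE il) !mul0r.
    by rewrite eqxx addr0 mul1r mulrCA -scalerAr mulr1.
  by rewrite -mulr_sumr -(coordE bZ.1 1) mulr1.
have FY : F *m (map_mx intr (invmx U) *m Y) = 1%:M.
  rewrite /F mulmxA -(mulmxA Bm) -map_mxM mulmxV // map_mx1 mulmx1.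
  exact: BY.
have fF : row_full F^T.
  by apply/row_fullP; exists (map_mx intr (invmx U) *m Y)^T; rewrite -trmx_mul FY trmx1.
exists (rowsub (fullrankfun fF) F^T)^T; split.
- by move=> i j; rewrite mxE mxE mxE; exact: OF.
- by rewrite det_tr -unitfE -unitmxE fullrowsub_unit.
- move=> l; have -> : col l (rowsub (fullrankfun fF) F^T)^T = col (fullrankfun fF l) F.
    by apply/colP => i; rewrite !mxE.
  exact: SD.
Qed.

(** The short columns form an integral X with bounded determinant, in general not a unit. Dividing
    on the right by one of finitely many [Y i] gives a matrix of SL_n(OK), and multiplies the
    entries of h X by bounded quantities; B sums these over all classes. *)
Lemma unimodular_reduction (c : R) : 0 < c -> exists B : R, forall h, conj_family h ->
  (forall k, \det (h k) = 1) -> (forall x, x != 0 -> c <= Phi h x) ->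
  exists g : 'M[K]_n, [/\ OKmx g, \det g = 1 &
    forall k i j, N2 ((h k *m map_mx (emb k) g) i j) <= B].
Proof.
move=> c0; have [D D0 H] := short_columns.
pose c1 := Num.min c 1; have c10 : 0 < c1 by rewrite lt_min c0 ltr01.
pose B1 := D / c1 ^+ #|{: T}|.-1.
have B10 : 0 < B1 by rewrite divr_gt0 ?exprn_gt0.
have [I [Y YP]] := finite_classes E n (2 ^+ #|{perm 'I_n}| * \sum_(s : {perm 'I_n}) B1 ^+ n).
exists (2 ^+ n * \sum_i \sum_(k : J) \sum_j \sum_l B1 * N2 (emb k (invmx (Y i) l j))).
move=> h hc dh hx.
have [|X [OX dX XB]] := H h c1 hc dh c10.
  move=> x Ox x0; rewrite leNgt; apply/negP => lt.
  have S1 : \sum_k Qf h k x <= 1 by rewrite (le_trans (ltW lt)) // ge_min lexx orbT.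
  have := le_trans (hx x x0) (Phi_le_sum Ox x0 S1).
  by rewrite leNgt (lt_le_trans lt) // ge_min lexx.
have XB' k i j : N2 ((h k *m map_mx (emb k) X) i j) <= B1.
  apply: le_trans (XB j).
  have -> : (h k *m map_mx (emb k) X) i j = (h k *m map_mx (emb k) (col j X)) i 0.
    by rewrite map_col !mxE; apply: eq_bigr => l _; rewrite !mxE.
  rewrite [leRHS](bigD1 k) //= ler_wpDr //; first by apply: sumr_ge0 => l _; exact: Qf_ge0.
  by rewrite /Qf [leRHS](bigD1 i) //= lerDl sumr_ge0 // => l _; exact: N2_ge0.
have [//|//|k|i [dY OXY dXY]] := YP X.
  have -> : emb k (\det X) = \det (h k *m map_mx (emb k) X).
    by rewrite det_mulmx dh mul1r det_map_mx.
  by apply: N2_det => i j; exact: XB'.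
exists (X *m invmx (Y i)); split=> // k a j.
rewrite map_mxM mulmxA (le_trans (N2_mulmx _ _ _ _)) // ler_wpM2l ?exprn_ge0 //.
rewrite (bigD1 i) //= ler_wpDr //.
  do 4 (apply: sumr_ge0 => ? _); by rewrite mulr_ge0 ?N2_ge0 // ltW.
rewrite (bigD1 k) //= ler_wpDr //.
  do 3 (apply: sumr_ge0 => ? _); by rewrite mulr_ge0 ?N2_ge0 // ltW.
rewrite [leRHS](bigD1 j) //= ler_wpDr //.
  do 2 (apply: sumr_ge0 => ? _); by rewrite mulr_ge0 ?N2_ge0 // ltW.
apply: ler_sum => l _; rewrite [map_mx _ (invmx _) _ _]mxE ler_wpM2r ?N2_ge0 //.
Qed.

Lemma Phi_mul h (g : 'M[K]_n) x : OKmx g -> \det g = 1 ->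
  Phi (fun k => h k *m map_mx (emb k) g) x = Phi h (g *m x).
Proof.
move=> Og dg; rewrite /Phi; congr (_ * _ ^+ 2).
  by apply: eq_bigr => k _; apply: eq_bigr => i _; rewrite map_mxM mulmxA.
congr PV; apply/funext => v; rewrite nv_SL // => i j.
exact: absK_OK.
Qed.

End Reduction.

(** * Existence of the maximum *)

Section ContinuousEntries.
Variables (R : realType) (T : topologicalType).
Local Notation C := R[i].
Implicit Types f g : T -> C.

(** One cluster point for all continuous functions at once: the equations defining families and the
    lower bounds of Phi at every vector must hold at the same limit. *)
Lemma cluster_ge (A : set T) (u : nat -> T) : compact A -> (forall j, A (u j)) ->
  exists p, forall (f : T -> R) a, continuous f ->
    (forall e, 0 < e -> exists N, forall j, (N <= j)%N -> a - e <= f (u j)) -> a <= f p.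
Proof.
move=> cA uA; have FA : (u @ \oo) A by exists 0%N => // j _; exact: uA.
have [p [_ pcl]] := cA _ _ FA; exists p => f a fc H.
rewrite leNgt; apply/negP => fa.
have e0 : 0 < (a - f p) / 2 by rewrite divr_gt0 // subr_gt0.
have [N NP] := H _ e0.
pose A1 := [set q | exists2 j, (N <= j)%N & q = u j].
pose B1 := [set q | f q < a - (a - f p) / 2].
have FA1 : (u @ \oo) A1 by exists N => // j Nj; exists j.
have pB1 : nbhs p B1.
  have /(_ p) fp := fc; apply: (cvgr_lt (f p) fp).
  by rewrite ltrBrDl -ltrBrDr; lra.
have [q [[j Nj ->]]] := pcl _ _ FA1 pB1.
by rewrite /B1 /= ltNge NP.
Qed.

Lemma continuous_sum (I : Type) (r : seq I) (P : pred I) (F : I -> T -> R) :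
  (forall i, continuous (F i)) -> continuous (fun t => \sum_(i <- r | P i) F i t).
Proof.
move=> Fc; elim: r => [|i r IHr] t.
  under eq_fun do rewrite big_nil; exact: cvg_cst.
under eq_fun do rewrite big_cons; case: (P i); last exact: IHr.
by apply: cvgD; [exact: Fc|exact: IHr].
Qed.

Lemma continuous_prod (I : Type) (r : seq I) (P : pred I) (F : I -> T -> R) :
  (forall i, continuous (F i)) -> continuous (fun t => \prod_(i <- r | P i) F i t).
Proof.
move=> Fc; elim: r => [|i r IHr] t.
  under eq_fun do rewrite big_nil; exact: cvg_cst.
under eq_fun do rewrite big_cons; case: (P i); last exact: IHr.
by apply: cvgM; [exact: Fc|exact: IHr].
Qed.

Lemma continuous_scale (f : T -> R) c : continuous f -> continuous (fun t => f t * c).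
Proof. by move=> fc t; apply: cvgM; [exact: fc|exact: cvg_cst]. Qed.

Lemma continuous_sub (f g : T -> R) :
  continuous f -> continuous g -> continuous (fun t => f t - g t).
Proof. by move=> fc gc t; apply: cvgB; [exact: fc|exact: gc]. Qed.

Definition ccontinuous f :=
  continuous (fun t => complex.Re (f t)) /\ continuous (fun t => complex.Im (f t)).

Lemma ccontinuous_cst c : ccontinuous (fun=> c).
Proof. by split=> t; exact: cvg_cst. Qed.

Lemma ccontinuousD f g : ccontinuous f -> ccontinuous g -> ccontinuous (fun t => f t + g t).
Proof.
move=> [f1 f2] [g1 g2].
split=> t.
  rewrite (_ : (fun t => _) = (fun t => complex.Re (f t) + complex.Re (g t))); last first.
    by apply/funext => s; case: (f s) (g s) => a b [].
    by apply: cvgD; [exact: f1|exact: g1].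
rewrite (_ : (fun t => _) = (fun t => complex.Im (f t) + complex.Im (g t))); last first.
  by apply/funext => s; case: (f s) (g s) => a b [].
by apply: cvgD; [exact: f2|exact: g2].
Qed.

Lemma ccontinuousM f g : ccontinuous f -> ccontinuous g -> ccontinuous (fun t => f t * g t).
Proof.
move=> [f1 f2] [g1 g2].
split=> t.
  rewrite (_ : (fun t => _) = (fun t => complex.Re (f t) * complex.Re (g t)
     - complex.Im (f t) * complex.Im (g t))); last first.
    by apply/funext => s; case: (f s) (g s) => a b [].
    by apply: cvgB; apply: cvgM; [exact: f1|exact: g1|exact: f2|exact: g2].
rewrite (_ : (fun t => _) = (fun t => complex.Re (f t) * complex.Im (g t)
     + complex.Im (f t) * complex.Re (g t))); last first.
  by apply/funext => s; case: (f s) (g s) => a b [].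
by apply: cvgD; apply: cvgM; [exact: f1|exact: g2|exact: f2|exact: g1].
Qed.

Lemma ccontinuous_conj f : ccontinuous f -> ccontinuous (fun t => conjc (f t)).
Proof.
move=> [f1 f2]; split.
  rewrite (_ : (fun t => _) = (fun t => complex.Re (f t))) //.
  by apply/funext => s; case: (f s).
rewrite (_ : (fun t => _) = (fun t => - complex.Im (f t))).
  by move=> t; apply: cvgN; exact: f2.
by apply/funext => s; case: (f s).
Qed.

Lemma ccontinuous_sum (I : Type) (r : seq I) (P : pred I) (F : I -> T -> C) :
  (forall i, ccontinuous (F i)) -> ccontinuous (fun t => \sum_(i <- r | P i) F i t).
Proof.
move=> Fc; elim: r => [|i r IHr].
  by under eq_fun do rewrite big_nil; exact: ccontinuous_cst.
under eq_fun do rewrite big_cons; case: (P i); last exact: IHr.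
by apply: ccontinuousD.
Qed.

Lemma ccontinuous_prod (I : Type) (r : seq I) (P : pred I) (F : I -> T -> C) :
  (forall i, ccontinuous (F i)) -> ccontinuous (fun t => \prod_(i <- r | P i) F i t).
Proof.
move=> Fc; elim: r => [|i r IHr].
  by under eq_fun do rewrite big_nil; exact: ccontinuous_cst.
under eq_fun do rewrite big_cons; case: (P i); last exact: IHr.
by apply: ccontinuousM.
Qed.

Lemma ccontinuous_det n (A : T -> 'M[C]_n) :
  (forall i j, ccontinuous (fun t => A t i j)) -> ccontinuous (fun t => \det (A t)).
Proof.
move=> Ac; apply: ccontinuous_sum => s.
by apply: ccontinuousM; [exact: ccontinuous_cst|apply: ccontinuous_prod => i].
Qed.

Lemma ccontinuous_N2 f : ccontinuous f -> continuous (fun t => N2 (f t)).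
Proof.
move=> [f1 f2] t; rewrite /N2.
by apply: cvgD; apply: cvgM; by [exact: f1|exact: f2].
Qed.

End ContinuousEntries.

Section Maximum.
Variables (R : realType) (K : fieldExtType rat) (E : embeddings R K) (n : nat).
Local Notation C := R[i].
Local Notation m := (\dim {:K}).
Local Notation J := ('I_(nreal E) + ('I_(ncomplex E) + 'I_(ncomplex E)))%type.
Local Notation P := (J * 'I_n * 'I_n * bool)%type.
Implicit Types (h : J -> 'M[C]_n) (x y : 'cV[K]_n).

Definition unimodular h := conj_family h /\ forall k, \det (h k) = 1.

(** Families are read as real row vectors, one entry for each real or imaginary part, so that a
    product of segments supplies compactness. *)
Definition decode (p : 'rV[R]_#|{: P}|) (k : J) : 'M[C]_n :=
  \matrix_(i, j) (p 0 (enum_rank (k, i, j, false)) +i* p 0 (enum_rank (k, i, j, true)))%C.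

Definition encode h : 'rV[R]_#|{: P}| :=
  \row_q let: (k, i, j, b) := (enum_val q : P) in
    if b then complex.Im (h k i j) else complex.Re (h k i j).

Lemma encodeK h : decode (encode h) = h.
Proof.
apply/funext => k; apply/matrixP => i j; rewrite !mxE !enum_rankK.
by case: (h k i j).
Qed.

Lemma decode_ccontinuous k i j : ccontinuous (fun p => decode p k i j).
Proof.
split=> p.
  rewrite (_ : (fun p => _) = (fun p : 'rV[R]_#|{: P}| => p 0 (enum_rank (k, i, j, false)))).
    exact: coord_continuous.
  by apply/funext => q; rewrite mxE.
rewrite (_ : (fun p => _) = (fun p : 'rV[R]_#|{: P}| => p 0 (enum_rank (k, i, j, true)))).
  exact: coord_continuous.
by apply/funext => q; rewrite mxE.
Qed.

Lemma Phi_continuous x : continuous (fun p => Phi (decode p) x).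
Proof.
apply: continuous_scale.
apply: continuous_prod => k; apply: continuous_sum => i.
apply: ccontinuous_N2.
rewrite (_ : (fun t => _) = (fun t => \sum_j decode t k i j * emb k (x j 0))).
  apply: ccontinuous_sum => j; apply: ccontinuousM; last exact: ccontinuous_cst.
  exact: decode_ccontinuous.
by apply/funext => t; rewrite mxE; apply: eq_bigr => j _; rewrite [X in _ * X]mxE.
Qed.

Lemma unimodular_mul h (g : 'M[K]_n) : unimodular h -> \det g = 1 ->
  unimodular (fun k => h k *m map_mx (emb k) g).
Proof.
move=> [hc dh] dg; split=> k; last by rewrite det_mulmx dh det_map_mx dg rmorph1 mulr1.
rewrite map_mxM hc; congr (_ *m _); apply/matrixP => i j; rewrite !mxE.
exact: emb_bar.
Qed.

Lemma unimodular1 : unimodular (fun=> 1%:M).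
Proof. by split=> k; rewrite ?det1 // map_mx1. Qed.

Lemma unimodular_det_neq0 h k : unimodular h -> \det (h k) != 0.
Proof. by move=> [_ ->]; exact: oner_neq0. Qed.

Lemma Phi_max : (0 < n)%N -> exists h x, [/\ unimodular h, OKvec x /\ x != 0,
  forall y, y != 0 -> Phi h x <= Phi h y &
  forall h', unimodular h' -> exists2 y, OKvec y /\ y != 0 & Phi h' y <= Phi h x].
Proof.
(* V collects the uniform lower bounds of Phi over all families, so its supremum M is the value to
   be attained; by [Phi_min] it contains the minimum of each family. *)
move=> n0; pose V : set R :=
  [set c | exists2 h, unimodular h & forall x, x != 0 -> c <= Phi h x].
have VP h : unimodular h -> exists x, [/\ OKvec x, x != 0, V (Phi h x)
    & forall y, y != 0 -> Phi h x <= Phi h y].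
  move=> hu; have [x [Ox x0 xmin]] := Phi_min n0 hu.1 (fun k => unimodular_det_neq0 k hu).
  by exists x; split=> //; exists h.
pose i0 := Ordinal n0; pose x1 : 'cV[K]_n := delta_mx i0 0.
have x10 : x1 != 0 by apply/cV0Pn; exists i0; rewrite mxE !eqxx oner_eq0.
have Ox1 : OKvec x1 by move=> i; rewrite mxE; exact: OK_nat.
have [B BP] := unimodular_reduction E n (@ltr01 R).
have ubV : has_ubound V.
  (* Only c > 1 needs a bound; then the reduction with constant 1 applies, and Phi at the image
     under g of the first standard vector is bounded through the entries of h g. *)
  exists (Num.max 1 (\prod_(k : J) \sum_(i < n) B)) => c [h hu hx].
  rewrite le_max; case: (leP c 1) => //= /ltW c1.
  have [x x0|g [Og dg gB]] := BP h hu.1 hu.2; first by rewrite (le_trans c1) // hx.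
  have gx0 : g *m x1 != 0.
    apply: contra x10 => /eqP gx; have ug : g \in unitmx by rewrite unitmxE dg unitr1.
    by rewrite -(mulKmx ug x1) gx mulmx0.
  apply: le_trans (hx _ gx0) _; rewrite -Phi_mul //.
  apply: le_trans (Phi_le_prod _ Ox1 x10) _; apply: ler_prod => k _; rewrite Qf_ge0 /=.
  apply: ler_sum => i _; rewrite (_ : map_mx _ x1 = delta_mx i0 0); last exact: map_delta_mx.
  by rewrite -colE mxE.
have [x [Ox x0 Vx _]] := VP _ unimodular1.
have supV : has_sup V by split=> //; eexists; exact: Vx.
pose M := sup V; have M0 : 0 < M.
  apply: lt_le_trans (ub_le_sup ubV Vx); apply: Phi_gt0 => // k.
  by rewrite det1 oner_neq0.
(* These errors never exceed M / 2, so the whole maximizing sequence stays above M / 2 and a single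
   reduction bound B' serves all its terms. *)
have e0 (j : nat) : 0 < M / 2 / j.+1%:R by rewrite !divr_gt0.
have [B' B'P] := unimodular_reduction E n (divr_gt0 M0 (ltr0n _ 2)).
have seqP j : exists h, [/\ unimodular h, forall k a b, N2 (h k a b) <= B' &
    forall x, x != 0 -> M - M / 2 / j.+1%:R <= Phi h x].
  have [c [h hu hx] Mc] := sup_adherent (e0 j) supV.
  have hM y : y != 0 -> M - M / 2 / j.+1%:R <= Phi h y.
    by move=> y0; apply: le_trans (ltW Mc) (hx y y0).
  have [y y0|g [Og dg gB]] := B'P h hu.1 hu.2.
    apply: le_trans (hM y y0); rewrite lerBrDr -lerBrDl.
    rewrite ler_pdivrMr ?ltr0n //.
    have j1 : 1 <= j.+1%:R :> R by rewrite ler1n.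
    by have := M0; nra.
  exists (fun k => h k *m map_mx (emb k) g); split=> //; first exact: unimodular_mul.
  move=> y y0; rewrite Phi_mul // hM //.
  apply: contra y0 => /eqP gy; have ug : g \in unitmx by rewrite unitmxE dg unitr1.
  by rewrite -(mulKmx ug y) gy mulmx0.
have H j := cid (seqP j).
pose hs j := sval (H j).
have hsu j : unimodular (hs j) by have [] := svalP (H j).
have hsB j k a b : N2 (hs j k a b) <= B' by have [_ h _] := svalP (H j); exact: h.
have hsM j x' : x' != 0 -> M - M / 2 / j.+1%:R <= Phi (hs j) x'.
  by have [_ _ h] := svalP (H j); exact: h.
pose A : set 'rV[R]_#|{: P}| := [set v | forall i, [set` `[- (1 + B'), 1 + B']] (v 0 i)].
have cA : compact A.
  exact: (@rV_compact _ _ (fun=> [set` `[- (1 + B'), 1 + B']]) (fun=> @segment_compact _ _ _)).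
(* From |r| <= 1 + r^2. *)
have sqb (r s : R) : r ^+ 2 + s ^+ 2 <= B' -> - (1 + B') <= r <= 1 + B' /\ - (1 + B') <= s <= 1 + B'.
  by move=> rs; split; apply/andP; split; nra.
have uA j : A (encode (hs j)).
  move=> q; rewrite mxE /=; case: (enum_val q) => [[[k a] b] []]; rewrite in_itv /=.
    by have [] := sqb _ _ (hsB j k a b).
  by have [] := sqb _ _ (hsB j k a b).
have [p pP] := cluster_ge R cA uA.
have ge_lim (f : 'rV[R]_#|{: P}| -> R) a : continuous f ->
    (forall j, a <= f (encode (hs j))) -> a <= f p.
  move=> fc fa; apply: pP => // e e_gt0; exists 0%N => j _.
  by apply: le_trans (fa j); rewrite gerBl ltW.
have eq_lim (f g : 'rV[R]_#|{: P}| -> R) : continuous f -> continuous g ->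
    (forall j, f (encode (hs j)) = g (encode (hs j))) -> f p = g p.
  move=> fc gc fg; apply: le_anti; apply/andP; split; rewrite -subr_ge0.
    apply: (ge_lim (fun t => g t - f t)) => [|j]; last by rewrite fg subrr.
    exact: continuous_sub.
  apply: (ge_lim (fun t => f t - g t)) => [|j]; last by rewrite fg subrr.
  exact: continuous_sub.
have eqC_lim (f g : 'rV[R]_#|{: P}| -> C) : ccontinuous f -> ccontinuous g ->
    (forall j, f (encode (hs j)) = g (encode (hs j))) -> f p = g p.
  move=> [f1 f2] [g1 g2] fg; apply/eqP; rewrite eq_complex; apply/andP; split; apply/eqP.
    by apply: (eq_lim _ _ f1 g1) => j /=; rewrite fg.
  by apply: (eq_lim _ _ f2 g2) => j /=; rewrite fg.
have hu : unimodular (decode p).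
  split=> k.
    apply/matrixP => i j; rewrite [RHS]mxE.
    apply: (eqC_lim (fun t => decode t (bar k) i j) (fun t => conjc (decode t k i j))).
    - exact: decode_ccontinuous.
    - by apply: ccontinuous_conj; exact: decode_ccontinuous.
    - by move=> l; rewrite encodeK (hsu l).1 mxE.
  apply: (eqC_lim (fun t => \det (decode t k)) (fun=> 1)).
  - by apply: ccontinuous_det => i j; exact: decode_ccontinuous.
  - exact: ccontinuous_cst.
  - by move=> l; rewrite encodeK (hsu l).2.
have hM y : y != 0 -> M <= Phi (decode p) y.
  move=> y0; apply: (pP (fun t => Phi (decode t) y)); first exact: Phi_continuous.
  move=> e e_gt0; exists (Num.bound (M / 2 / e)) => j Nj; rewrite encodeK.
  apply: le_trans (hsM j y y0); rewrite lerD2l lerN2 ler_pdivrMr ?ltr0n //.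
  rewrite -ler_pdivrMl // mulrC; apply: le_trans (ltW (archi_boundP _)) _.
    by rewrite !divr_ge0 // ltW.
  by rewrite ler_nat ltnW.
have [z [Oz z0 Vz zmin]] := VP _ hu.
exists (decode p), z; split=> // h' hu'.
have [y [Oy y0 Vy _]] := VP _ hu'; exists y => //.
by apply: le_trans (ub_le_sup ubV Vy) (hM z z0).
Qed.

End Maximum.

(** * Humbert forms *)

Section LocalForms.
Variable R : realType.
Local Notation C := R[i].
Local Notation rc := (real_complex R).

Lemma powR_root n (a : R) : (0 < n)%N -> 0 <= a -> (a `^ n%:R^-1) ^+ n = a.
Proof.
move=> n0 a0; rewrite -powR_mulrn ?powR_ge0 // -powRrM mulVf ?powRr1 //.
by rewrite pnatr_eq0 -lt0n.
Qed.

Lemma powR_exprV n (a : R) : (0 < n)%N -> 0 <= a -> (a ^+ n) `^ n%:R^-1 = a.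
Proof.
move=> n0 a0; rewrite -powR_mulrn // -powRrM mulfV ?powRr1 //.
by rewrite pnatr_eq0 -lt0n.
Qed.

Lemma gram_det_neq0 (F : fieldType) n (g : 'M[F]_n) :
  (forall y : 'cV_n, y != 0 -> g *m y != 0) -> \det g != 0.
Proof.
move=> gy; rewrite -det_tr; apply/det0P => -[v v0 vg].
have := gy v^T; rewrite trmx_eq0 => /(_ v0) /eqP; apply.
by rewrite -[g]trmxK -trmx_mul vg trmx0.
Qed.

(** Cholesky, then normalization of the factor: the scalar t is |det g0|^(2/n), and a sign in one
    row, invisible in the sum of squares, makes the determinant 1. *)
Lemma real_place n (S : 'M[R]_n) : (0 < n)%N -> S \is symmetricmx ->
  (forall y, y != 0 -> 0 < rform S y) -> exists g t,
  [/\ \det g = 1, 0 < t, \det S = t ^+ n &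
     forall y, rform S y = t * \sum_a (g *m y) a 0 ^+ 2].
Proof.
move=> n0 Ss Sp; have St : S^T = S.
  by move: Ss => /is_hermitianmxP; rewrite expr0 scale1r => {2}->; rewrite map_mx_id.
have [g0 SE] := rcholesky (conj St Sp).
have SyE y : rform S y = \sum_a (g0 *m y) a 0 ^+ 2 by rewrite SE; exact: rqf_gram.
have dg0 : \det g0 != 0.
  apply: gram_det_neq0 => y /Sp; rewrite SyE; apply: contraTneq => ->.
  by rewrite big1 ?ltxx // => a _; rewrite mxE expr0n.
set d := \det g0 in dg0.
pose r : R := `|d| `^ n%:R^-1.
have r0 : 0 < r by rewrite powR_gt0 // normr_gt0.
have rn : r ^+ n = `|d| by rewrite powR_root.
pose i0 := Ordinal n0; pose D : 'rV[R]_n := \row_i (if i == i0 then Num.sg d else 1).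
have dD : \det (diag_mx D) = Num.sg d.
  rewrite det_diag (bigD1 i0) //= big1 => [|i /negbTE ii0]; last by rewrite mxE ii0.
  by rewrite mxE eqxx mulr1.
have D2 i : D 0 i ^+ 2 = 1 by rewrite mxE; case: ifP => _; rewrite ?expr1n // sqr_sg dg0.
exists (r^-1 *: (diag_mx D *m g0)), (r ^+ 2); split.
- rewrite detZ det_mulmx dD -/d -normrEsg exprVn rn mulVf //.
  by rewrite normr_eq0.
- by rewrite exprn_gt0.
- by rewrite SE det_mulmx det_tr -exprM mulnC exprM rn real_normK ?num_real // expr2.
move=> y; rewrite SyE mulr_sumr; apply: eq_bigr => a _.
have -> : (r^-1 *: (diag_mx D *m g0) *m y) a 0 = r^-1 * (D 0 a * (g0 *m y) a 0).
  by rewrite -scalemxAl -mulmxA mul_diag_mx [LHS]mxE; congr (_ * _); rewrite mxE.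
rewrite !exprMn D2 mul1r.
by rewrite mulrA -exprMn divff ?gt_eqF // expr1n mul1r.
Qed.

Lemma conjtrE n (y : 'cV[C]_n) : (y ^t Num.conj)%sesqui = adjmx conjc y.
Proof. by apply/matrixP => i j; rewrite !mxE. Qed.

Lemma cform_gram n (g : 'M[C]_n) y :
  cform (adjmx conjc g *m g) y = (\sum_a N2 ((g *m y) a 0))%:C%C.
Proof.
rewrite /cform conjtrE.
have -> : adjmx conjc y *m (adjmx conjc g *m g) *m y = adjmx conjc (g *m y) *m (g *m y).
  by rewrite (adjmxM conjc) !mulmxA.
rewrite mxE rmorph_sum; apply: eq_bigr => a _; rewrite [X in X * _]mxE [X in X * _]mxE.
exact: N2E.
Qed.

Lemma cposP (a : C) : 0 < a -> a != 0 /\ exists c, a = conjc c * c.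
Proof.
move=> a0; split; first by rewrite gt_eqF.
exists (Num.sqrt (complex.Re a))%:C%C; rewrite N2E N2_real sqr_sqrtr.
  by apply/esym/RRe_real; exact: gtr0_real.
by move: a0; case: a => x y; rewrite ltcE /= => /andP[_ /ltW].
Qed.

(** As at a real place, but a complex n-th root z of the determinant of the Cholesky factor
    normalizes it at once, with t the squared modulus of z. *)
Lemma complex_place n (S : 'M[C]_n) : (0 < n)%N -> S \is hermsymmx ->
  (forall y, y != 0 -> 0 < cform S y) -> exists g t,
  [/\ \det g = 1, 0 < t, \det S = (t ^+ n)%:C%C &
     forall y, complex.Re (cform S y) = t * \sum_a N2 ((g *m y) a 0)].
Proof.
move=> n0 Ss Sp; have St : adjmx conjc S = S.
  by move: Ss => /is_hermitianmxP; rewrite expr0 scale1r => {2}->; rewrite /adjmx map_trmx.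
have [|g0 SE] := @cholesky C conjc (fun z => 0 < z) (@conjcK R) cposP n S.
  split; first exact: St.
  move=> y y0; change (0 < hform conjc S y).
  have -> : hform conjc S y = cform S y by rewrite /cform conjtrE.
  exact: Sp.
have SyE y : cform S y = (\sum_a N2 ((g0 *m y) a 0))%:C%C by rewrite SE cform_gram.
have dg0 : \det g0 != 0.
  apply: gram_det_neq0 => y /Sp; rewrite SyE; apply: contraTneq => ->.
  by rewrite big1 ?ltxx // => a _; rewrite mxE; apply/eqP; rewrite N2_eq0.
set d := \det g0 in dg0.
have [z zn] : exists z, z ^+ n = d by exists (n.-root d); exact: rootCK.
have z0 : z != 0 by apply: contra_neq dg0 => z0; rewrite -zn z0 expr0n eqn0Ngt n0.
have N2X k : N2 (z ^+ k) = N2 z ^+ k.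
  by elim: k => [|k IHk]; rewrite ?expr0 ?N2_1 // !exprS N2M IHk.
exists (z^-1 *: g0), (N2 z); split.
- by rewrite detZ -/d exprVn zn mulVf.
- exact: N2_gt0.
- by rewrite SE det_mulmx det_tr det_map_mx -/d -N2X zn; exact: N2E.
move=> y; rewrite SyE /= mulr_sumr; apply: eq_bigr => a _.
have -> : (z^-1 *: g0 *m y) a 0 = z^-1 * (g0 *m y) a 0 by rewrite -scalemxAl [LHS]mxE.
by rewrite -N2M mulrA divff // mul1r.
Qed.

End LocalForms.

Section Families.
Variables (R : realType) (K : fieldExtType rat) (E : embeddings R K) (n : nat).
Hypothesis n_gt0 : (0 < n)%N.
Local Notation C := R[i].
Local Notation rc := (real_complex R).
Local Notation m := (\dim {:K}).
Local Notation J := ('I_(nreal E) + ('I_(ncomplex E) + 'I_(ncomplex E)))%type.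
Implicit Types (h : J -> 'M[C]_n) (x y : 'cV[K]_n).

Definition place_family (hr : 'I_(nreal E) -> 'M[R]_n) (hc : 'I_(ncomplex E) -> 'M[C]_n) (k : J) :=
  match k with
  | inl i => map_mx rc (hr i)
  | inr (inl j) => hc j
  | inr (inr j) => map_mx conjc (hc j)
  end.

Lemma conj_real_mx p q (A : 'M[R]_(p, q)) : map_mx conjc (map_mx rc A) = map_mx rc A.
Proof. by apply/matrixP => i j; rewrite !mxE; exact: conjc_real. Qed.

Lemma family_unimodular hr hc : (forall i, \det (hr i) = 1) -> (forall j, \det (hc j) = 1) ->
  unimodular (place_family hr hc).
Proof.
move=> dr dc; split=> [[i|[j|j]]|[i|[j|j]]] /=; rewrite ?det_map_mx ?dr ?dc ?rmorph1 //.
  by rewrite conj_real_mx.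
by apply/matrixP => a b; rewrite !mxE conjcK.
Qed.

Lemma unimodular_family h : unimodular h -> exists hr hc,
  [/\ h = place_family hr hc, forall i, \det (hr i) = 1 & forall j, \det (hc j) = 1].
Proof.
move=> [hc dh]; pose hr i : 'M[R]_n := map_mx (@complex.Re R) (h (inl i)).
have hrE i : map_mx rc (hr i) = h (inl i).
  apply/matrixP => a b; rewrite !mxE; have /matrixP/(_ a b) := hc (inl i).
  rewrite mxE /=; case: (h (inl i) a b) => u w [] /eqP.
  by rewrite -addr_eq0 -mulr2n mulrn_eq0 /= => /eqP ->.
exists hr, (fun j => h (inr (inl j))); split=> [|i|j]; last exact: dh.
  apply/funext => -[i|[j|j]]; [exact: esym (hrE i)|by []|exact: hc (inr (inl j))].
by apply: (@complexI R); rewrite -[LHS]det_map_mx hrE dh.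
Qed.

Definition realQ (g : 'M[R]_n) (y : 'cV[R]_n) : R := \sum_a (g *m y) a 0 ^+ 2.
Definition complexQ (g : 'M[C]_n) (y : 'cV[C]_n) : R := \sum_a N2 ((g *m y) a 0).

Lemma Phi_family hr hc x : Phi (place_family hr hc) x =
  (\prod_i realQ (hr i) (map_mx (real_emb i) x)) *
  (\prod_j complexQ (hc j) (map_mx (complex_emb j) x)) ^+ 2 * PV (fun v => nv R v x) ^+ 2.
Proof.
rewrite /Phi big_sumType big_sumType /= expr2; congr (_ * (_ * _) * _).
- apply: eq_bigr => i _; apply: eq_bigr => a _.
  have -> : map_mx (emb (inl i : J)) x = map_mx rc (map_mx (real_emb i) x).
    by apply/matrixP => b c; rewrite !mxE.
  by rewrite -map_mxM mxE N2_real.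
- apply: eq_bigr => j _; apply: eq_bigr => a _.
  have -> : map_mx (emb (inr (inr j) : J)) x = map_mx conjc (map_mx (complex_emb j) x).
    by apply/matrixP => b c; rewrite !mxE.
  by rewrite -map_mxM mxE N2_conj.
Qed.

(** The local scalars multiply to t; the form is t times that of determinant 1, and its determinant
    is t^n, whose n-th root cancels t. *)
Lemma humbert_quotE (S : form_tuple E n) hr hc tr tc x :
  (forall i, 0 < tr i /\ \det (S.1 i) = tr i ^+ n) ->
  (forall j, 0 < tc j /\ \det (S.2 j) = (tc j ^+ n)%:C%C) ->
  (forall i z, rform (S.1 i) z = tr i * realQ (hr i) z) ->
  (forall j z, complex.Re (cform (S.2 j) z) = tc j * complexQ (hc j) z) ->
  OKvec x -> x != 0 -> humbert_quot S x = Phi (place_family hr hc) x.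
Proof.
move=> dr dc qr qc Ox x0; pose t := \prod_i tr i * (\prod_j tc j) ^+ 2.
have t0 : 0 < t.
  by rewrite mulr_gt0 ?exprn_gt0 // prodr_gt0 // => i _; [have [] := dr i|have [] := dc i].
have detE : form_det S = t ^+ n.
  rewrite /form_det /t exprMn -exprM mulnC exprM; congr (_ * _ ^+ 2); rewrite -prodrXl.
    by apply: eq_bigr => i _; have [] := dr i.
  by apply: eq_bigr => j _; have [_ ->] := dc j.
have valE : form_val S x = t * ((\prod_i realQ (hr i) (map_mx (real_emb i) x)) *
    (\prod_j complexQ (hc j) (map_mx (complex_emb j) x)) ^+ 2).
  rewrite /form_val (eq_bigr _ (fun i _ => qr i _)) (eq_bigr _ (fun j _ => qc j _)) !big_split /=.
  by rewrite exprMn mulrACA.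
have [_ NE] := PV_nv R Ox x0.
rewrite /humbert_quot detE powR_exprV ?ltW // valE Phi_family NE exprVn.
by rewrite [X in _ / X]mulrC -mulf_div divff ?gt_eqF // mul1r.
Qed.

Lemma humbert_family (S : form_tuple E n) : humbert S -> exists2 h : J -> 'M[C]_n, unimodular h &
  forall x, OKvec x -> x != 0 -> humbert_quot S x = Phi h x.
Proof.
move=> [Sr Sc].
have Hr i := cid (real_place n_gt0 (Sr i).1 (Sr i).2).
have Hr' i := cid (svalP (Hr i)).
have Hc j := cid (complex_place n_gt0 (Sc j).1 (Sc j).2).
have Hc' j := cid (svalP (Hc j)).
pose hr i := sval (Hr i); pose tr i := sval (Hr' i).
pose hc i := sval (Hc i); pose tc i := sval (Hc' i).
have rP i : [/\ \det (hr i) = 1, 0 < tr i, \det (S.1 i) = tr i ^+ n &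
     forall z, rform (S.1 i) z = tr i * \sum_a (hr i *m z) a 0 ^+ 2] by exact: svalP (Hr' i).
have cP i : [/\ \det (hc i) = 1, 0 < tc i, \det (S.2 i) = (tc i ^+ n)%:C%C &
     forall z, complex.Re (cform (S.2 i) z) = tc i * \sum_a N2 ((hc i *m z) a 0)].
  exact: svalP (Hc' i).
exists (place_family hr hc).
  by apply: family_unimodular => [i|j]; [have [] := rP i|have [] := cP j].
move=> x Ox x0; apply: (humbert_quotE (tr := tr) (tc := tc)) => // i.
- by have [_ ? ?] := rP i.
- by have [_ ? ?] := cP i.
- by have [_ _ _] := rP i.
- by have [_ _ _] := cP i.
Qed.

Lemma family_humbert h : unimodular h -> exists2 S : form_tuple E n, humbert S &
  forall x, OKvec x -> x != 0 -> humbert_quot S x = Phi h x.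
Proof.
move=> /unimodular_family[hr [hc [-> dr dc]]].
have ur i : hr i \in unitmx by rewrite unitmxE dr unitr1.
have uc j : hc j \in unitmx by rewrite unitmxE dc unitr1.
exists (fun i => (hr i)^T *m hr i, fun j => adjmx conjc (hc j) *m hc j).
  split=> [i|j] /=; split.
  - apply/is_hermitianmxP; rewrite expr0 scale1r map_mx_id //.
    by rewrite trmx_mul trmxK.
  - move=> y y0; rewrite -[rform _ _]/(rqf _ y) rqf_gram.
    have /cV0Pn[a za] : hr i *m y != 0.
      by apply: contra y0 => /eqP hy; rewrite -(mulKmx (ur i) y) hy mulmx0.
    rewrite (bigD1 a) //= ltr_pwDl ?exprn_even_gt0 //.
    by apply: sumr_ge0 => b _; exact: sqr_ge0.
  - apply/is_hermitianmxP; rewrite expr0 scale1r.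
    have AE : adjmx conjc (adjmx conjc (hc j) *m hc j) = adjmx conjc (hc j) *m hc j.
      by rewrite (adjmxM conjc) (adjmxK (@conjcK R)).
    by move: AE; set A := _ *m _ => AE; rewrite -{1}AE /adjmx -map_trmx.
  - move=> y y0; rewrite cform_gram ltcR.
    have /cV0Pn[a za] : hc j *m y != 0.
      by apply: contra y0 => /eqP hy; rewrite -(mulKmx (uc j) y) hy mulmx0.
    rewrite (bigD1 a) //= ltr_pwDl ?N2_gt0 //.
    by apply: sumr_ge0 => b _; exact: N2_ge0.
move=> x Ox x0; apply: (humbert_quotE (tr := fun=> 1) (tc := fun=> 1)) => // [i|j|i y|j y] /=.
- by rewrite det_mulmx det_tr dr mulr1 expr1n.
- by rewrite det_mulmx det_tr det_map_mx dc rmorph1 mulr1 expr1n.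
- by rewrite mul1r; exact: rqf_gram.
- by rewrite cform_gram mul1r.
Qed.

End Families.

(** Rank factorization writes x as r L e; a diagonal matrix then corrects the determinant in the
    second coordinate, where e vanishes. This is how n >= 2 enters. *)
Lemma SL_orbit (F : fieldType) n (x : 'cV[F]_n) : (1 < n)%N -> x != 0 ->
  exists2 g : 'M[F]_n, \det g = 1 & g *m \col_i (i == 0%N :> nat)%:R = x.
Proof.
move=> n1 x0; have n0 : (0 < n)%N by exact: ltnW.
have rx : \rank x = 1%N.
  by apply/eqP; rewrite eqn_leq rank_leq_col lt0n mxrank_eq0.
pose L := col_ebase x; pose r := row_ebase x 0 0.
have uL : \det L != 0 by rewrite -unitfE -unitmxE col_ebase_unit.
have r0 : r != 0.
  have := row_ebase_unit x; rewrite unitmxE unitfE; apply: contra => /eqP r0.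
  by rewrite (expand_det_row _ 0) big_ord1 -/r r0 mul0r.
pose e : 'cV[F]_n := \col_i (i == 0%N :> nat)%:R.
have xE : x = r *: (L *m e).
  rewrite -{1}(mulmx_ebase x) rx -/L; have -> : row_ebase x = r%:M.
    by apply/matrixP => i j; rewrite !ord1 mxE mulr1n.
  rewrite mul_mx_scalar; congr (_ *: (_ *m _)); apply/matrixP => i j.
  by rewrite !mxE !ord1 /=; case: (i : nat) => [|k].
pose i1 := Ordinal n1; pose d := (r ^+ n * \det L)^-1.
pose D : 'rV[F]_n := \row_i (if i == i1 then d else 1).
have dD : \det (diag_mx D) = d.
  rewrite det_diag (bigD1 i1) //= big1 => [|i /negbTE ii]; last by rewrite mxE ii.
  by rewrite mxE eqxx mulr1.
exists (r *: (L *m diag_mx D)).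
  by rewrite detZ det_mulmx dD mulrA divff // mulf_neq0 ?expf_neq0.
rewrite [RHS]xE -scalemxAl -mulmxA; congr (_ *: (_ *m _)).
apply/colP => i; rewrite mul_diag_mx !mxE; case: eqP => [->|_]; last by rewrite mul1r.
by rewrite /= mulr0.
Qed.

Lemma to_completion0 (K : fieldExtType rat) (v : finplace K) : to_completion v 0 = 0.
Proof.
rewrite /to_completion -(rmorph0 (\pi_(completion v))%qT); congr (\pi_(completion v) _)%qT; apply: val_inj.
by rewrite -[RHS]/(val (0 : cauchy_seq v)) rmorph0.
Qed.

Lemma to_completion1 (K : fieldExtType rat) (v : finplace K) : to_completion v 1 = 1.
Proof.
rewrite /to_completion -(rmorph1 (\pi_(completion v))%qT); congr (\pi_(completion v) _)%qT; apply: val_inj.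
by rewrite -[RHS]/(val (1 : cauchy_seq v)) rmorph1.
Qed.

(** * Heights of adelic matrices *)

Section Heights.
Variables (R : realType) (K : fieldExtType rat) (E : embeddings R K) (n : nat).
Hypothesis n_gt0 : (0 < n)%N.
Local Notation C := R[i].
Local Notation m := (\dim {:K}).
Local Notation J := ('I_(nreal E) + ('I_(ncomplex E) + 'I_(ncomplex E)))%type.
Implicit Types (h : J -> 'M[C]_n) (x y : 'cV[K]_n) (g : place_mx E n).

(** The exponent 2m clears the roots 1/(2m) at real places and 1/m elsewhere, leaving squares at the
    complex and finite places. The vector y may differ from x because after strong approximation the
    finite heights at c x are those of x. *)
Lemma height_exp g x y : y != 0 ->
  (forall v, height_fin R (mx_fin g v *m map_mx (to_completion v) x) =
     nv R v y `^ m%:R^-1) ->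
  height g x ^+ (2 * m) =
  (\prod_i realQ (mx_real g i) (map_mx (real_emb i) x)) *
  (\prod_j complexQ (mx_complex g j) (map_mx (complex_emb j) x)) ^+ 2 *
  PV (fun v => nv R v y) ^+ 2.
Proof.
move=> y0 gv; have m0 := dimK_gt0 K.
rewrite /height !exprMn; congr (_ * _ * _).
- rewrite -prodrXl; apply: eq_bigr => i _; rewrite powR_root ?muln_gt0 //.
    by apply: eq_bigr => a _; rewrite real_normK ?num_real.
  by apply: sumr_ge0 => a _; exact: sqr_ge0.
- rewrite mulnC exprM -prodrXl; congr (_ ^+ 2); apply: eq_bigr => j _; rewrite powR_root //.
    by apply: eq_bigr => a _; rewrite N2_normr.
  by apply: sumr_ge0 => a _; exact: sqr_ge0.
- rewrite mulnC exprM; congr (_ ^+ 2).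
  pose F v := nv R v y `^ m%:R^-1.
  have fF : finsupp1 F.
    have [s sP] := finsupp1_nv R y0; exists s => v; rewrite /F => Fv; apply: sP.
    by apply: contraNneq Fv => ->; rewrite powR1.
  have [_ FE] := PV_X m fF.
  transitivity (PV F ^+ m); first by congr (_ ^+ m); apply: eq_fsbigr => v _; exact: gv.
  rewrite -FE; congr PV; apply/funext => v.
  by rewrite powR_root // nv_ge0.
Qed.

(* By strong approximation, g may be moved by SL_n(K) into the product of SL_n(K_v),
   v infinite, and the maximal compact subgroups SL_n(O_v), v finite. *)
Lemma adelic_family g : SLA g -> exists c h, [/\ \det c = 1, unimodular h &
  forall x, x != 0 -> height g (c *m x) ^+ (2 * m) = Phi h x].
Proof.
move=> [dr dc df gf].
have HA v := cid (completion_approx R n_gt0 (df v)).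
pose A v := sval (HA v).
have dA v : \det (A v) = 1 by have [] := svalP (HA v).
have Ah v x : height_fin R (mx_fin g v *m map_mx (to_completion v) x) =
    nv R v (A v *m x) `^ m%:R^-1 by have [_ ? _] := svalP (HA v).
have A1 v : (forall i j, absv R (mx_fin g v i j) <= 1) ->
    forall i j, absK R v (A v i j) <= 1 by have [_ _ ?] := svalP (HA v).
have Hs i j := cid ((finite_seqP _).1 (gf i j)).
pose s i j := sval (Hs i j).
have sP i j v : ~ absv R (mx_fin g v i j) <= 1 -> v \in s i j.
  by move=> h; have := svalP (Hs i j) => sE; have : [set` s i j] v by rewrite -sE.
(* The finitely many places where g is not integral; outside T both the approximation of g and the
   matrix c are integral. *)
pose T := undup (flatten [seq s p.1 p.2 | p : 'I_n * 'I_n]).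
have [c [dc1 cT cnT]] := strong_approximation R (undup_uniq _ : uniq T) dA.
exists c, (place_family (fun i => mx_real g i *m map_mx (real_emb i) c)
                  (fun j => mx_complex g j *m map_mx (complex_emb j) c)); split=> //.
  by apply: family_unimodular => k; rewrite det_mulmx det_map_mx dc1 rmorph1 mulr1.
move=> x x0; rewrite (height_exp x0); last first.
  move=> v; rewrite Ah mulmxA nv_SL //; last by rewrite det_mulmx dA dc1 mulr1.
  have [vT|vT] := boolP (v \in T); first exact: cT.
  move=> i j; rewrite mxE absK_sum // => k _.
  rewrite absKM mulr_ile1 ?absK_ge0 ?cnT //; apply: A1 => a b.
  apply: contrapT => /sP vs; move/negP: vT; apply; rewrite mem_undup.
  by apply/flattenP; exists (s a b) => //; apply/mapP; exists (a, b); rewrite ?mem_enum.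
rewrite Phi_family; congr (_ * _ ^+ 2 * _).
  by apply: eq_bigr => k _; rewrite map_mxM /realQ mulmxA.
by apply: eq_bigr => k _; rewrite map_mxM /complexQ mulmxA.
Qed.

Lemma family_adelic h : unimodular h -> exists2 g : place_mx E n, SLA g &
  forall x, x != 0 -> height g x ^+ (2 * m) = Phi h x.
Proof.
move=> /unimodular_family[hr [hc [-> dr dc]]].
exists (PlaceMx hr hc (fun v => 1%:M)).
  split=> //= [v|i j]; first exact: det1.
  rewrite (_ : [set v | _] = set0) // -subset0 => v /=; apply.
  have -> : (1%:M : 'M[completion v]_n) i j = to_completion v (i == j)%:R.
    by rewrite mxE; case: (i == j); rewrite ?to_completion0 ?to_completion1.
  by rewrite absv_to_completion absK_OK //; exact: OK_nat.
move=> x x0; rewrite (height_exp x0) ?Phi_family // => v.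
rewrite mul1mx /height_fin; congr (_ `^ _); apply: eq_bigr => i _.
by rewrite mxE absv_to_completion.
Qed.

End Heights.

(** * Comparison of the two constants *)

Lemma minvalE (R : realType) (A : set R) a : A a -> lbound A a -> minval A = a.
Proof.
move=> Aa lA; rewrite /minval; case: xgetP => [b _ [Ab lb]|/(_ a)[]//].
by apply/eqP; rewrite eq_le lb // lA.
Qed.

Lemma maxvalE (R : realType) (A : set R) a : A a -> ubound A a -> maxval A = a.
Proof.
move=> Aa uA; rewrite /maxval; case: xgetP => [b _ [Ab ub]|/(_ a)[]//].
by apply/eqP; rewrite eq_le ub // uA.
Qed.

Lemma le_of_pow (R : realType) k (a b p q : R) : (0 < k)%N -> 0 <= a -> 0 <= b ->
  a ^+ k = p -> b ^+ k = q -> p <= q -> a <= b.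
Proof. by move=> k0 a0 b0 <- <-; rewrite ler_pXn2r ?nnegrE. Qed.

Section MinimaOfHeights.
Variables (R : realType) (K : fieldExtType rat) (E : embeddings R K) (n : nat).
Hypothesis n_gt1 : (1 < n)%N.
Local Notation C := R[i].
Local Notation m := (\dim {:K}).
Local Notation J := ('I_(nreal E) + ('I_(ncomplex E) + 'I_(ncomplex E)))%type.
Implicit Types (h : J -> 'M[C]_n) (x y : 'cV[K]_n) (g : place_mx E n).

Definition Phi_minimizer h x :=
  [/\ OKvec x, x != 0 & forall y, y != 0 -> Phi h x <= Phi h y].

Lemma minval_humbert (S : form_tuple E n) h x : Phi_minimizer h x ->
  (forall y, OKvec y -> y != 0 -> humbert_quot S y = Phi h y) ->
  minval [set humbert_quot S y | y in [set y : 'cV[K]_n | y != 0 /\ forall i, OK (y i 0)]] =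
  Phi h x.
Proof.
move=> [Ox x0 xmin] hS; apply: minvalE; first by exists x => //; exact: hS.
by move=> _ [y [y0 Oy] <-]; rewrite hS // xmin.
Qed.

(** The orbit of [e1] under SL_n(K) is the set of all nonzero vectors and is stable under c, so the
    minimum of heights is reached at c x. Stated for any H and c in order to cover both
    [family_adelic], with c = 1, and [adelic_family]. *)
Lemma minval_height (H : 'cV[K]_n -> R) c h x : Phi_minimizer h x -> \det c = 1 ->
  (forall y, y != 0 -> H (c *m y) ^+ (2 * m) = Phi h y) ->
  0 <= minval [set H (a *m e1 K n) ^+ 2 | a in [set a : 'M[K]_n | \det a = 1]] /\
  minval [set H (a *m e1 K n) ^+ 2 | a in [set a : 'M[K]_n | \det a = 1]] ^+ m = Phi h x.
Proof.
move=> [Ox x0 xmin] dc hH; have [a da ax] := SL_orbit n_gt1 x0.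
have uc : c \in unitmx by rewrite unitmxE dc unitr1.
have -> : minval [set H (a *m e1 K n) ^+ 2 | a in [set a : 'M[K]_n | \det a = 1]] =
    H (c *m x) ^+ 2.
  apply: minvalE.
    exists (c *m a); first by rewrite /= det_mulmx dc da mulr1.
    by congr (H _ ^+ 2); rewrite -mulmxA; congr (_ *m _); exact: ax.
  move=> _ [b db <-]; pose y := invmx c *m (b *m e1 K n).
  have ub : b \in unitmx by rewrite unitmxE db unitr1.
  have e0 : e1 K n != 0.
    by apply/cV0Pn; exists (Ordinal (ltnW n_gt1)); rewrite mxE oner_eq0.
  have y0 : y != 0.
    apply: contra e0 => /eqP yE; rewrite -(mulKmx ub (e1 K n)) -(mulKVmx uc (b *m _)).
    by rewrite -/y yE !mulmx0.
  have <- : c *m y = b *m e1 K n by rewrite mulKVmx.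
  have : (H (c *m x) ^+ 2) ^+ m <= (H (c *m y) ^+ 2) ^+ m.
    by rewrite -[leLHS]exprM -[leRHS]exprM (hH x x0) (hH y y0); exact: xmin.
  move: (H (c *m x)) (H (c *m y)) => u w.
  by rewrite (ler_pXn2r (dimK_gt0 K)) ?nnegrE ?sqr_ge0.
by rewrite -exprM (hH x x0); split=> //; exact: sqr_ge0.
Qed.

End MinimaOfHeights.

Theorem mainTheorem3 (R : realType) (K : fieldExtType rat) (E : embeddings R K)
    (n : nat) (hn : (2 <= n)%N) :
  gammaP E n = gammaW E n ^+ (\dim {:K}).
Proof.
have n0 : (0 < n)%N by exact: ltnW.
have m0 := dimK_gt0 K.
have [h [x [hu [Ox x0] xmin hmax]]] := Phi_max E n0.
have hx : Phi_minimizer h x by [].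
have minP (h' : 'I_(nreal E) + ('I_(ncomplex E) + 'I_(ncomplex E)) -> 'M[R[i]]_n) :
    unimodular h' -> exists2 y, Phi_minimizer h' y & Phi h' y <= Phi h x.
  move=> hu'; have [y [Oy y0 ymin]] := Phi_min n0 hu'.1 (fun k => unimodular_det_neq0 k hu').
  exists y => //; have [z [_ z0] zM] := hmax h' hu'.
  by apply: le_trans zM; exact: ymin.
(* The supremum is a maximum: the form attached to the optimal family reaches it, and every form is
   bounded through its own family. *)
have -> : gammaP E n = Phi h x.
  rewrite /gammaP; set V := [set _ | _ in _].
  have VM : ubound V (Phi h x).
    move=> _ [S Sh <-]; have [h' hu' hS] := humbert_family n0 Sh.
    have [y hy yM] := minP h' hu'.
    by rewrite (minval_humbert hy hS).
  have VV : V (Phi h x).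
    have [S Sh hS] := family_humbert n0 hu; exists S => //.
    exact: (minval_humbert hx hS).
  apply: le_anti; apply/andP; split; first by apply: ge_sup => //; exists (Phi h x).
  by apply: ub_le_sup => //; exists (Phi h x).
have [g gS gh] := family_adelic hu.
have [|w0 wE] := minval_height (H := height g) (c := 1%:M) hn hx (det1 _ _).
  by move=> y y0; rewrite mul1mx gh.
(* Remaining: the adelic matrix of the optimal family realizes the maximum defining [gammaW].
   Competing minima are nonnegative and are compared through their m-th powers, which are values of
   Phi. *)
rewrite -wE; congr (_ ^+ _); apply/esym/maxvalE; first by exists g.
move=> _ [g' gS' <-]; have [c [h' [dc hu' gh']]] := adelic_family n0 gS'.
have [y hy yM] := minP h' hu'.
have [w0' wE'] := minval_height hn hy dc gh'.
exact: (le_of_pow m0 w0' w0 wE' wE yM).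
Qed.
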